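(* Let $K$ be an imaginary quadratic number field (embedded in $\mathbb C$) whose ring of integers $\mathcal O_K$ is principal. For all $z\in\mathbb C^\times$, $\theta\in\,]0,2\pi]$ and $k\in\mathcal O_K$, as $x\to+\infty$, we have $$\sum_{a\in\mathcal O_K\cap C(z,\theta,x)}\varphi_K(a)\,\varphi_K(a+k)\ \sim\ \frac{\theta}{3\,\sqrt{|D_K|}}\ \prod_{\mathfrak p}\Big(1-\frac{2}{\mathtt N(\mathfrak p)^2}\Big)\ \prod_{\mathfrak p\,\mid\,k\mathcal O_K}\Big(1+\frac{1}{\mathtt N(\mathfrak p)\,(\mathtt N(\mathfrak p)^2-2)}\Big)\;x^6 ,$$ where $\mathfrak p$ ranges over the nonzero prime ideals of $\mathcal O_K$ (and, in the second product, over those dividing $k\mathcal O_K$, that is, containing $k$).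
   Context: $D_K$ is the discriminant of $K$. For a nonzero ideal $\mathfrak a$ of $\mathcal O_K$, $\mathtt N(\mathfrak a)=\operatorname{Card}(\mathcal O_K/\mathfrak a)$ and $\varphi_K(\mathfrak a)=\operatorname{Card}\big((\mathcal O_K/\mathfrak a)^\times\big)=\mathtt N(\mathfrak a)\prod_{\mathfrak p\mid\mathfrak a}\big(1-\frac1{\mathtt N(\mathfrak p)}\big)$; for $a\in\mathcal O_K-\{0\}$, $\varphi_K(a)=\varphi_K(a\mathcal O_K)$. Convention: $\varphi_K(0)=0$, so that a possible term with $a+k=0$ does not contribute. For ideals, $J\mid I$ means $I\subset J$; in particular every ideal divides the zero ideal (relevant when $k=0$). For $z\in\mathbb C^\times$, $\theta\in\,]0,2\pi]$ and $R\geq0$, the truncated angular sector is $$C(z,\theta,R)=\Big\{\rho\,e^{it}z:\ t\in\,\big]-\tfrac\theta2,\tfrac\theta2\big],\ 0<\rho\leq\tfrac{R}{|z|}\Big\}\subset\mathbb C .$$ *)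

(* Defs.v *)
From HB Require Import structures.
From mathcomp Require Import all_boot all_order all_algebra all_field.
From mathcomp Require Import finmap complex.
From mathcomp Require Import all_classical all_reals all_analysis.
From mathcomp.analysis.showcase Require Import summability.

Set Implicit Arguments.
Unset Strict Implicit.
Unset Printing Implicit Defensive.

Import Order.TTheory GRing.Theory Num.Theory.
Import numFieldNormedType.Exports.

Local Open Scope classical_set_scope.
Local Open Scope ring_scope.
Local Open Scope complex_scope.

(* Cardinality of a finite set (0 when the set is infinite). *)
Definition ncard (T : choiceType) (S : set T) : nat := #|` fset_set S|.

(* Product of an unordered family: limit of the finite partial products along
   the filter of finite sets of indices directed by inclusion. *)
Definition unordered_prod (R : realType) (I : choiceType) (P : set I)
    (F : I -> R) : R :=
  lim ((fun J : {fset I} => \prod_(i <- J | i \in P) F i) @ totally).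

(* Lets the asymptotic notations of landau.v be used at +oo. *)
Canonical pinfty_filter_on (R : realType) :=
  FilterType (pinfty_nbhs R) (@filter_filter R _ proper_pinfty_nbhs).

Section Ideals.
Variable A : comNzRingType.
Implicit Types (I J : set A) (a x y : A).

Definition is_ideal I : Prop :=
  [/\ I 0, forall x y, I x -> I y -> I (x + y) & forall a x, I x -> I (a * x)].

Definition is_prime_ideal I : Prop :=
  [/\ is_ideal I, ~ I 1 & forall x y, I (x * y) -> I x \/ I y].

Definition pideal a : set A := [set a * x | x in [set: A]].

Definition is_principal_ring : Prop :=
  forall I, is_ideal I -> exists a, I = pideal a.

Definition ideal_dvd J I : Prop := I `<=` J.

(* The quotient A / I is represented by the set of residue classes; this also
   covers I = A, where the quotient is the zero ring. *)
Definition residue I x : set A := [set y | I (y - x)].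

Definition quotient I : set (set A) := [set residue I x | x in [set: A]].

Definition quotient_units I : set (set A) :=
  [set residue I x | x in [set x | exists y, residue I (x * y) = residue I 1]].

Definition idealN I : nat := ncard (quotient I).

(* The value at 0 is a convention: A / 0 = A may well have finitely many units. *)
Definition phi a : nat :=
  if a == 0 then 0%N else ncard (quotient_units (pideal a)).

Definition nz_prime_ideals : set (set A) :=
  [set p | is_prime_ideal p /\ p <> [set 0]].

End Ideals.

Section NumberField.
Variable K : fieldExtType rat.

Definition algint : {pred K} :=
  fun x => `[< integralOver (intr : int -> K) x >].

Fact algint_subring : subring_closed algint.
Proof.
split=> [|x y /asboolP ix /asboolP iy|x y /asboolP ix /asboolP iy];
  apply/asboolP.
- exact: integral1.
- exact: integral_sub.
- exact: integral_mul.
Qed.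

HB.instance Definition _ := GRing.isSubringClosed.Build K algint algint_subring.

(* The ring of integers of K. *)
Record OK : predArgType := MkOK { OKval :> K; _ : OKval \in algint }.

HB.instance Definition _ := [isSub for OKval].
HB.instance Definition _ := [Choice of OK by <:].
HB.instance Definition _ := [SubChoice_isSubComNzRing of OK by <:].

(* Tr_{K/Q}(x) *)
Definition trK (x : K) : rat := \tr (passmx.mxof (vbasis {:K}) (vbasis {:K}) (amulr x)).

Definition integral_basis (n : nat) (w : 'I_n -> OK) : Prop :=
  forall x : OK, exists! c : 'rV[int]_n, x = \sum_i w i *~ c 0 i.

(* D_K, the common value of the discriminants of all integral bases. *)
Definition disc : rat :=
  xget 0 [set d : rat | exists w : 'I_(\dim {:K}) -> OK,
    integral_basis w /\ d = \det (\matrix_(i, j) trK (OKval (w i) * OKval (w j)))].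

End NumberField.

(* The norm of R[i] takes its values in R[i], hence the real part of `|z|;
   cos t +i* sin t stands for exp(it). *)
Definition sector (R : realType) (z : R[i]) (theta r : R) : set R[i] :=
  [set w | exists t rho : R,
    [/\ - (theta / 2) < t <= theta / 2, 0 < rho <= r / complex.Re `|z| &
        w = rho%:C * (cos t +i* sin t) * z]].

(* Main.v *)
Require Import Defs.
From HB Require Import structures.
From mathcomp Require Import all_boot all_order all_algebra all_field.
From mathcomp Require Import finmap complex.
From mathcomp Require Import all_classical all_reals all_analysis.
From mathcomp.analysis.showcase Require Import summability.
From mathcomp Require Import ring lra zify.

Set Implicit Arguments.
Unset Strict Implicit.
Unset Printing Implicit Defensive.

Import Order.TTheory GRing.Theory Num.Theory.
Import numFieldNormedType.Exports.

Local Open Scope classical_set_scope.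
Local Open Scope ring_scope.
Local Open Scope complex_scope.

(** The ring of integers is a lattice [Z + Z tau] in the complex plane, and
    the theorem is a statement about averages over lattice points.

    Write [phi a = N(a) f(a)] with [f(a)] the product of [1 - 1 / N P] over the
    primes [P] containing [a]. The sum of [N(a) N(a + k) f(a) f(a + k)] over a
    sector then follows by summation by parts ([abel_nrm_shift]) from the mean
    value of [f(a) f(a + k)] over sectors ([correlation_density]); the weights
    only contribute the factor 1/3, the integral of [r ^ 4 d(r ^ 2)] on [[0,1]].

    The function [f] is a limit of periodic functions. If only the primes of a
    finite set [J] are kept in the product, the error at [a] is at most the sum
    of [1 / N P] over the primes [P] outside [J] containing [a]. A disc of
    radius [x] contains [O(x ^ 2 / N P)] nonzero points of [P], and [1 / N P ^ 2]
    is summable, because distinct primes have distinct generators and the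
    lattice has [O(r ^ 2)] nonzero points in the disc of radius [r]. So the
    error is small on average ([euler_trunc_average]).

    A function with period an integer [M] has the same density in every
    sector, namely its mean over the residues modulo [M]
    ([cone_density_periodic]). In a triangle with apex 0 and one side along the
    lattice rows, row by row counting gives this with an explicit error. A thin
    cone of directions lies between two such triangles whose areas differ to
    second order in the angle, and a sector is cut into many thin cones.

    The mean over residues is invariant under translations. Hence it gives the
    same weight to all classes modulo an ideal, and more generally it makes
    conditions modulo distinct primes independent ([qmean_class],
    [qmean_prime_product]). This one fact gives the formula for [phi]
    ([phiE]), where being a unit modulo [a] means avoiding the primes over [a],
    and the local densities of [f(a) f(a + k)] ([euler_trunc_mean]): they are
    [1 - 2 / N P ^ 2] when [P] does not contain [k], and
    [1 - 2 / N P ^ 2 + 1 / N P ^ 3] when it does. That the quotient by [a] has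
    [N(a)] classes also comes from densities, by comparing the multiples of [a]
    in a disc with the disc shrunk by [|a|] ([idealN_pideal]).

    Finally the ring of integers of an imaginary quadratic field is such a
    lattice ([OK_quad_order]), and the area of a fundamental domain is half the
    square root of the absolute value of the discriminant ([disc_covol]). *)

#[local] Existing Instance totally_filter.

(** * Sums over finite sets *)

Section FiniteSums.
Variables (R : realType) (I : choiceType).
Implicit Types (S : set I) (f g : I -> R).

Lemma fsumD S f g : finite_set S ->
  \sum_(i \in S) (f i + g i) = \sum_(i \in S) f i + \sum_(i \in S) g i.
Proof. by move=> fS; rewrite fsbig_split. Qed.

Lemma fsumN S f : \sum_(i \in S) (- f i) = - \sum_(i \in S) f i.
Proof.
rewrite -mulN1r mulr_fsumr.
by under [RHS]eq_fsbigr do rewrite mulN1r.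
Qed.

Lemma fsumB S f g : finite_set S ->
  \sum_(i \in S) (f i - g i) = \sum_(i \in S) f i - \sum_(i \in S) g i.
Proof. by move=> fS; rewrite fsumD // fsumN. Qed.

Lemma ler_fsum S f g : finite_set S -> (forall i, S i -> f i <= g i) ->
  \sum_(i \in S) f i <= \sum_(i \in S) g i.
Proof.
move=> fS fg; rewrite -subr_ge0 -fsumB //; apply: fsumr_ge0 => i Si.
by rewrite subr_ge0 fg.
Qed.

Lemma ler_norm_fsum S f : finite_set S ->
  `|\sum_(i \in S) f i| <= \sum_(i \in S) `|f i|.
Proof. by move=> fS; rewrite !fsbig_finite //; exact: ler_norm_sum. Qed.

Lemma fsum_setID S T f : finite_set T -> S `<=` T ->
  \sum_(i \in T) f i = \sum_(i \in S) f i + \sum_(i \in T `\` S) f i.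
Proof.
move=> fT ST; rewrite (fsbigID S) //.
by rewrite (_ : T `&` S = S) ?setDE //; apply/setIidPr.
Qed.

Lemma ler_fsum_sub S T f : finite_set T -> S `<=` T ->
  (forall i, T i -> 0 <= f i) -> \sum_(i \in S) f i <= \sum_(i \in T) f i.
Proof.
move=> fT ST f0; rewrite (fsum_setID f fT ST) lerDl.
by apply: fsumr_ge0 => i [Ti _]; exact: f0.
Qed.

(** Counts are written as sums of the constant [1], so that they share the
    lemmas on weighted sums. *)
Lemma fsum1_le_size S (r : seq I) : S `<=` [set` r] ->
  \sum_(i \in S) (1 : R) <= (size r)%:R.
Proof.
move=> Sr; have fr : finite_set [set` undup r] by exact: finite_seq.
apply: (@le_trans _ _ (\sum_(i \in [set` undup r]) (1 : R))).
  by apply: ler_fsum_sub => // i /Sr /=; rewrite mem_undup.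
rewrite -(fsbig_seq _ _ (undup_uniq r)) big_const_seq count_predT iter_addr_0.
by rewrite ler_nat size_undup.
Qed.

(** Used to squeeze the sum over a cone between sums over triangles: only the
    counts need to be monotone, the function itself may have any sign. *)
Lemma fsum_nested_le S T f : finite_set T -> S `<=` T ->
  (forall i, `|f i| <= 1) ->
  `|\sum_(i \in T) f i - \sum_(i \in S) f i| <=
    \sum_(i \in T) (1 : R) - \sum_(i \in S) (1 : R).
Proof.
move=> fT ST f1.
rewrite (fsum_setID f fT ST) (fsum_setID (fun=> 1 : R) fT ST).
rewrite [X in X - _]addrC addrK [X in _ <= X - _]addrC addrK.
have fD : finite_set (T `\` S) by exact: finite_setD.
by apply: le_trans (ler_norm_fsum _ fD) _; exact: ler_fsum.
Qed.

End FiniteSums.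

(** * Lattices in the complex plane *)

(** What is used of the ring of integers of an imaginary quadratic field: it is
    a lattice [Z + Z tau] stable under multiplication, with integral norms, and
    every element divides its norm. The coordinates and the conjugation are
    data rather than existence statements to avoid repeated choices. *)
Record quad_order (R : realType) (A : comNzRingType) := QuadOrder {
  emb : {rmorphism A -> R[i]};
  tau : A;
  scoord : A -> int;
  tcoord : A -> int;
  coordE : forall a, a = (scoord a)%:~R + (tcoord a)%:~R * tau;
  tau_im : 0 < complex.Im (emb tau);
  nrm : A -> nat;
  nrmE : forall a,
    (nrm a)%:R = complex.Re (emb a) ^+ 2 + complex.Im (emb a) ^+ 2;
  conjA : A -> A;
  mul_conjA : forall a, a * conjA a = (nrm a)%:R }.

Section Coordinates.
Variables (R : realType) (A : comNzRingType) (L : quad_order R A).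
Implicit Types (a b : A) (s t : int).

Definition re a : R := complex.Re (emb L a).
Definition im a : R := complex.Im (emb L a).
Definition covol : R := im (tau L).
Definition pt s t : A := s%:~R + t%:~R * tau L.

Lemma covol_gt0 : 0 < covol. Proof. exact: tau_im. Qed.

Lemma emb_intr s : emb L s%:~R = (s%:~R)%:C.
Proof. by rewrite !rmorph_int. Qed.

Lemma reD a b : re (a + b) = re a + re b.
Proof. by rewrite /re rmorphD; case: (emb L a) (emb L b) => [? ?] []. Qed.

Lemma imD a b : im (a + b) = im a + im b.
Proof. by rewrite /im rmorphD; case: (emb L a) (emb L b) => [? ?] []. Qed.

Lemma reN a : re (- a) = - re a.
Proof. by rewrite /re rmorphN; case: (emb L a). Qed.

Lemma imN a : im (- a) = - im a.
Proof. by rewrite /im rmorphN; case: (emb L a). Qed.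

Lemma re_pt s t : re (pt s t) = s%:~R + t%:~R * re (tau L).
Proof.
rewrite reD /re rmorphM !emb_intr /=; case: (emb L (tau L)) => x y /=.
by rewrite mul0r subr0.
Qed.

Lemma im_pt s t : im (pt s t) = t%:~R * covol.
Proof.
rewrite imD /covol /im rmorphM !emb_intr /=; case: (emb L (tau L)) => x y /=.
by rewrite mul0r addr0 add0r.
Qed.

Lemma ptE a : a = pt (scoord L a) (tcoord L a).
Proof. exact: coordE. Qed.

Lemma pt_inj s t s' t' : pt s t = pt s' t' -> s = s' /\ t = t'.
Proof.
move=> e; have := congr1 im e; rewrite !im_pt => /(mulIf (lt0r_neq0 covol_gt0)).
move=> /intr_inj tt; have := congr1 re e; rewrite !re_pt tt.
by move=> /addIr /intr_inj.
Qed.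

Lemma re_im_inj a b : re a = re b -> im a = im b -> a = b.
Proof.
rewrite (ptE a) (ptE b) !re_pt !im_pt => + /(mulIf (lt0r_neq0 covol_gt0)).
by move=> + /intr_inj e; rewrite e => /addIr /intr_inj ->.
Qed.

Lemma ptD s t s' t' : pt s t + pt s' t' = pt (s + s') (t + t').
Proof. by rewrite /pt !rmorphD /= mulrDl addrACA. Qed.

Lemma nrm_re_im a : (nrm L a)%:R = re a ^+ 2 + im a ^+ 2.
Proof. exact: nrmE. Qed.

Lemma reM a b : re (a * b) = re a * re b - im a * im b.
Proof. by rewrite /re /im rmorphM; case: (emb L a) (emb L b) => [? ?] []. Qed.

Lemma imM a b : im (a * b) = re a * im b + im a * re b.
Proof. by rewrite /re /im rmorphM; case: (emb L a) (emb L b) => [? ?] []. Qed.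

Lemma re1 : re 1 = 1. Proof. by rewrite /re rmorph1. Qed.
Lemma im1 : im 1 = 0. Proof. by rewrite /im rmorph1. Qed.
Lemma re0 : re 0 = 0. Proof. by rewrite /re rmorph0. Qed.
Lemma im0 : im 0 = 0. Proof. by rewrite /im rmorph0. Qed.

Lemma nrmM a b : nrm L (a * b) = (nrm L a * nrm L b)%N.
Proof.
apply/eqP; rewrite -(eqr_nat R) natrM !nrm_re_im reM imM; apply/eqP; ring.
Qed.

Lemma nrm_eq0 a : (nrm L a == 0)%N = (a == 0).
Proof.
apply/idP/eqP => [|->].
  rewrite -(eqr_nat R) nrm_re_im paddr_eq0 ?sqr_ge0 // !sqrf_eq0.
  by move=> /andP[/eqP r0 /eqP i0]; apply: re_im_inj; rewrite ?re0 ?im0.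
rewrite -(eqr_nat R) nrm_re_im re0 im0; apply/eqP; ring.
Qed.

Lemma nrm_gt0 a : a != 0 -> (0 < nrm L a)%N.
Proof. by rewrite -nrm_eq0 lt0n. Qed.

Lemma mulA_eq0 a b : (a * b == 0) = (a == 0) || (b == 0).
Proof. by rewrite -!nrm_eq0 nrmM muln_eq0. Qed.

Lemma mulA_inj a : a != 0 -> injective (fun b : A => a * b).
Proof.
move=> a0 b c /= e; have : a * (b - c) == 0 by rewrite mulrBr e subrr.
by rewrite mulA_eq0 (negbTE a0) /= subr_eq0 => /eqP.
Qed.

End Coordinates.

(** * Periodic functions of one integer *)

Lemma ler_norm_sum_ord (R : realType) n (f : nat -> R) c :
  (forall i, `|f i| <= c) -> `|\sum_(0 <= i < n) f i| <= n%:R * c.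
Proof.
move=> fc; rewrite big_mkord; apply: le_trans (ler_norm_sum _ _ _) _.
rewrite mulr_natl -[n in _ *+ n]card_ord -sumr_const.
exact: ler_sum.
Qed.

Section PeriodicSums.
Variables (R : realType) (M : nat) (h : int -> R).
Hypotheses (M_gt0 : (0 < M)%N) (h_per : forall s, h (s + M%:Z) = h s)
  (h_le1 : forall s, `|h s| <= 1).

Definition pmean : R := M%:R^-1 * \sum_(i < M) h i%:Z.

Lemma periodic_sum_shift (s : int) :
  \sum_(i < M) h (s + i%:Z) = \sum_(i < M) h i%:Z.
Proof.
have step (r : int) : \sum_(i < M) h (r + 1 + i%:Z) = \sum_(i < M) h (r + i%:Z).
  have : \sum_(i < M.+1) h (r + i%:Z) = \sum_(i < M.+1) h (r + i%:Z) by [].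
  rewrite {1}big_ord_recl big_ord_recr /= h_per addr0 [RHS]addrC => /addrI <-.
  by apply: eq_bigr => i _; congr h; rewrite /bump leq0n -addrA -PoszD.
elim/int_ind: s => [|n IH|n IH].
- by apply: eq_bigr => i _; rewrite add0r.
- by rewrite -addn1 PoszD step.
- by rewrite -step -addn1 PoszD opprD subrK.
Qed.

Lemma pmean_le1 : `|pmean| <= 1.
Proof.
rewrite /pmean normrM normfV (@ger0_norm _ M%:R) // mulrC ler_pdivrMr ?ltr0n // mul1r.
rewrite -(big_mkord xpredT (fun i => h i%:Z)) -[leRHS]mulr1.
exact: ler_norm_sum_ord.
Qed.

(** Complete periods contribute exactly their mean; what is left is shorter
    than a period. *)
Lemma periodic_window (s : int) (n : nat) :
  `|\sum_(0 <= i < n) h (s + i%:Z) - n%:R * pmean| <= 2 * M%:R.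
Proof.
elim/ltn_ind: n s => n IH s; have [nM|Mn] := ltnP n M; last first.
  have -> : \sum_(0 <= i < n) h (s + i%:Z) =
      \sum_(i < M) h (s + i%:Z) + \sum_(0 <= i < n - M) h (s + M%:Z + i%:Z).
    rewrite (big_cat_nat (leq0n _) Mn) /= big_mkord; congr (_ + _).
    rewrite -{1}[M]add0n big_addn; apply: eq_bigr => i _.
    by congr h; rewrite PoszD; ring.
  rewrite periodic_sum_shift -[n in n%:R](subnKC Mn) natrD mulrDl {2}/pmean.
  rewrite mulVKf ?pnatr_eq0 -?lt0n // opprD addrACA subrr add0r.
  by apply: IH; rewrite ltn_subrL M_gt0 (leq_trans M_gt0 Mn).
apply: le_trans (ler_normB _ _) _.
rewrite (_ : 2 * M%:R = M%:R + M%:R); last by ring.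
have nMR : n%:R <= M%:R :> R by rewrite ler_nat ltnW.
apply: lerD; apply: le_trans nMR.
  by rewrite -[leRHS]mulr1; exact: ler_norm_sum_ord.
by rewrite normrM ger0_norm // ler_piMr // pmean_le1.
Qed.

(** The integers of [[a, b[] start at [ceil a] and their number is within 1 of
    [b - a]. Half-open intervals are used because they tile the line. *)
Lemma periodic_interval (a b : R) : a <= b ->
  `|\sum_(0 <= i < `|Num.ceil b - Num.ceil a|%N) h (Num.ceil a + i%:Z)
    - (b - a) * pmean| <= 2 * M%:R + 1.
Proof.
move=> ab; set n := `|_|%N.
have nE : n%:R = (Num.ceil b)%:~R - (Num.ceil a)%:~R :> R.
  by rewrite /n natr_absz ger0_norm ?subr_ge0 ?ceil_le ?rmorphB.
have := periodic_window (Num.ceil a) n; set S := \sum_(_ <= _ < _) _ => Sn.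
have : `|n%:R - (b - a)| <= 1.
  rewrite nE ler_norml.
  have := ceil_itv a; have := ceil_itv b; rewrite !rmorphB /=; lra.
move=> nab; have -> : S - (b - a) * pmean =
    S - n%:R * pmean + (n%:R - (b - a)) * pmean by ring.
apply: le_trans (ler_normD _ _) _; apply: lerD => //.
by rewrite normrM mulr_ile1 // pmean_le1.
Qed.

(** Summation by parts: a linear weight turns the mean into half of it. *)
Lemma periodic_weighted (n : nat) :
  `|\sum_(0 <= i < n) i.+1%:R * h (i.+1)%:Z - pmean * n%:R ^+ 2 / 2|
     <= (4 * M%:R + 1) * n%:R.
Proof.
pose P k := \sum_(0 <= i < k) h (1 + i%:Z).
have -> : \sum_(0 <= i < n) i.+1%:R * h (i.+1)%:Z =
    n%:R * P n - \sum_(0 <= k < n) P k.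
  elim: n => [|n IH]; first by rewrite !big_geq // mul0r subr0.
  rewrite big_nat_recr //= IH [in RHS]big_nat_recr //= /P big_nat_recr //=.
  by rewrite -[in RHS](PoszD 1 n) add1n -[n.+1%:R](natr1); ring.
pose e k := P k - k%:R * pmean.
have eM k : `|e k| <= 2 * M%:R by exact: periodic_window.
have sumP : \sum_(0 <= k < n) P k =
    pmean * (n%:R ^+ 2 - n%:R) / 2 + \sum_(0 <= k < n) e k.
  elim: n => [|n IH]; first by rewrite !big_geq // expr0n /=; field.
  by rewrite !big_nat_recr //= IH /e -[n.+1%:R](natr1); field.
rewrite sumP (_ : P n = n%:R * pmean + e n); last by rewrite /e; ring.
have -> : n%:R * (n%:R * pmean + e n) -
   (pmean * (n%:R ^+ 2 - n%:R) / 2 + \sum_(0 <= k < n) e k) -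
   pmean * n%:R ^+ 2 / 2 =
   n%:R * e n - \sum_(0 <= k < n) e k + pmean * n%:R / 2 by field.
have s_e : `|\sum_(0 <= k < n) e k| <= n%:R * (2 * M%:R).
  exact: ler_norm_sum_ord.
have n_e : `|n%:R * e n| <= n%:R * (2 * M%:R).
  by rewrite normrM ger0_norm // ler_wpM2l.
have p_e : `|pmean * n%:R / 2| <= n%:R.
  rewrite -mulrA normrM; apply: (@le_trans _ _ (1 * `|n%:R / 2 : R|)).
    by rewrite ler_wpM2r // pmean_le1.
  rewrite mul1r ger0_norm ?divr_ge0 // ler_pdivrMr // ler_peMr //.
  by rewrite ler1n.
apply: le_trans (ler_normD _ _) _.
apply: (@le_trans _ _ (n%:R * (2 * M%:R) + n%:R * (2 * M%:R) + n%:R)).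
  apply: lerD => //; apply: le_trans (ler_normB _ _) _; exact: lerD.
lra.
Qed.

End PeriodicSums.

(** * Counting by rows *)

Section Rows.
Variables (R : realType) (A : comNzRingType) (L : quad_order R A).
Implicit Types (a b : A) (s t : int) (g : A -> R).

(** An enumeration without repetition of the lattice points of a region that
    meets each row in an interval; triangles are of this kind, and discs and
    cones are contained in such regions. *)
Definition rows t0 (T : nat) (lo : int -> int) (n : int -> nat) : seq A :=
  [seq pt L (lo (t0 + j%:Z) + i%:Z) (t0 + j%:Z)
  | j <- iota 0 T, i <- iota 0 (n (t0 + j%:Z))].

Lemma sum_rows t0 T lo n g :
  \sum_(a <- rows t0 T lo n) g a =
  \sum_(0 <= j < T) \sum_(0 <= i < n (t0 + j%:Z))
     g (pt L (lo (t0 + j%:Z) + i%:Z) (t0 + j%:Z)).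
Proof.
rewrite /rows big_allpairs_dep /index_iota !subn0.
by apply: eq_bigr => j _; rewrite subn0.
Qed.

Lemma uniq_rows t0 T lo n : uniq (rows t0 T lo n).
Proof.
apply: allpairs_uniq_dep => [|j _|]; [exact: iota_uniq|exact: iota_uniq|].
move=> [j i] [j' i'] _ _ /= /pt_inj[+ /addrI[jj]]; rewrite jj => /addrI[ii].
by rewrite ii.
Qed.

Lemma mem_rows t0 T lo n a :
  (a \in rows t0 T lo n) =
  (t0 <= tcoord L a < t0 + T%:Z) &&
  (lo (tcoord L a) <= scoord L a < lo (tcoord L a) + (n (tcoord L a))%:Z).
Proof.
apply/allpairsPdep/idP.
  move=> [j [i []]]; rewrite !mem_iota !add0n => jT iN ae.
  have [ss tt] : scoord L a = lo (t0 + j%:Z) + i%:Z /\ tcoord L a = t0 + j%:Z.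
    by apply: (@pt_inj _ _ L); rewrite -ae -ptE.
  by rewrite ss tt; lia.
move=> /andP[/andP[t0t tT] /andP[ss sn]].
have tE : t0 + `|tcoord L a - t0|%N%:Z = tcoord L a by lia.
exists `|tcoord L a - t0|%N, `|scoord L a - lo (tcoord L a)|%N.
rewrite !mem_iota !add0n tE; split; [lia|lia|].
by rewrite [LHS](ptE L); congr (pt L _ _); lia.
Qed.

Lemma size_rows_le t0 T lo n m :
  (forall t, (n t <= m)%N) -> (size (rows t0 T lo n) <= T * m)%N.
Proof.
move=> nm; rewrite size_allpairs_dep -[T in (_ <= T * _)%N](size_iota 0).
by elim: (iota 0 T) => //= j r IH; rewrite size_iota mulSn leq_add.
Qed.

Definition periodic_mod (M : nat) g := forall a b, g (a + M%:R * b) = g a.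

(** An iterated mean, over the box of coordinates in [[0, M[], which represents
    each residue modulo [M] once: the lemmas on functions of one integer apply
    to each coordinate in turn. *)
Definition qmean (M : nat) g : R :=
  M%:R^-1 * \sum_(j < M) (M%:R^-1 * \sum_(i < M) g (pt L i%:Z j%:Z)).

(** Apex 0, one side at height [H], the other two with inverse slopes [u] and
    [v]; half-open so that triangles with a common side do not overlap. *)
Definition triangle u v H : set A :=
  [set a | [/\ 0 < im L a <= H, u * im L a <= re L a & re L a < v * im L a]].

Lemma finite_rows (S : set A) t0 T lo n :
  (forall a, S a -> a \in rows t0 T lo n) -> finite_set S.
Proof.
by move=> Sr; apply: (sub_finite_set (B := [set` rows t0 T lo n])) => //.
Qed.

(** On each row a triangle with apex [0] and a horizontal side cuts an interval
    whose length is proportional to the height, so the weighted mean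
    applies. *)
Lemma triangle_sum M g u v H : (0 < M)%N -> periodic_mod M g ->
  (forall a, `|g a| <= 1) -> u <= v -> 0 <= H ->
  finite_set (triangle u v H) /\
  `|\sum_(a \in triangle u v H) g a
     - qmean M g * (v - u) * H ^+ 2 / (2 * covol L)|
  <= ((v - u) * (4 * M%:R + 2) + (2 * M%:R + 1) / covol L) * H.
Proof.
move=> M0 gper g1 uv H0; set I := covol L; have I0 : 0 < I := covol_gt0 L.
pose al := u * I - re L (tau L); pose be := v * I - re L (tau L).
pose T := Num.truncn (H / I).
pose lo t := Num.ceil (al * t%:~R).
pose n t := `|Num.ceil (be * t%:~R) - Num.ceil (al * t%:~R)|%N.
have reE a : re L a = (scoord L a)%:~R + (tcoord L a)%:~R * re L (tau L).
  by rewrite {1}(ptE L a) re_pt.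
have imE a : im L a = (tcoord L a)%:~R * I by rewrite {1}(ptE L a) im_pt.
have HI : 0 <= H / I by rewrite divr_ge0 // ltW.
have albe t : 0 < t -> al * t%:~R <= be * t%:~R :> R.
  move=> t0; apply: ler_wpM2r; first by rewrite ler0z ltW.
  by rewrite /al /be lerD2r ler_wpM2r // ltW.
have mem a : triangle u v H a <-> a \in rows 1 T lo n.
  rewrite mem_rows /triangle /= imE reE.
  have -> : (0 < (tcoord L a)%:~R * I <= H) = (1 <= tcoord L a < 1 + T%:Z).
    rewrite pmulr_lgt0 // ltr0z -ler_pdivlMr //.
    have -> : ((tcoord L a)%:~R <= H / I) = (tcoord L a <= T%:Z).
      by rewrite -floor_ge_int /T truncn_floor HI gez0_abs // floor_ge0.
    lia.
  split.
    move=> [ht h1 h2]; rewrite ht /=.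
    have t0 : 0 < tcoord L a by lia.
    have cc := le_ceil (albe _ t0); rewrite /n gez0_abs ?subr_ge0 // /lo.
    rewrite addrCA subrr addr0 ceil_le_int ltNge ceil_le_int -ltNge.
    by rewrite /al /be !mulrBl; lra.
  move=> /andP[ht]; have t0 : 0 < tcoord L a by lia.
  have cc := le_ceil (albe _ t0); rewrite /n gez0_abs ?subr_ge0 // /lo.
  rewrite addrCA subrr addr0 ceil_le_int ltNge ceil_le_int -ltNge.
  rewrite /al /be !mulrBl => h; split=> //; lra.
split; first by apply: finite_rows => a /mem; exact.
have -> : triangle u v H = [set` rows 1 T lo n].
  by apply/seteqP; split=> a /mem.
rewrite -(fsbig_seq _ _ (uniq_rows _ _ _ _)) sum_rows.
pose m t := pmean M (fun s => g (pt L s t)).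
have gperZ a (b : A) : g (a + M%:R * b) = g a by [].
have m1 t : `|m t| <= 1 by apply: pmean_le1.
have row_per t s : g (pt L (s + M%:Z) t) = g (pt L s t).
  rewrite -[RHS](gper _ 1); congr g; rewrite /pt rmorphD /= mulr1.
  by rewrite -pmulrn; ring.
have m_per t : m (t + M%:Z) = m t.
  rewrite /m /pmean; congr (_ * _); apply: eq_bigr => i _.
  rewrite -[RHS](gper _ (tau L)); congr g; rewrite /pt rmorphD /=.
  by rewrite -pmulrn; ring.
have rowE t : 0 < t ->
  `|\sum_(0 <= i < n t) g (pt L (lo t + i%:Z) t)
     - (v - u) * I * (t%:~R * m t)| <= 2 * M%:R + 1.
  move=> t0; rewrite (_ : (v - u) * I * (t%:~R * m t) =
    (be * t%:~R - al * t%:~R) * m t); last by rewrite /be /al; ring.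
  exact: (periodic_interval M0 (row_per t) (fun s => g1 _) (albe t t0)).
have mw := @periodic_weighted _ _ m M0 m_per m1 T.
have -> : qmean M g = pmean M m by [].
set E := pmean M m in mw *.
have E1 : `|E| <= 1 by apply: pmean_le1.
clearbody E.
pose r j := \sum_(0 <= i < n (1 + j%:Z)) g (pt L (lo (1 + j%:Z) + i%:Z) (1 + j%:Z))
     - (v - u) * I * (j.+1%:R * m j.+1%:Z).
have rb j : `|r j| <= 2 * M%:R + 1 by have := rowE (1 + j%:Z) isT.
have -> : \sum_(0 <= j < T) \sum_(0 <= i < n (1 + j%:Z))
     g (pt L (lo (1 + j%:Z) + i%:Z) (1 + j%:Z)) =
  \sum_(0 <= j < T) r j + (v - u) * I * \sum_(0 <= j < T) (j.+1%:R * m j.+1%:Z).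
  by rewrite mulr_sumr -big_split /=; apply: eq_bigr => j _; rewrite /r subrK.
set W := \sum_(0 <= j < T) (_ * _) in mw *.
have sr := ler_norm_sum_ord T rb; set Sr := \sum_(0 <= j < T) r j in sr *.
have /andP[TH HT] := truncn_itv HI; rewrite -/T in TH HT.
have e1 : (v - u) * I * (W - E * T%:R ^+ 2 / 2) + (v - u) * I * E * (T%:R ^+ 2 - (H / I) ^+ 2) / 2 + Sr
   = Sr + (v - u) * I * W - E * (v - u) * H ^+ 2 / (2 * I).
  by field; rewrite gt_eqF.
rewrite -e1 {e1}; set vu := v - u; have vu0 : 0 <= vu by rewrite subr_ge0.
have TT : `|T%:R ^+ 2 - (H / I) ^+ 2| <= 2 * (H / I).
  rewrite -natr1 in HT; have T0 : 0 <= T%:R :> R by [].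
  by rewrite ler_norml; nra.
have M0' : 0 <= M%:R :> R by [].
apply: le_trans (ler_normD _ _) _; apply: le_trans (lerD (ler_normD _ _) (lexx _)) _.
have vI : 0 <= vu * I by rewrite mulr_ge0 // ltW.
have b1 : `|vu * I * (W - E * T%:R ^+ 2 / 2)| <= vu * I * ((4 * M%:R + 1) * (H / I)).
  rewrite normrM (ger0_norm vI) ler_wpM2l //; apply: le_trans mw _.
  by rewrite ler_wpM2l // addr_ge0 // mulr_ge0.
have b2 : `|vu * I * E * (T%:R ^+ 2 - (H / I) ^+ 2) / 2| <= vu * I * (H / I).
  rewrite -!mulrA !normrM (ger0_norm vu0) (gtr0_norm I0).
  apply: ler_wpM2l => //; apply: ler_wpM2l; first exact: ltW.
  set d := `|_ - _| in TT *.
  rewrite (@ger0_norm _ 2^-1) //.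
  have d0 : 0 <= d := normr_ge0 _.
  have : `|E| * (d / 2) <= 1 * (d / 2) by rewrite ler_wpM2r // divr_ge0.
  lra.
have b3 : `|Sr| <= (2 * M%:R + 1) * (H / I).
  by apply: le_trans sr _; rewrite mulrC ler_wpM2l // addr_ge0 // mulr_ge0.
apply: le_trans (lerD (lerD b1 b2) b3) _.
rewrite le_eqVlt; apply/orP; left; apply/eqP; field.
by rewrite gt_eqF.
Qed.

End Rows.

(** * Cones of directions *)

Section Trigonometry.
Variable R : realType.
Implicit Types (s t d : R).

Lemma sin_lipschitz s t : s <= t -> `|sin t - sin s| <= t - s.
Proof.
move=> st; have [c _ ->] := MVT_segment st (fun x _ => is_derive_sin x)
  (continuous_subspaceT (@continuous_sin R)).
rewrite normrM (@ger0_norm _ (t - s)) ?subr_ge0 // ler_piMl ?subr_ge0 //.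
exact: cos_max.
Qed.

Lemma cos_lipschitz s t : s <= t -> `|cos t - cos s| <= t - s.
Proof.
move=> st; have [c _ ->] := MVT_segment st (fun x _ => is_derive_cos x)
  (continuous_subspaceT (@continuous_cos R)).
rewrite normrM (@ger0_norm _ (t - s)) ?subr_ge0 // ler_piMl ?subr_ge0 //.
by rewrite normrN sin_max.
Qed.

Lemma sin_le_id d : 0 <= d -> sin d <= d.
Proof.
by move=> /sin_lipschitz; rewrite sin0 !subr0 => /(le_trans (ler_norm _)).
Qed.

Lemma sin_ge_quadratic d : 0 <= d -> d - d ^+ 2 <= sin d.
Proof.
move=> d0; have [c cd e] := MVT_segment d0 (fun x _ => is_derive_sin x)
  (continuous_subspaceT (@continuous_sin R)).
move: cd e; rewrite in_itv /= sin0 !subr0 => /andP[c0 cd] ->.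
have := cos_lipschitz c0; rewrite cos0 subr0 ler_norml => /andP[h _].
have : (1 - d) * d <= cos c * d by rewrite ler_wpM2r //; lra.
lra.
Qed.

Lemma cos_eq1 t : - (2 * pi) < t < 2 * pi -> cos t = 1 -> t = 0.
Proof.
move=> /andP[t1 t2] ct; have := cos_mulr2n (t / 2).
have -> : (t / 2) *+ 2 = t by rewrite -[_ *+ 2]mulr_natr divfK.
rewrite ct cos2sin2 mulr2n => e.
have /eqP : sin (t / 2) ^+ 2 = 0 by lra.
rewrite sqrf_eq0 => /eqP s0.
have [tlt|tgt|->//] := ltgtP t 0.
- have : 0 < sin (- (t / 2)) by apply: sin_gt0_pi; apply/andP; split; lra.
  by rewrite sinN s0 oppr0 ltxx.
- have : 0 < sin (t / 2) by apply: sin_gt0_pi; apply/andP; split; lra.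
  by rewrite s0 ltxx.
Qed.

Lemma polar_upper (x y : R) : 0 < y -> exists t rho : R,
  [/\ 0 < t < pi, 0 < rho, x = rho * cos t & y = rho * sin t].
Proof.
move=> y0; pose r2 := x ^+ 2 + y ^+ 2.
have r20 : 0 < r2 by rewrite /r2 ltr_wpDl ?sqr_ge0 // exprn_gt0.
pose rho := Num.sqrt r2; have rho0 : 0 < rho by rewrite sqrtr_gt0.
have rhoE : rho ^+ 2 = r2 by rewrite sqr_sqrtr // ltW.
have cE : 1 - (x / rho) ^+ 2 = (y / rho) ^+ 2.
  rewrite !expr_div_n -[1](@divff _ (rho ^+ 2)) ?expf_neq0 ?gt_eqF //.
  by rewrite -mulrBl rhoE /r2; congr (_ / _); ring.
have c2 : (x / rho) ^+ 2 < 1.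
  by rewrite -subr_gt0 cE exprn_gt0 // divr_gt0.
have : -1 < x / rho < 1 by apply/andP; split; nra.
move=> /andP[c1 c3]; have c13 : -1 <= x / rho <= 1 by rewrite !ltW.
exists (acos (x / rho)), rho; split=> //.
- by rewrite acos_gt0 ?acos_ltpi ?c1 ?c3 ?(ltW c1) ?(ltW c3).
- by rewrite acosK ?in_itv /= ?c13 // mulrCA divff ?mulr1 // gt_eqF.
- rewrite sin_acos // cE sqrtr_sqr ger0_norm ?divr_ge0 ?ltW //.
  by rewrite mulrCA divff ?mulr1 // gt_eqF.
Qed.

Lemma polar (x y : R) : (x, y) != (0, 0) -> exists t rho : R,
  [/\ - pi < t <= pi, 0 < rho, x = rho * cos t & y = rho * sin t].
Proof.
have pi0 := pi_gt0 R; move=> xy.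
have [y0|y0|ye] := ltgtP y 0.
- have /(polar_upper x)[t [rho [/andP[t0 tp] r0 -> e]]] : 0 < - y by lra.
  exists (- t), rho; rewrite cosN sinN; split=> //; last by lra.
  by apply/andP; split; lra.
- have [t [rho [/andP[t0 tp] r0 -> ->]]] := polar_upper x y0.
  by exists t, rho; split=> //; apply/andP; split; lra.
have x0 : x != 0 by apply: contra xy => /eqP ->; rewrite ye.
have [x1|x1] := ltP 0 x.
- by exists 0, x; rewrite cos0 sin0 ye; split=> //; [apply/andP; split; lra|lra|lra].
- have x2 : x < 0 by rewrite lt_neqAle x0.
  exists pi, (- x); rewrite cospi sinpi ye; split; [|lra|lra|lra].
  by apply/andP; split; lra.
Qed.

End Trigonometry.

Section Cones.
Variables (R : realType) (A : comNzRingType) (L : quad_order R A).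
Implicit Types (p q : A) (g : A -> R) (a b x : R).
Let I := covol L.
Let I_gt0 : 0 < I := covol_gt0 L.

(** At most [H / I + 1] rows meet the rectangle, each in at most [W + 1]
    points. *)
Lemma strip_count (S : set A) (x0 W y0 H : R) : 0 <= W -> 0 <= H ->
  (forall p, S p -> x0 <= re L p <= x0 + W /\ y0 <= im L p <= y0 + H) ->
  finite_set S /\ \sum_(p \in S) (1 : R) <= (H / I + 1) * (W + 1).
Proof.
move=> W0 H0 Sb.
pose T := (Num.truncn (H / I)).+1; pose n := (Num.truncn W).+1.
pose lo (t : int) := Num.ceil (x0 - t%:~R * re L (tau L)).
have HI : 0 <= H / I by rewrite divr_ge0 // ltW.
have Sr p : S p -> p \in rows L (Num.ceil (y0 / I)) T lo (fun=> n).
  move=> /Sb; rewrite mem_rows; set t := tcoord L p; set s := scoord L p.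
  have -> : re L p = s%:~R + t%:~R * re L (tau L) by rewrite {1}(ptE L p) re_pt.
  have -> : im L p = t%:~R * I by rewrite {1}(ptE L p) im_pt.
  move=> [/andP[s1 s2] /andP[t1 t2]].
  rewrite !ceil_le_int ler_pdivrMr // t1 /=; apply/andP; split; last first.
    apply/andP; split; first by lra.
    rewrite -(ltr_int R) rmorphD /=; apply: (@le_lt_trans _ _ (x0 - t%:~R * re L (tau L) + W)); first by lra.
    by apply: ler_ltD; [exact: ceil_ge|exact: truncnS_gt].
  rewrite -(ltr_int R) rmorphD /=; apply: (@le_lt_trans _ _ (y0 / I + H / I)).
    by rewrite -mulrDl ler_pdivlMr.
  by apply: ler_ltD; [exact: ceil_ge|exact: truncnS_gt].
split; first exact: finite_rows Sr.
apply: le_trans (fsum1_le_size _ Sr) _.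
apply: (@le_trans _ _ (T * n)%:R); first by rewrite ler_nat size_rows_le.
rewrite natrM /T /n -!natr1; apply: ler_pM; rewrite ?addr_ge0 //.
- by rewrite lerD2r; case/andP: (truncn_itv HI).
- by rewrite lerD2r; case/andP: (truncn_itv W0).
Qed.

Definition disc_const : R := (2 / I + 1) * 3.

Lemma disc_const_ge0 : 0 <= disc_const.
Proof. by rewrite /disc_const mulr_ge0 // addr_ge0 // divr_ge0 // ltW. Qed.

Lemma re_im_le_radius p x : 0 <= x -> (nrm L p)%:R <= x ^+ 2 ->
  `|re L p| <= x /\ `|im L p| <= x.
Proof.
rewrite nrm_re_im => x0 h; split; rewrite -(ler_pXn2r (ltn0Sn 1)) ?nnegrE //.
  by rewrite real_normK ?num_real //; apply: le_trans h; rewrite lerDl sqr_ge0.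
by rewrite real_normK ?num_real //; apply: le_trans h; rewrite lerDr sqr_ge0.
Qed.

Lemma disc_finite x : finite_set [set p | (nrm L p)%:R <= x ^+ 2].
Proof.
wlog x0 : x / 0 <= x => [H|].
  by have := H `|x| (normr_ge0 _); rewrite real_normK ?num_real.
apply: (@strip_count _ (- x) (2 * x) (- x) (2 * x) _ _ _).1; try lra.
move=> p /= /(re_im_le_radius x0)[]; rewrite !ler_norml => r i.
by split; lra.
Qed.

(** Nonzero elements have norm at least 1, so a disc of radius less than 1
    contains none, and the boundary terms can be absorbed in [x ^ 2]. Without
    the constant term the bound can be summed over infinitely many ideals. *)
Lemma disc_count x : 0 <= x ->
  \sum_(p \in [set p | p != 0 /\ (nrm L p)%:R <= x ^+ 2]) (1 : R)
    <= disc_const * x ^+ 2.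
Proof.
move=> x0; have [x1|x1] := ltP x 1.
  rewrite (_ : [set p | _] = set0); last first.
    apply/seteqP; split=> // p /= [p0 h].
    have : (1 : R) <= (nrm L p)%:R by rewrite ler1n nrm_gt0.
    have : x ^+ 2 < 1 by nra.
    lra.
  by rewrite fsbig_set0 mulr_ge0 ?disc_const_ge0 // sqr_ge0.
apply: le_trans (_ : ((2 * x) / I + 1) * (2 * x + 1) <= _).
  apply: (@strip_count _ (- x) (2 * x) (- x) (2 * x) _ _ _).2; try lra.
  move=> p /= [_ /(re_im_le_radius x0)[]]; rewrite !ler_norml => r i.
  by split; lra.
rewrite /disc_const expr2 (_ : _ * (x * x) = ((2 / I + 1) * x) * (3 * x)); last by ring.
have i0 : 0 <= I^-1 by rewrite invr_ge0 ltW.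
apply: ler_pM; [|lra| |lra].
- by rewrite addr_ge0 // divr_ge0 ?ltW //; lra.
- nra.
Qed.

(** The truncated sector with directions in [(a, b]]. The angles are kept as
    real numbers, so that cones can be cut and rotated freely. *)
Definition cone a b x : set A :=
  [set p | exists t rho : R, [/\ a < t <= b, 0 < rho <= x,
     re L p = rho * cos t & im L p = rho * sin t]].

Lemma cone_disc a b x p : cone a b x p -> p != 0 /\ (nrm L p)%:R <= x ^+ 2.
Proof.
move=> [t [rho [_ /andP[r0 rx] re_ im_]]].
have nE : (nrm L p)%:R = rho ^+ 2.
  by rewrite nrm_re_im re_ im_ !exprMn -mulrDr cos2Dsin2 mulr1.
split; last by rewrite nE ler_pXn2r // ?nnegrE; lra.
by apply/eqP => p0; move: nE; rewrite p0 (eqP (_ : nrm L 0 == 0%N)) ?nrm_eq0 //; nra.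
Qed.

Lemma cone_finite a b x : finite_set (cone a b x).
Proof. by apply: sub_finite_set (disc_finite x) => p /cone_disc[]. Qed.

Lemma cone_empty a x : cone a a x = set0.
Proof.
apply/seteqP; split=> // p [t [rho [/andP[at_ ta] _ _ _]]].
by move: (lt_le_trans at_ ta); rewrite ltxx.
Qed.

Lemma cone_catl a b c x : a <= b -> b <= c -> cone a b x `<=` cone a c x.
Proof.
move=> ab bc p [t [rho [/andP[h1 h2] ? ? ?]]]; exists t, rho; split=> //.
by apply/andP; split; lra.
Qed.

(** Polar coordinates are unique on a half-open arc of length at most a full
    turn; this is where the bound on the opening angle is used. *)
Lemma cone_cat a b c x : a <= b -> b <= c -> c - a <= 2 * pi ->
  cone a c x `\` cone a b x = cone b c x.
Proof.
move=> ab bc ca; apply/seteqP; split=> p.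
  move=> [[t [rho [/andP[h1 h2] hr e1 e2]]] np]; exists t, rho; split=> //.
  apply/andP; split=> //; rewrite ltNge; apply/negP => tb; apply: np.
  by exists t, rho; split=> //; apply/andP; split; lra.
move=> [t [rho [/andP[h1 h2] hr e1 e2]]]; split.
  by exists t, rho; split=> //; apply/andP; split; lra.
move=> [t' [rho' [/andP[h1' h2'] hr' e1' e2']]].
have [r0 r0'] : 0 < rho /\ 0 < rho' by case/andP: hr; case/andP: hr'.
have rr : rho = rho'.
  have : rho ^+ 2 = rho' ^+ 2.
    rewrite -[LHS]mulr1 -(cos2Dsin2 t) mulrDr -!exprMn -e1 -e2 e1' e2'.
    by rewrite !exprMn -mulrDr cos2Dsin2 mulr1.
  by move=> /eqP; rewrite eqrXn2 ?ltW // => /eqP.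
have : cos (t - t') = 1.
  rewrite cosB; move: e1 e2; rewrite e1' e2' -rr.
  move=> /(mulfI (lt0r_neq0 r0)) <- /(mulfI (lt0r_neq0 r0)) <-.
  by rewrite -!expr2 cos2Dsin2.
move/cos_eq1 => h; have : t - t' = 0 by apply: h; apply/andP; split; lra.
lra.
Qed.

Lemma cone_pi a b x : cone (a + pi) (b + pi) x = [set - p | p in cone a b x].
Proof.
apply/seteqP; split=> p.
  move=> [t [rho [h hr e1 e2]]]; exists (- p); last by rewrite opprK.
  exists (t - pi), rho; split=> //; first by apply/andP; split; lra.
    by rewrite reN e1 -{1}(subrK pi t) cosDpi; ring.
  by rewrite imN e2 -{1}(subrK pi t) sinDpi; ring.
move=> [q [t [rho [h hr e1 e2]]] <-]; exists (t + pi), rho; split=> //.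
- by apply/andP; split; lra.
- by rewrite reN e1 cosDpi; ring.
- by rewrite imN e2 sinDpi; ring.
Qed.

End Cones.

(** * Density of periodic functions in cones *)

Section ErrorTerms.
Variable R : realType.
Implicit Types (F G : R -> R) (eps C D x : R).

(** The form in which [F x = o(x ^ 2)] is used: it holds from [x = 0] on, so
    that rescaling and summation need no threshold. *)
Definition o_sq F := forall eps, 0 < eps ->
  exists D, forall x, 0 <= x -> `|F x| <= eps * x ^+ 2 + D.

Lemma o_sq_linear F :
  (forall eps, 0 < eps -> exists C, forall x, 0 <= x ->
    `|F x| <= eps * x ^+ 2 + C * (x + 1)) -> o_sq F.
Proof.
move=> H eps e0; have e2 : 0 < eps / 2 by rewrite divr_gt0.
have [C HC] := H _ e2; exists (C ^+ 2 / (2 * eps) + C) => x x0.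
apply: le_trans (HC x x0) _; rewrite -subr_ge0.
have -> : eps * x ^+ 2 + (C ^+ 2 / (2 * eps) + C) -
    (eps / 2 * x ^+ 2 + C * (x + 1)) = (eps * x - C) ^+ 2 / (2 * eps).
  by field; rewrite gt_eqF.
by rewrite divr_ge0 ?sqr_ge0 // mulr_ge0 // ltW.
Qed.

Lemma o_sqD F G : o_sq F -> o_sq G -> o_sq (fun x => F x + G x).
Proof.
move=> oF oG eps e0; have e2 : 0 < eps / 2 by rewrite divr_gt0.
have [D HD] := oF _ e2; have [D' HD'] := oG _ e2; exists (D + D') => x x0.
apply: le_trans (ler_normD _ _) _.
apply: le_trans (lerD (HD x x0) (HD' x x0)) _; lra.
Qed.

Lemma o_sq_ext F G : (forall x, 0 <= x -> F x = G x) -> o_sq F -> o_sq G.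
Proof.
by move=> FG oF eps e0; have [D HD] := oF _ e0; exists D => x x0; rewrite -FG ?HD.
Qed.

Lemma o_sq_le F G : (forall x, 0 <= x -> `|F x| <= `|G x|) -> o_sq G -> o_sq F.
Proof.
move=> FG oG eps e0; have [D HD] := oG _ e0; exists D => x x0.
exact: le_trans (FG x x0) (HD x x0).
Qed.

End ErrorTerms.

Section ConeAsymptotics.
Variables (R : realType) (A : comNzRingType) (L : quad_order R A).
Implicit Types (p q : A) (g : A -> R) (a b x : R).
Let I := covol L.
Let I_gt0 : 0 < I := covol_gt0 L.

(** The sector of angle [b - a] and radius [x] has area [(b - a) x ^ 2 / 2], and
    [I] is the area of a fundamental domain of the lattice. *)
Definition cone_density g e a b := o_sq (fun x =>
  \sum_(p \in cone L a b x) g p - e * (b - a) / (2 * I) * x ^+ 2).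

Lemma cone_density_cat g e a b c : a <= b -> b <= c -> c - a <= 2 * pi ->
  cone_density g e a b -> cone_density g e b c -> cone_density g e a c.
Proof.
move=> ab bc ca gab gbc; apply: o_sq_ext (o_sqD gab gbc) => x x0.
rewrite (fsum_setID g (cone_finite L a c x) (cone_catl ab bc)).
by rewrite cone_cat //; field; rewrite gt_eqF.
Qed.

Lemma cone_density_empty g e a : cone_density g e a a.
Proof.
move=> eps e0; exists 0 => x x0; rewrite cone_empty fsbig_set0.
rewrite subrr mulr0 mul0r mul0r subrr normr0 addr0.
by rewrite mulr_ge0 ?sqr_ge0 // ltW.
Qed.

Lemma qmean_le1 M g : (0 < M)%N -> (forall p, `|g p| <= 1) -> `|qmean L M g| <= 1.
Proof.
move=> M0 g1; apply: (@pmean_le1 _ _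
  (fun t => pmean M (fun s => g (pt L s t)))) => // t.
exact: pmean_le1.
Qed.

Lemma qmean_const M (c : R) : (0 < M)%N -> qmean L M (fun=> c) = c.
Proof.
move=> M0; have M1 : M%:R != 0 :> R by rewrite pnatr_eq0 -lt0n.
have av (y : R) : M%:R^-1 * \sum_(i < M) y = y.
  by rewrite sumr_const card_ord -[y *+ M]mulr_natl mulKf.
by rewrite /qmean av av.
Qed.

Definition cot t : R := cos t / sin t.

Lemma cotB a b : sin a != 0 -> sin b != 0 ->
  (cot a - cot b) * (sin a * sin b) = sin (b - a).
Proof. by move=> a0 b0; rewrite sinB /cot; field; rewrite a0 b0. Qed.

(** In the upper half plane the sides of a cone are lines of inverse slope
    [cot], and the distance to the origin is the height divided by the sine. *)
Lemma triangle_sub_cone a b (m x : R) : 0 < a -> a <= b -> b < pi -> 0 <= x ->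
  (forall t, a <= t <= b -> m <= sin t) ->
  triangle L (cot b) (cot a) (x * m) `<=` cone L a b x.
Proof.
move=> a0 ab bpi x0 sinm p [/andP[i0 ix] h1 h2].
have sa0 : 0 < sin a by apply: sin_gt0_pi; apply/andP; split; lra.
have sb0 : 0 < sin b by apply: sin_gt0_pi; apply/andP; split; lra.
have [t [rho [/andP[t0 tpi] r0 re_ im_]]] := polar_upper (re L p) i0.
have st : 0 < sin t by apply: sin_gt0_pi; rewrite t0.
have tb : t <= b.
  rewrite leNgt; apply/negP => bt.
  have : 0 < sin (t - b) by apply: sin_gt0_pi; apply/andP; split; lra.
  rewrite sinB; move: h1; rewrite re_ im_ /cot mulrAC ler_pdivrMr //.
  rewrite (_ : cos b * (rho * sin t) = rho * (sin t * cos b)); last by ring.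
  by rewrite -[rho * cos t * _]mulrA ler_pM2l // ltNge; lra.
have at_ : a < t.
  rewrite ltNge; apply/negP => ta.
  have : 0 <= sin (a - t) by apply: sin_ge0_pi; apply/andP; split; lra.
  rewrite sinB; move: h2; rewrite re_ im_ /cot mulrAC ltr_pdivlMr //.
  rewrite (_ : cos a * (rho * sin t) = rho * (cos a * sin t)); last by ring.
  by rewrite -[rho * cos t * _]mulrA ltr_pM2l //; lra.
exists t, rho; split=> //; first by rewrite at_.
rewrite r0 /= -(ler_pM2r st) -im_; apply: le_trans ix _.
by rewrite ler_wpM2l // sinm // (ltW at_).
Qed.

Lemma cone_sub_triangle a b (m x : R) : 0 < a -> a <= b -> b < pi -> 0 <= x ->
  (forall t, a <= t <= b -> sin t <= m) ->
  cone L a b x `<=` triangle L (cot b) (cot a) (x * m).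
Proof.
move=> a0 ab bpi x0 sinm p [t [rho [/andP[at_ tb] /andP[r0 rx] re_ im_]]].
have sa0 : 0 < sin a by apply: sin_gt0_pi; apply/andP; split; lra.
have sb0 : 0 < sin b by apply: sin_gt0_pi; apply/andP; split; lra.
have st : 0 < sin t by apply: sin_gt0_pi; apply/andP; split; lra.
have stm : sin t <= m by rewrite sinm // (ltW at_).
split.
- by rewrite im_ mulr_gt0 //= ler_pM // ltW.
- rewrite re_ im_ /cot mulrAC ler_pdivrMr //.
  rewrite (_ : cos b * (rho * sin t) = rho * (sin t * cos b)); last by ring.
  rewrite -[rho * cos t * _]mulrA ler_pM2l //.
  have : 0 <= sin (b - t) by apply: sin_ge0_pi; apply/andP; split; lra.
  by rewrite sinB; lra.
- rewrite re_ im_ /cot mulrAC ltr_pdivlMr //.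
  rewrite (_ : cos a * (rho * sin t) = rho * (cos a * sin t)); last by ring.
  rewrite -[rho * cos t * _]mulrA ltr_pM2l //.
  have : 0 < sin (t - a) by apply: sin_gt0_pi; apply/andP; split; lra.
  by rewrite sinB; lra.
Qed.

(** [cot] has derivative [- 1 / sin ^ 2]: the triangles of heights
    [sin a - d] and [sin a + d] have twice the area [d] up to [O(d ^ 2)]. *)
Lemma cot_diff_bounds a b (sg : R) : 0 < a -> a <= b -> b < pi -> 0 < sg ->
    sg <= sin a -> sg <= sin b -> b - a <= sg / 2 ->
  let d := b - a in let k := cot a - cot b in let q := d ^+ 2 / sg ^+ 2 in
  [/\ 0 <= k, `|d - k * (sin a - d) ^+ 2| <= 5 * q &
      k * (sin a + d) ^+ 2 - k * (sin a - d) ^+ 2 <= 4 * q].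
Proof.
move=> a0 ab bpi sg0 sa sb dsg d k q; rewrite -/d in dsg.
have d0 : 0 <= d by rewrite subr_ge0.
have sa0 := lt_le_trans sg0 sa; have sb0 := lt_le_trans sg0 sb.
have sin1 := sin_le1 a.
have kE : k * (sin a * sin b) = sin d by apply: cotB; rewrite gt_eqF.
have k0 : 0 <= k.
  rewrite -(pmulr_lge0 _ (mulr_gt0 sa0 sb0)) kE; apply: sin_ge0_pi.
  by rewrite d0 /d /=; lra.
have := sin_lipschitz ab; rewrite -/d ler_norml => /andP[sb1 sb2].
have sg1 : sg <= 1 by lra.
have dq : d ^+ 2 <= q.
  by rewrite /q ler_pdivlMr ?exprn_gt0 // ler_piMr ?sqr_ge0 // expr_le1 // ltW.
have kdq : k * d <= q.
  rewrite /q ler_pdivlMr ?exprn_gt0 // mulrAC [leRHS]expr2 ler_wpM2r //.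
  apply: le_trans (sin_le_id d0); rewrite -kE ler_wpM2l // expr2.
  by apply: ler_pM => //; exact: ltW.
have km : k * (sin a - d) ^+ 2 <= d.
  apply: le_trans (sin_le_id d0); rewrite -kE ler_wpM2l // expr2.
  by apply: ler_pM; lra.
have kM : d - d ^+ 2 <= k * (sin a + d) ^+ 2.
  apply: le_trans (sin_ge_quadratic d0) _; rewrite -kE ler_wpM2l // expr2.
  by apply: ler_pM; lra.
have kMm : k * (sin a + d) ^+ 2 - k * (sin a - d) ^+ 2 <= 4 * q.
  rewrite (_ : _ - _ = 4 * (k * d * sin a)); last by ring.
  by rewrite ler_wpM2l //; apply: le_trans kdq; rewrite ler_piMr // mulr_ge0.
by split=> //; rewrite ger0_norm; lra.
Qed.

(** With [d = b - a], the heights [x (sin a - d)] and [x (sin a + d)] bound those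
    of the arc of radius [x], so the cone lies between the triangles with these
    heights. Both have area [d x ^ 2 / 2] up to a second order term in [d]. *)
Lemma thin_cone M g a b sg : (0 < M)%N -> periodic_mod M g ->
    (forall p, `|g p| <= 1) -> 0 < a -> a <= b -> b < pi ->
    0 < sg -> (forall t, a <= t <= b -> sg <= sin t) -> b - a <= sg / 2 ->
  exists C, forall x, 0 <= x ->
    `|\sum_(p \in cone L a b x) g p - qmean L M g * (b - a) / (2 * I) * x ^+ 2|
    <= 5 * (b - a) ^+ 2 / (sg ^+ 2 * I) * x ^+ 2 + C * (x + 1).
Proof.
move=> M0 gper g1 a0 ab bpi sg0 sgP dsg.
have sa : sg <= sin a by apply: sgP; rewrite lexx.
have sb : sg <= sin b by apply: sgP; rewrite lexx andbT.
have [] := cot_diff_bounds a0 ab bpi sg0 sa sb dsg.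
set d := b - a in dsg *; set k := cot a - cot b; set q := d ^+ 2 / sg ^+ 2.
pose m := sin a - d; pose M' := sin a + d; rewrite -/m -/M' => k0 kd kMm.
have d0 : 0 <= d by rewrite subr_ge0.
have sin1 := sin_le1 a.
have [m0 m1 mM M2] : [/\ 0 <= m, m <= 1, 0 <= M' & M' <= 2].
  by rewrite /m /M'; split; lra.
have sinm t : a <= t <= b -> m <= sin t.
  move=> /andP[at_ tb]; have := sin_lipschitz at_; rewrite ler_norml /m /d; lra.
have sinM t : a <= t <= b -> sin t <= M'.
  move=> /andP[at_ tb]; have := sin_lipschitz at_; rewrite ler_norml /M' /d; lra.
have sub1 x (x0 : 0 <= x) := triangle_sub_cone a0 ab bpi x0 sinm.
have sub2 x (x0 : 0 <= x) := cone_sub_triangle a0 ab bpi x0 sinM.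
have uv : cot b <= cot a by rewrite -subr_ge0.
pose C0 := k * (4 * M%:R + 2) + (2 * M%:R + 1) / I.
have C00 : 0 <= C0.
  apply: addr_ge0; first by rewrite mulr_ge0 // addr_ge0 // mulr_ge0.
  by rewrite divr_ge0 ?(ltW I_gt0) // addr_ge0 // mulr_ge0.
pose one := fun _ : A => 1 : R.
have one1 p : `|one p| <= 1 by rewrite normr1.
have one_per : periodic_mod M one by [].
exists (C0 * 5) => x x0.
have [fT2 n2] := triangle_sum L M0 one_per one1 uv (mulr_ge0 x0 mM).
have [_ n1] := triangle_sum L M0 one_per one1 uv (mulr_ge0 x0 m0).
have [_ t1] := triangle_sum L M0 gper g1 uv (mulr_ge0 x0 m0).
have nest := fsum_nested_le (cone_finite L a b x) (sub1 x x0) g1.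
have up : \sum_(p \in cone L a b x) (1 : R) <=
    \sum_(p \in triangle L (cot b) (cot a) (x * M')) (1 : R).
  exact: ler_fsum_sub (sub2 x x0) _.
rewrite !(qmean_const _ M0) !mul1r -/k -/I -/C0 in n1 n2.
rewrite -/k -/I -/C0 in t1.
have e1 := qmean_le1 M0 g1.
move: nest up n1 n2 t1.
set S := \sum_(p \in cone L a b x) g p; set NS := \sum_(p \in cone L a b x) _.
set T1 := \sum_(p \in triangle _ _ _ (x * m)) g p.
set N1 := \sum_(p \in triangle _ _ _ (x * m)) _.
set N2 := \sum_(p \in _) _.
set e := qmean L M g in e1 * => nest up n1 n2 t1.
pose X := x ^+ 2 / (2 * I).
have X0 : 0 <= X by rewrite divr_ge0 ?sqr_ge0 // mulr_ge0 // ltW.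
have n1' : `|N1 - k * m ^+ 2 * X| <= C0 * (x * m).
  by rewrite (_ : k * m ^+ 2 * X = k * (x * m) ^+ 2 / (2 * I)) // /X; ring.
have n2' : `|N2 - k * M' ^+ 2 * X| <= C0 * (x * M').
  by rewrite (_ : k * M' ^+ 2 * X = k * (x * M') ^+ 2 / (2 * I)) // /X; ring.
have t1' : `|T1 - e * (k * m ^+ 2) * X| <= C0 * (x * m).
  by rewrite (_ : e * (k * m ^+ 2) * X = e * k * (x * m) ^+ 2 / (2 * I)) // /X; ring.
rewrite (_ : e * d / (2 * I) * x ^+ 2 = e * d * X); last by rewrite /X; ring.
rewrite (_ : 5 * d ^+ 2 / (sg ^+ 2 * I) * x ^+ 2 = 10 * (q * X)); last first.
  by rewrite /q /X; field; rewrite !gt_eqF.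
have mx : C0 * (x * m) <= C0 * x by rewrite ler_wpM2l // ler_piMr.
have Mx : C0 * (x * M') <= 2 * (C0 * x).
  by rewrite [leRHS]mulrCA ler_wpM2l // mulrC ler_wpM2r.
have Cx : 0 <= C0 * x by rewrite mulr_ge0.
have ek : `|e * d * X - e * (k * m ^+ 2) * X| <= 5 * (q * X).
  rewrite -mulrBl normrM (ger0_norm X0) -mulrBr [leRHS]mulrA ler_wpM2r //.
  rewrite normrM; apply: le_trans kd.
  by rewrite -[leRHS]mul1r ler_wpM2r.
have kX : k * M' ^+ 2 * X - k * m ^+ 2 * X <= 4 * (q * X).
  by rewrite -mulrBl mulrA ler_wpM2r.
have qX : 0 <= q * X by rewrite mulr_ge0 // divr_ge0 ?sqr_ge0.
clear -nest n1' n2' t1' ek kX qX mx Mx Cx up C00 x0.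
move: nest n1' n2' t1' ek; rewrite !ler_norml.
move: (e * d * X) (e * (k * m ^+ 2) * X) (k * m ^+ 2 * X) (k * M' ^+ 2 * X) (q * X) kX qX.
move=> z1 z2 z3 z4 z5 kX qX.
move=> /andP[? ?] /andP[? ?] /andP[? ?] /andP[? ?] /andP[? ?].
by apply/andP; split; lra.
Qed.

End ConeAsymptotics.

Section ConeDensity.
Variables (R : realType) (A : comNzRingType) (L : quad_order R A) (M : nat).
Implicit Types (p q : A) (g : A -> R) (a b x : R).
Hypothesis M_gt0 : (0 < M)%N.
Let I := covol L.
Let I_gt0 : 0 < I := covol_gt0 L.

Lemma sin_lower_bound a b : 0 < a -> a <= b -> b < pi ->
  exists2 sg : R, 0 < sg & forall t, a <= t <= b -> sg <= sin t.
Proof.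
move=> a0 ab bpi.
have [c] := EVT_min ab (continuous_subspaceT (@continuous_sin R)).
rewrite in_itv /= => /andP[ac cb] H; exists (sin c).
  by apply: sin_gt0_pi; apply/andP; split; lra.
by move=> t tab; apply: H; rewrite in_itv.
Qed.

(** Away from the real axis, cut into [n] thin cones of equal angle: [n] errors
    of second order in [1 / n] add up to [O(1 / n)]. *)
Lemma cone_density_interior g a b : periodic_mod M g ->
  (forall p, `|g p| <= 1) -> 0 < a -> a <= b -> b < pi ->
  cone_density L g (qmean L M g) a b.
Proof.
move=> gper g1 a0 ab bpi; apply: o_sq_linear => eps e0.
have [sg sg0 sgP] := sin_lower_bound a0 ab bpi.
set e := qmean L M g.
pose K := 5 * (b - a) ^+ 2 / (sg ^+ 2 * I).
have K0 : 0 <= K.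
  by rewrite /K divr_ge0 // mulr_ge0 ?sqr_ge0 // (ltW I_gt0).
have ba0 : 0 <= b - a by rewrite subr_ge0.
(* More than [B] pieces make them thin enough and their errors small enough. *)
pose B := (b - a) * 2 / sg + K / eps.
have B0 : 0 <= B.
  apply: addr_ge0; last exact: divr_ge0 K0 (ltW e0).
  by apply: divr_ge0 (ltW sg0); exact: mulr_ge0.
pose n := (Num.truncn B).+1; have nB : B < n%:R := truncnS_gt B.
have n0 : 0 < n%:R :> R by rewrite ltr0n.
pose d := (b - a) / n%:R; have d0 : 0 <= d by rewrite divr_ge0 // ltW.
have dsg : d <= sg / 2.
  have : (b - a) * 2 / sg < n%:R.
    by apply: le_lt_trans nB; rewrite /B lerDl; exact: divr_ge0 K0 (ltW e0).
  by rewrite ltr_pdivrMr // /d ler_pdivrMr //; lra.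
have dK : n%:R * (5 * d ^+ 2 / (sg ^+ 2 * I)) <= eps.
  rewrite (_ : _ * _ = K / n%:R); last first.
    by rewrite /K /d; field; rewrite !gt_eqF.
  rewrite ler_pdivrMr // mulrC -ler_pdivrMr //; apply: ltW.
  by apply: le_lt_trans nB; rewrite /B lerDr; apply: divr_ge0 (ltW sg0); exact: mulr_ge0.
have nd : n%:R * d = b - a by rewrite /d mulrC divfK // gt_eqF.
set kap := 5 * d ^+ 2 / (sg ^+ 2 * I) in dK.
suff H k : (k <= n)%N -> exists C, forall x, 0 <= x ->
    `|\sum_(p \in cone L a (a + k%:R * d) x) g p
        - e * (k%:R * d) / (2 * I) * x ^+ 2|
      <= k%:R * kap * x ^+ 2 + C * (x + 1).
  have [C HC] := H n (leqnn n); exists C => x x0.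
  have := HC x x0; rewrite nd subrKC => h; apply: le_trans h _.
  by rewrite lerD2r ler_wpM2r ?sqr_ge0.
elim: k => [_|k IH kn].
  exists 0 => x x0; rewrite !mul0r addr0 cone_empty fsbig_set0.
  by rewrite mulr0 !mul0r subr0 normr0 addr0.
have [C HC] := IH (ltnW kn).
have kd : k%:R * d <= k.+1%:R * d by rewrite ler_wpM2r // ler_nat.
have kdb : k.+1%:R * d <= b - a by rewrite -nd ler_wpM2r // ler_nat.
have kd0 : 0 <= k%:R * d by rewrite mulr_ge0.
set a1 := a + k%:R * d; set b1 := a + k.+1%:R * d.
have ab1 : b1 - a1 = d by rewrite /a1 /b1 -natr1; ring.
have a1a : a <= a1 by rewrite /a1; lra.
have a1b1 : a1 <= b1 by rewrite -subr_ge0 ab1.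
have b1b : b1 <= b by rewrite /b1; lra.
have sgP1 t : a1 <= t <= b1 -> sg <= sin t.
  by move=> /andP[? ?]; apply: sgP; apply/andP; split; lra.
have ds1 : b1 - a1 <= sg / 2 by rewrite ab1.
have [C' HC'] := thin_cone L M_gt0 gper g1 (lt_le_trans a0 a1a) a1b1
  (le_lt_trans b1b bpi) sg0 sgP1 ds1.
exists (C + C') => x x0.
rewrite (fsum_setID g (cone_finite L a b1 x) (cone_catl a1a a1b1)).
have := HC x x0; have := HC' x x0; rewrite ab1 -/e -/kap.
rewrite cone_cat //; last by have := pi_gt0 R; lra.
set S1 := \sum_(p \in cone L a a1 x) _.
set S2 := \sum_(p \in cone L a1 b1 x) _ => h2 h1.
have -> : S1 + S2 - e * (k.+1%:R * d) / (2 * I) * x ^+ 2 =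
  S1 - e * (k%:R * d) / (2 * I) * x ^+ 2 + (S2 - e * d / (2 * I) * x ^+ 2).
  by rewrite -natr1; field; rewrite gt_eqF.
apply: le_trans (ler_normD _ _) _; apply: le_trans (lerD h1 h2) _.
by rewrite -natr1; lra.
Qed.

(** Near the real axis the bounding triangles degenerate, but a cone of small
    angle lies in a strip of height proportional to its radius. *)
Lemma cone_small_count g a b (dl : R) : (forall p, `|g p| <= 1) -> 0 <= dl ->
  (forall t, a < t <= b -> `|sin t| <= dl) -> forall x, 0 <= x ->
  `|\sum_(p \in cone L a b x) g p| <=
     4 * dl / I * x ^+ 2 + (2 * dl / I + 2) * (x + 1).
Proof.
move=> g1 dl0 sd x x0.
have Ii : 0 <= I^-1 by rewrite invr_ge0 ltW.
apply: le_trans (ler_norm_fsum _ (cone_finite _ _ _ _)) _.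
apply: le_trans (ler_fsum (cone_finite _ _ _ _) (fun p _ => g1 p)) _.
apply: (@le_trans _ _ ((2 * (dl * x) / I + 1) * (2 * x + 1))); last first.
  have d1 : 0 <= dl / I by rewrite mulr_ge0.
  rewrite -subr_ge0 (_ : _ - _ = 2 * (dl / I) + 1); last by ring.
  by rewrite addr_ge0 // mulr_ge0.
have dx : 0 <= dl * x by rewrite mulr_ge0.
apply: (@strip_count _ _ L _ (- x) (2 * x) (- (dl * x)) (2 * (dl * x)) _ _ _).2;
  try lra.
move=> p cp; have [_ /(re_im_le_radius x0)[rx _]] := cone_disc cp.
have [t [rho [tab /andP[r0 rx'] _ im_]]] := cp.
have : `|im L p| <= dl * x.
  rewrite im_ normrM (gtr0_norm r0) mulrC; apply: ler_pM => //; last exact: sd.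
  exact: ltW.
move: rx; rewrite !ler_norml => /andP[? ?] /andP[? ?].
by split; apply/andP; split; lra.
Qed.

(** Removing small cones at both ends changes neither side much; this reaches
    the directions of the real axis from the interior. *)
Lemma cone_density_approx g e a b :
  (forall p, `|g p| <= 1) -> `|e| <= 1 -> b - a <= 2 * pi ->
  (forall eps, 0 < eps -> exists c c',
     [/\ a <= c <= c' /\ c' <= b, cone_density L g e c c',
         c - a <= eps /\ b - c' <= eps,
         forall t, a < t <= c -> `|sin t| <= eps &
         forall t, c' < t <= b -> `|sin t| <= eps]) ->
  cone_density L g e a b.
Proof.
move=> g1 e1 ba H; apply: o_sq_linear => eps e0.
pose del := eps * I / 20; have del0 : 0 < del by rewrite !mulr_gt0 ?invr_gt0.
have [c [c' [[/andP[ac cc] cb] dense [ca bc] s1 s2]]] := H _ del0.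
have [D HD] := dense _ (divr_gt0 e0 (ltr0n R 4)).
pose C1 := 2 * del / I + 2.
exists (2 * C1 + `|D|) => x x0.
have h1 := cone_small_count g1 (ltW del0) s1 x0.
have h2 := cone_small_count g1 (ltW del0) s2 x0.
have h3 := HD x x0.
rewrite (fsum_setID g (cone_finite L a b x) (cone_catl (le_trans ac cc) cb)).
rewrite cone_cat ?(le_trans ac cc) //.
rewrite (fsum_setID g (cone_finite L a c' x) (cone_catl ac cc)).
rewrite cone_cat //; last lra.
rewrite -/C1 in h1 h2; move: h1 h2 h3.
set S1 := \sum_(p \in cone L a c x) _; set S2 := \sum_(p \in cone L c c' x) _.
set S3 := \sum_(p \in cone L c' b x) _ => h1 h2 h3.
have -> : S1 + S2 + S3 - e * (b - a) / (2 * I) * x ^+ 2 =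
  S1 + S3 + (S2 - e * (c' - c) / (2 * I) * x ^+ 2)
    - e * ((c - a + (b - c')) / (2 * I) * x ^+ 2).
  by field; rewrite gt_eqF.
have x2 := sqr_ge0 x.
have dI : 4 * del / I * x ^+ 2 = eps / 5 * x ^+ 2.
  by rewrite /del; field; rewrite gt_eqF.
have h4 : `|e * ((c - a + (b - c')) / (2 * I) * x ^+ 2)| <= eps / 20 * x ^+ 2.
  have w0 : 0 <= (c - a + (b - c')) / (2 * I) * x ^+ 2.
    by rewrite mulr_ge0 // divr_ge0 ?mulr_ge0 ?(ltW I_gt0) //; lra.
  rewrite normrM (ger0_norm w0); apply: (@le_trans _ _ (1 * ((c - a + (b - c')) / (2 * I) * x ^+ 2))).
    by rewrite ler_wpM2r.
  rewrite mul1r ler_wpM2r // ler_pdivrMr ?mulr_gt0 //.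
  by move: ca bc; rewrite /del; lra.
have xD : D <= `|D| * (x + 1).
  by apply: le_trans (ler_norm _) _; rewrite ler_peMr //; lra.
rewrite dI in h1 h2.
have e2 : 0 <= eps * x ^+ 2 by rewrite mulr_ge0 // ltW.
apply: le_trans (ler_normB _ _) _; apply: le_trans (lerD (ler_normD _ _) h4) _.
apply: le_trans (lerD (lerD (ler_normD _ _) h3) (lexx _)) _.
apply: le_trans (lerD (lerD (lerD h1 h2) (lexx _)) (lexx _)) _.
lra.
Qed.

Lemma cone_density_upper g a b : periodic_mod M g ->
  (forall p, `|g p| <= 1) -> 0 <= a -> a <= b -> b <= pi ->
  cone_density L g (qmean L M g) a b.
Proof.
move=> gper g1 a0 ab bpi; have pi0 := pi_gt0 R.
have e1 := qmean_le1 L M_gt0 g1.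
have [<-|anb] := eqVneq a b; first exact: cone_density_empty.
have {anb} ltab : a < b by rewrite lt_neqAle anb.
apply: cone_density_approx => // [|eps e0]; first lra.
pose eta := Num.min eps ((b - a) / 4).
have eta0 : 0 < eta by rewrite lt_min e0 /= divr_gt0 // subr_gt0.
have etae : eta <= eps by rewrite ge_min lexx.
have etab : eta <= (b - a) / 4 by rewrite ge_min lexx orbT.
have [c [c0 ac ca s1]] : exists c, [/\ 0 < c, a <= c, c - a <= eta &
    forall t, a < t <= c -> `|sin t| <= eps].
  have [<-|na] := eqVneq 0 a.
    exists eta; split; rewrite ?subr0 ?(ltW eta0) // => t /andP[t0 te].
    have := sin_lipschitz (ltW t0); rewrite sin0 !subr0 => h.
    by apply: le_trans h _; lra.
  exists a; split=> //; rewrite ?subrr ?(ltW eta0) //; first by rewrite lt_neqAle na.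
  by move=> t /andP[h1 h2]; have := lt_le_trans h1 h2; rewrite ltxx.
have [c' [c0' cb bc s2]] : exists c', [/\ c' < pi, c' <= b, b - c' <= eta &
    forall t, c' < t <= b -> `|sin t| <= eps].
  have [->|nb] := eqVneq b pi.
    exists (pi - eta); split; [lra|lra|lra|] => t /andP[t0 te].
    have := sin_lipschitz te; rewrite sinpi sub0r normrN => h.
    by apply: le_trans h _; lra.
  exists b; split=> //; rewrite ?subrr ?(ltW eta0) //; first by rewrite lt_neqAle nb.
  by move=> t /andP[h1 h2]; have := lt_le_trans h1 h2; rewrite ltxx.
exists c, c'; split=> //; first by split=> //; apply/andP; split=> //; lra.
- by apply: cone_density_interior => //; lra.
- by split; lra.
Qed.

Lemma pmean_opp (h : int -> R) : (forall s, h (s + M%:Z) = h s) ->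
  pmean M (fun s => h (- s)) = pmean M h.
Proof.
move=> hper; rewrite /pmean; congr (_ * _).
rewrite -(periodic_sum_shift hper (1 - M%:Z)) (reindex_inj rev_ord_inj) /=.
apply: eq_bigr => i _; congr h; have := ltn_ord i; lia.
Qed.

Lemma qmeanE g :
  qmean L M g = pmean M (fun t => pmean M (fun s => g (pt L s t))).
Proof. by []. Qed.

Lemma periodic_scoord g s t : periodic_mod M g ->
  g (pt L (s + M%:Z) t) = g (pt L s t).
Proof.
move=> gper; rewrite -[RHS](gper _ 1); congr g.
by rewrite /pt rmorphD /= mulr1 -pmulrn; ring.
Qed.

Lemma periodic_tcoord g s t : periodic_mod M g ->
  g (pt L s (t + M%:Z)) = g (pt L s t).
Proof.
move=> gper; rewrite -[RHS](gper _ (tau L)); congr g.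
by rewrite /pt rmorphD /= -pmulrn; ring.
Qed.

Lemma qmean_opp g : periodic_mod M g ->
  qmean L M (fun p => g (- p)) = qmean L M g.
Proof.
move=> gper; rewrite !qmeanE.
have optE s t : - pt L s t = pt L (- s) (- t) by rewrite /pt !rmorphN /=; ring.
have -> : (fun t => pmean M (fun s => g (- pt L s t))) =
    (fun t => pmean M (fun s => g (pt L s (- t)))).
  apply/funext => t; rewrite -[RHS]pmean_opp.
    by congr pmean; apply/funext => s; rewrite optE.
  by move=> s; exact: periodic_scoord.
apply: (@pmean_opp (fun t => pmean M (fun s => g (pt L s t)))) => t.
by congr pmean; apply/funext => s; exact: periodic_tcoord.
Qed.

Lemma qmean_shift g c : periodic_mod M g ->
  qmean L M (fun p => g (p + c)) = qmean L M g.
Proof.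
move=> gper; rewrite !qmeanE (ptE L c).
set s0 := scoord L c; set t0 := tcoord L c.
have -> : (fun t => pmean M (fun s => g (pt L s t + pt L s0 t0))) =
    (fun t => pmean M (fun s => g (pt L s (t0 + t)))).
  apply/funext => t; rewrite /pmean; congr (_ * _).
  rewrite -(@periodic_sum_shift _ _ (fun s => g (pt L s (t0 + t))) _ s0).
    by apply: eq_bigr => i _; rewrite ptD addrC [t + _]addrC.
  by move=> s; exact: periodic_scoord.
rewrite /pmean; congr (_ * _).
apply: (@periodic_sum_shift _ _ (fun t => pmean M (fun s => g (pt L s t)))) => t.
by congr pmean; apply/funext => s; exact: periodic_tcoord.
Qed.

Lemma cone_density_half_turn g a b :
  cone_density L g (qmean L M g) (a + pi) (b + pi) <->
  cone_density L (fun p => g (- p)) (qmean L M g) a b.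
Proof.
have E x : \sum_(p \in cone L (a + pi) (b + pi) x) g p =
    \sum_(p \in cone L a b x) g (- p).
  by rewrite cone_pi fsbig_image // => p q _ _; exact: oppr_inj.
have e : b + pi - (a + pi) = b - a by ring.
by split; apply: o_sq_ext => x _; rewrite E e.
Qed.

(** A half turn multiplies the lattice by [- 1], which exchanges the half planes
    and replaces [g] by its reflection. *)
Lemma cone_density_half_plane (j : int) g a b : periodic_mod M g ->
  (forall p, `|g p| <= 1) -> j%:~R * pi <= a -> a <= b ->
  b <= (j + 1)%:~R * pi -> cone_density L g (qmean L M g) a b.
Proof.
have opp_per (f : A -> R) : periodic_mod M f -> periodic_mod M (fun p => f (- p)).
  by move=> fper p q; rewrite opprD -mulrN fper.
elim/int_ind: j g a b => [|n IH|n IH] g a b gper g1 ja ab bj.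
- by apply: cone_density_upper => //; lra.
- rewrite -(subrK pi a) -(subrK pi b) cone_density_half_turn.
  rewrite -qmean_opp //; apply: IH; [exact: opp_per|by move=> p|..];
    move: ja bj; rewrite -addn1 ?PoszD !rmorphD /=; lra.
- have : cone_density L (fun p => g (- p)) (qmean L M (fun p => g (- p)))
      (a + pi) (b + pi).
    apply: IH; [exact: opp_per|by move=> p|..];
      move: ja bj; rewrite -[n.+1]addn1 ?PoszD ?opprD !rmorphD /=; lra.
  move/cone_density_half_turn; rewrite qmean_opp //.
  by under eq_fun do rewrite opprK.
Qed.

Theorem cone_density_periodic g a b : periodic_mod M g ->
  (forall p, `|g p| <= 1) -> a <= b -> b - a <= 2 * pi ->
  cone_density L g (qmean L M g) a b.
Proof.
move=> gper g1 ab ba; have pi0 := pi_gt0 R.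
pose j := Num.floor (a / pi).
have /andP[ja aj] : j%:~R * pi <= a < (j + 1)%:~R * pi.
  by rewrite -ler_pdivlMr // -ltr_pdivrMr // floor_itv.
have jE (i : nat) : (j + i%:Z)%:~R * pi = j%:~R * pi + i%:R * pi :> R.
  by rewrite rmorphD /= mulrDl -pmulrn.
have H (i : nat) a' b' : j%:~R * pi + i%:R * pi <= a' -> a' <= b' ->
    b' <= j%:~R * pi + i.+1%:R * pi -> cone_density L g (qmean L M g) a' b'.
  move=> h1 h2 h3; apply: (@cone_density_half_plane (j + i%:Z)) => //.
    by rewrite jE.
  by rewrite -addrA -PoszD addn1 jE.
rewrite (jE 1%N) in aj.
pose c := Num.min b (j%:~R * pi + 1 * pi); pose d := Num.min b (j%:~R * pi + 2 * pi).
have ac : a <= c by rewrite le_min ab ltW.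
have cd : c <= d.
  by rewrite le_min ge_min lexx /= ge_min; apply/orP; right; lra.
have db : d <= b by rewrite ge_min lexx.
have c1 : c <= j%:~R * pi + 1 * pi by rewrite ge_min lexx orbT.
have d2 : d <= j%:~R * pi + 2 * pi by rewrite ge_min lexx orbT.
have Hd : cone_density L g (qmean L M g) d b.
  rewrite /d; case: leP => h; first exact: cone_density_empty.
  by apply: (H 2%N) => //; lra.
have Hc : cone_density L g (qmean L M g) c d.
  have [h|h] := leP b (j%:~R * pi + 1 * pi).
    have cb : c = b by apply/min_idPl.
    rewrite cb; have -> : d = b by rewrite /d; apply/min_idPl; lra.
    exact: cone_density_empty.
  have cE : c = j%:~R * pi + 1 * pi by apply/min_idPr/ltW.
  by apply: (H 1%N) => //; lra.
have Ha : cone_density L g (qmean L M g) a c.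
  by apply: (H 0%N) => //; lra.
apply: cone_density_cat db _ _ Hd => //; first lra.
by apply: cone_density_cat cd _ Ha Hc => //; lra.
Qed.

End ConeDensity.

(** * Ideals and means over classes *)

Section Ideals.
Variables (R : realType) (A : comNzRingType) (L : quad_order R A).
Implicit Types (I J P Q : set A) (a b p r : A).
Hypothesis A_principal : is_principal_ring A.

Lemma ideal_sub I a b : is_ideal I -> I a -> I b -> I (a - b).
Proof.
by move=> [_ ID IM] Ia Ib; apply: ID => //; rewrite -mulN1r; exact: IM.
Qed.

Lemma ideal_mulr I a b : is_ideal I -> I a -> I (a * b).
Proof. by move=> [_ _ IM] Ia; rewrite mulrC; exact: IM. Qed.

Lemma pidealP a b : pideal a b <-> exists c, b = c * a.
Proof.
by split=> [[c _ <-]|[c ->]]; exists c; rewrite // mulrC.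
Qed.

Lemma pideal_ideal a : is_ideal (pideal a).
Proof.
split; first by apply/pidealP; exists 0; rewrite mul0r.
- move=> x y /pidealP[c ->] /pidealP[d ->].
  by apply/pidealP; exists (c + d); rewrite mulrDl.
- by move=> x y /pidealP[c ->]; apply/pidealP; exists (x * c); rewrite mulrA.
Qed.

Lemma pideal_id a : pideal a a.
Proof. by apply/pidealP; exists 1; rewrite mul1r. Qed.

Lemma nrm_in_ideal I a : is_ideal I -> I a -> I (nrm L a)%:R.
Proof. by move=> Ii Ia; rewrite -(mul_conjA L); exact: ideal_mulr. Qed.

Lemma eq_residue I a b : is_ideal I -> residue I a = residue I b <-> I (a - b).
Proof.
move=> Ii; split=> [e|Iab].
  have : residue I b a by rewrite -e /residue /= subrr; case: Ii.
  by [].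
apply/seteqP; split=> x; rewrite /residue /= => h.
  rewrite (_ : x - b = (x - a) + (a - b)); last by ring.
  by case: Ii => _ ID _; exact: ID.
rewrite (_ : x - a = (x - b) - (a - b)); last by ring.
exact: ideal_sub.
Qed.

(** Every class modulo [I] meets the box of residues modulo [M]. *)
Lemma quotient_finite I M : is_ideal I -> (0 < M)%N -> I M%:R ->
  finite_set (quotient I).
Proof.
move=> Ii M0 IM.
apply: (@sub_finite_set _ _ ((fun ij : nat * nat => residue I (pt L ij.1%:Z ij.2%:Z))
   @` (`I_M `*` `I_M))); last first.
  by apply: finite_image; apply: finite_setX; exact: finite_II.
move=> _ [a _ <-].
have M0' : M%:Z != 0 by rewrite eqz_nat -lt0n.
have mod_lt (s : int) : (`|(s %% M%:Z)%Z| < M)%N.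
  by have := ltz_mod s M0'; have := modz_ge0 s M0'; lia.
exists (`|(scoord L a %% M%:Z)%Z|%N, `|(tcoord L a %% M%:Z)%Z|%N).
  by split; exact: mod_lt.
apply/(eq_residue _ _ Ii) => /=; rewrite !gez0_abs ?modz_ge0 //.
set s := scoord L a; set t := tcoord L a.
have aE : a = pt L ((s %/ M%:Z)%Z * M%:Z + (s %% M%:Z)%Z)
    ((t %/ M%:Z)%Z * M%:Z + (t %% M%:Z)%Z) by rewrite -!divz_eq; exact: ptE.
rewrite [X in _ - X]aE.
rewrite (_ : _ - _ = M%:R * (- pt L (s %/ M%:Z)%Z (t %/ M%:Z)%Z)).
  exact: ideal_mulr.
by rewrite /pt !rmorphD !rmorphM /= -!pmulrn; ring.
Qed.

Lemma nz_prime_ideal_gen P : nz_prime_ideals P ->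
  exists2 c, c != 0 & P = pideal c.
Proof.
move=> [[Pi P1 PM] P0]; have [c Pc] := A_principal Pi; exists c => //.
apply/eqP => c0; apply: P0; rewrite Pc c0; apply/seteqP; split=> x /=.
  by move=> /pidealP[y ->]; rewrite mulr0.
by move=> ->; exact: pideal_id.
Qed.

Lemma nrm_eq1 a : nrm L a = 1%N -> a * conjA L a = 1.
Proof. by move=> a1; rewrite mul_conjA a1. Qed.

(** A nonzero prime ideal is maximal: if [P = (c)] and [(c, mu) = (d)] then [d]
    divides [c], and [P] contains [d] or the cofactor. *)
Lemma prime_comaximal P (mu : A) : nz_prime_ideals P -> ~ P mu ->
  exists v, P (1 - mu * v).
Proof.
move=> Pp Pmu; have [c c0 Pc] := nz_prime_ideal_gen Pp.
have [[Pi P1 PM] _] := Pp.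
pose J := [set x : A | exists y z, x = y * c + z * mu].
have Ji : is_ideal J.
  split; first by exists 0, 0; ring.
  - by move=> x y [? [? ->]] [? [? ->]]; eexists; eexists; rewrite addrACA -!mulrDl.
  - by move=> x y [? [? ->]]; eexists; eexists; rewrite mulrDr !mulrA.
have [d Jd] := A_principal Ji.
have Jc : J c by exists 1, 0; ring.
have Jmu : J mu by exists 0, 1; ring.
have Pcc : P c by rewrite Pc; exact: pideal_id.
move: Jc Jmu; rewrite Jd => /pidealP[e ce] /pidealP[f muf].
have [Pe|Pd] : P e \/ P d by apply: PM; rewrite -ce.
- have /pidealP[e' ee'] : pideal c e by rewrite -Pc.
  have : J (e' * d) by rewrite Jd; apply/pidealP; exists e'.
  have -> : e' * d = 1.
    by apply: (mulA_inj L c0) => /=; rewrite mulr1 [in RHS]ce ee'; ring.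
  move=> [y [z e1]]; exists z; rewrite e1 [mu * z]mulrC addrK; case: Pi => _ _ PZ; exact: PZ.
- by case: Pmu; rewrite muf; case: Pi => _ _ PZ; exact: PZ.
Qed.

Lemma prime_avoid P Q : nz_prime_ideals P -> nz_prime_ideals Q -> P <> Q ->
  exists2 mu, Q mu & ~ P mu.
Proof.
move=> Pp Qp PQ; apply: contrapT => H.
have QP : Q `<=` P by move=> x Qx; apply: contrapT => Px; apply: H; exists x.
apply: PQ; apply/seteqP; split=> // x Px; apply: contrapT => Qx.
have [v Qv] := prime_comaximal Qp Qx.
have [[Pi P1 _] _] := Pp; apply: P1.
rewrite -(subrK (x * v) 1); case: (Pi) => _ PD _; apply: PD; first exact: QP.
exact: ideal_mulr.
Qed.

(** Translations by the multiples of such a [mu] reach every class modulo [P]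
    without changing the classes modulo the primes of [s]. *)
Lemma primes_avoid P (s : seq (set A)) : nz_prime_ideals P ->
  (forall Q, Q \in s -> nz_prime_ideals Q /\ P <> Q) ->
  exists2 mu, (forall Q, Q \in s -> Q mu) & ~ P mu.
Proof.
move=> Pp; have [[Pi P1 PM] _] := Pp; elim: s => [|Q s IH] Hs.
  by exists 1.
have [|mu mus Pmu] := IH; first by move=> Q' Q's; apply: Hs; rewrite inE Q's orbT.
have [Qp PQ] := Hs Q (mem_head _ _).
have [nu Qnu Pnu] := prime_avoid Pp Qp PQ.
exists (mu * nu); last by move=> /PM[].
move=> Q'; rewrite inE => /predU1P[->|Q's].
  by case: Qp => [[[_ _ QM] _ _] _]; exact: QM.
have [[[Q'i _ _] _] _] := Hs Q' (mem_behead (s := Q :: s) Q's).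
by apply: ideal_mulr => //; exact: mus.
Qed.

(** A nonunit lies in a prime ideal: descend along divisors of smaller norm. *)
Lemma nonunit_in_prime a : a != 0 -> ~ (exists b, a * b = 1) ->
  exists2 P, nz_prime_ideals P & P a.
Proof.
elim/ltn_ind: {a}(nrm L a) {1 3 4 5}a (erefl (nrm L a)) => n IH a na a0 au.
have [pr|npr] := pselect (is_prime_ideal (pideal a)).
  exists (pideal a); last exact: pideal_id.
  split=> // /seteqP[/(_ a (pideal_id a)) /= a0' _].
  by rewrite a0' eqxx in a0.
have [x [y [xy nx ny]]] : exists x y, [/\ pideal a (x * y), ~ pideal a x & ~ pideal a y].
  apply: contrapT => H; apply: npr; split; first exact: pideal_ideal.
    by move=> /pidealP[b ab]; apply: au; exists b; rewrite mulrC -ab.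
  move=> x y xy; have [ax|nax] := pselect (pideal a x); first by left.
  by right; apply: contrapT => nay; apply: H; exists x, y.
pose J := [set w : A | exists y z, w = y * a + z * x].
have Ji : is_ideal J.
  split; first by exists 0, 0; ring.
  - by move=> u v [? [? ->]] [? [? ->]]; eexists; eexists; rewrite addrACA -!mulrDl.
  - by move=> u v [? [? ->]]; eexists; eexists; rewrite mulrDr !mulrA.
have [d Jd] := A_principal Ji.
have Ja : J a by exists 1, 0; ring.
have Jx : J x by exists 0, 1; ring.
have Jd' : J d by rewrite Jd; exact: pideal_id.
move: Ja Jx; rewrite Jd => /pidealP[e ae] /pidealP[f xf].
have d0 : d != 0 by apply: contra a0 => /eqP d0; rewrite ae d0 mulr0.
have e0 : e != 0 by apply: contra a0 => /eqP e0; rewrite ae e0 mul0r.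
have du : ~ exists b, d * b = 1.
  move=> [b db]; have [u [v duv]] := Jd'; apply: ny.
  have [w xyw] := (pidealP a (x * y)).1 xy.
  apply/pidealP; exists (b * y * u + b * v * w).
  rewrite mulrDl -[b * v * w * a]mulrA -xyw -[LHS]mulr1 -db duv; ring.
have e1 : (1 < nrm L e)%N.
  rewrite ltn_neqAle nrm_gt0 // andbT eq_sym; apply/eqP => /nrm_eq1 eu.
  apply: nx; apply/pidealP; exists (f * conjA L e).
  by rewrite ae xf -[LHS]mulr1 -eu; ring.
have nd : (nrm L d < n)%N.
  by rewrite -na ae nrmM ltn_Pmull // nrm_gt0.
have [P Pp Pd] := IH _ nd d (erefl _) d0 du.
by exists P => //; rewrite ae; case: Pp => [[[_ _ PM] _ _] _]; exact: PM.
Qed.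

(** If [(a, b) = (d)] and [d] is not a unit, a prime ideal containing [d]
    contains both [a] and [b]. *)
Lemma coprimeP a b : a != 0 ->
  (exists y, pideal a (b * y - 1)) <->
  (forall P, nz_prime_ideals P -> P a -> ~ P b).
Proof.
move=> a0; split=> [[y /pidealP[z e]] P [[Pi P1 _] _] Pa Pb|H].
  apply: P1; rewrite (_ : 1 = b * y - z * a); last by rewrite -e; ring.
  apply: ideal_sub => //; first exact: ideal_mulr.
  by case: Pi => _ _ PZ; exact: PZ.
pose J := [set w : A | exists y z, w = y * a + z * b].
have Ji : is_ideal J.
  split; first by exists 0, 0; ring.
  - by move=> u v [? [? ->]] [? [? ->]]; eexists; eexists; rewrite addrACA -!mulrDl.
  - by move=> u v [? [? ->]]; eexists; eexists; rewrite mulrDr !mulrA.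
have [d Jd] := A_principal Ji.
have Ja : J a by exists 1, 0; ring.
have Jb : J b by exists 0, 1; ring.
have Jd' : J d by rewrite Jd; exact: pideal_id.
move: Ja Jb; rewrite Jd => /pidealP[e ae] /pidealP[f bf].
have d0 : d != 0 by apply: contra a0 => /eqP d0; rewrite ae d0 mulr0.
have [[c dc]|du] := pselect (exists c, d * c = 1).
  have [u [v duv]] := Jd'; exists (v * c); apply/pidealP; exists (- (u * c)).
  by rewrite -dc duv; ring.
have [P Pp Pd] := nonunit_in_prime d0 du.
have [[[_ _ PM] _ _] _] := Pp.
by case: (H P Pp); rewrite ?ae ?bf; exact: PM.
Qed.

(** The generators divide [a], so they have bounded norm. *)
Lemma primes_over_finite a : a != 0 ->
  finite_set [set P | nz_prime_ideals P /\ P a].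
Proof.
move=> a0.
apply: (@sub_finite_set _ _ (@pideal A @` [set c | (nrm L c)%:R <= (nrm L a)%:R ^+ 2 :> R])).
  move=> P [/nz_prime_ideal_gen[c c0 ->] /pidealP[e ae]]; exists c => //=.
  have e0 : (0 < nrm L e)%N.
    by apply: nrm_gt0; apply: contra a0 => /eqP e0; rewrite ae e0 mul0r.
  rewrite -natrX ler_nat ae nrmM; apply: leq_trans (leq_pmull _ e0) _.
  by rewrite -{1}[(_ * _)%N]expn1 leq_pexp2l // muln_gt0 e0 nrm_gt0.
by apply: finite_image; exact: disc_finite.
Qed.



Lemma qmeanD M (g h : A -> R) :
  qmean L M (fun p => g p + h p) = qmean L M g + qmean L M h.
Proof.
rewrite /qmean -mulrDr -big_split /=; congr (_ * _); apply: eq_bigr => j _.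
by rewrite -mulrDr -big_split.
Qed.

Lemma qmeanZ M c (g : A -> R) : qmean L M (fun p => c * g p) = c * qmean L M g.
Proof.
rewrite /qmean [RHS]mulrCA; congr (_ * _); rewrite [RHS]mulr_sumr.
apply: eq_bigr => j _; rewrite [RHS]mulrCA; congr (_ * _).
by rewrite mulr_sumr.
Qed.

Lemma qmean_sum M (T : eqType) (s : seq T) (f : T -> A -> R) : (0 < M)%N ->
  qmean L M (fun p => \sum_(i <- s) f i p) = \sum_(i <- s) qmean L M (f i).
Proof.
move=> M0; elim: s => [|i s IH].
  by rewrite big_nil -[RHS](qmean_const L 0 M0); congr qmean; apply/funext => p; rewrite big_nil.
rewrite big_cons -IH -qmeanD; congr qmean; apply/funext => p.
by rewrite big_cons.
Qed.

Lemma indic_periodic M I r : is_ideal I -> I M%:R ->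
  periodic_mod M (fun p => \1_I (p - r) : R).
Proof.
move=> Ii IM a b; rewrite !indicE; congr (_%:R); apply: congr1.
apply/idP/idP; rewrite !inE => h.
  rewrite (_ : a - r = (a + M%:R * b - r) - M%:R * b); last by ring.
  by apply: ideal_sub => //; exact: ideal_mulr.
rewrite addrAC; case: (Ii) => _ ID _; apply: ID => //; exact: ideal_mulr.
Qed.

Lemma quotientP I Q : quotient I Q <-> exists r, Q = residue I r.
Proof. by split=> [[r _ <-]|[r ->]]; exists r. Qed.

Lemma sum_classes I (U : set (set A)) p : is_ideal I -> U `<=` quotient I ->
  finite_set U ->
  \sum_(Q <- fset_set U) (\1_Q p : R) = \1_U (residue I p).
Proof.
move=> Ii UI fU.
have classE Q : Q \in fset_set U -> (p \in Q) = (Q == residue I p).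
  rewrite in_fset_set // inE => /UI /quotientP[r ->].
  apply/idP/eqP; rewrite inE => h.
    by apply/(eq_residue _ _ Ii); rewrite -opprB -mulN1r; case: (Ii) => _ _; exact.
  by rewrite h /residue /= subrr; case: Ii.
rewrite big_seq (eq_bigr (fun Q => if Q == residue I p then 1 else 0)); last first.
  by move=> Q QU; rewrite indicE classE //; case: eqP.
rewrite -big_seq -big_mkcond /= indicE -(in_fset_set fU).
have [h|h] := boolP (residue I p \in _).
  by rewrite -big_filter filter_pred1_uniq ?fset_uniq // big_seq1.
rewrite big_seq_cond big1 // => Q /andP[QU /eqP Qp].
by rewrite -Qp QU in h.
Qed.

Section ClassMeans.
Variables (M : nat) (I : set A).
Hypotheses (M_gt0 : (0 < M)%N) (I_ideal : is_ideal I) (IM : I M%:R).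

Lemma idealN_gt0 : (0 < idealN I)%N.
Proof.
rewrite /idealN /ncard lt0n cardfs_eq0; apply/eqP => e.
have fq := quotient_finite I_ideal M_gt0 IM.
have : residue I 0 \in fset_set (quotient I).
  by rewrite in_fset_set // inE; apply/quotientP; exists 0.
by rewrite e inE.
Qed.

(** Translating by multiples of [mu] permutes the classes transitively and
    leaves [g] unchanged: all classes contribute equally to the mean of [g]. *)
Lemma qmean_class g mu : periodic_mod M g ->
  (forall p b, g (p + mu * b) = g p) -> (exists v, I (1 - mu * v)) ->
  forall r, qmean L M (fun p => g p * \1_I (p - r)) = qmean L M g / (idealN I)%:R.
Proof.
move=> gper gmu [v Iv] r.
pose h r := qmean L M (fun p => g p * \1_I (p - r)).
have h_const r' : h r' = h r.
  pose c := mu * (v * (r' - r)).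
  have per : periodic_mod M (fun p => g p * \1_I (p - r') : R).
    by move=> a b; rewrite gper (indic_periodic r' I_ideal IM).
  rewrite /h -(qmean_shift L c per); congr qmean; apply/funext => p.
  rewrite gmu; congr (_ * _); rewrite !indicE; congr (_%:R); apply: congr1.
  have e : p + c - r' = (p - r) - (1 - mu * v) * (r' - r) by rewrite /c; ring.
  have I1 : I ((1 - mu * v) * (r' - r)) by exact: ideal_mulr.
  apply/idP/idP; rewrite !inE => Ip; last by rewrite e; exact: ideal_sub.
  rewrite (_ : p - r = (p + c - r') + (1 - mu * v) * (r' - r)); last by rewrite e; ring.
  by case: (I_ideal) => _ ID _; exact: ID.
have fq := quotient_finite I_ideal M_gt0 IM.
have total : \sum_(Q <- fset_set (quotient I)) qmean L M (fun p => g p * \1_Q p)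
    = qmean L M g.
  rewrite -qmean_sum //; congr qmean; apply/funext => p.
  rewrite -mulr_sumr (sum_classes p I_ideal (@subset_refl _ _) fq) indicE mem_set ?mulr1 //.
  by apply/quotientP; exists p.
have N0 : (idealN I)%:R != 0 :> R by rewrite pnatr_eq0 -lt0n idealN_gt0.
apply: (mulIf N0); rewrite divfK // -total big_seq (eq_bigr (fun=> h r)).
  rewrite -big_seq big_const_seq count_predT iter_addr_0.
  by rewrite /idealN /ncard mulr_natr.
move=> Q; rewrite in_fset_set // inE => /quotientP[r' ->].
by rewrite -(h_const r').
Qed.

Lemma qmean_residue r : qmean L M (fun p => \1_I (p - r)) = (idealN I)%:R^-1.
Proof.
have v1 : exists v, I (1 - 1 * v).
  by exists 1; rewrite mulr1 subrr; case: I_ideal.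
have := @qmean_class (fun=> 1) 1 (fun _ _ => erefl) (fun _ _ => erefl) v1 r.
rewrite qmean_const // mul1r => <-.
by congr qmean; apply/funext => p; rewrite mul1r.
Qed.

End ClassMeans.

(** Independence of the primes, by induction: the product over the other primes
    is invariant under the multiples of an element invertible modulo [P]. Two
    residue conditions per prime suffice for [phi(a)] and for the correlation
    of [phi] with its translate by [k]. *)
Lemma qmean_prime_product M (k : A) (s : seq (set A)) (c c' : set A -> R) :
    (0 < M)%N -> uniq s ->
    (forall P, P \in s -> nz_prime_ideals P /\ P M%:R) ->
  let h P p := 1 - c P * \1_P p - c' P * \1_P (p + k) in
  qmean L M (fun p => \prod_(P <- s) h P p) =
  \prod_(P <- s) (1 - (c P + c' P) / (idealN P)%:R).
Proof.
move=> M0 us sp h.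
have hmul P mu p b : is_ideal P -> P mu -> h P (p + mu * b) = h P p.
  move=> Pi Pmu; have Pmb := ideal_mulr b Pi Pmu; rewrite /h.
  have E q : \1_P (q + mu * b) = \1_P q :> R.
    rewrite !indicE; congr (_%:R); apply: congr1; apply/idP/idP; rewrite !inE => Pq.
      by rewrite -(addrK (mu * b) q); exact: ideal_sub.
    by case: (Pi) => _ PD _; exact: PD.
  by rewrite [p + mu * b + k]addrAC !E.
elim: s us sp => [_ _|P s IH /= /andP[Ps us] sp].
  rewrite big_nil -[RHS](qmean_const L 1 M0).
  by congr qmean; apply/funext => p; rewrite big_nil.
have sp' Q : Q \in s -> nz_prime_ideals Q /\ Q M%:R.
  by move=> Qs; apply: sp; rewrite inE Qs orbT.
rewrite big_cons -(IH us sp').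
set g := fun p => \prod_(P <- s) h P p.
have [Pp PM] := sp P (mem_head _ _); have [[Pi _ _] _] := Pp.
have gper : periodic_mod M g.
  move=> a b; rewrite /g !big_seq; apply: eq_bigr => Q Qs.
  by have [[[Qi _ _] _] QM] := sp' Q Qs; exact: hmul.
have [|mu smu Pmu] := @primes_avoid P s Pp.
  move=> Q Qs; have [Qp _] := sp' Q Qs; split=> // PQ.
  by rewrite PQ Qs in Ps.
have gmu p b : g (p + mu * b) = g p.
  rewrite /g !big_seq; apply: eq_bigr => Q Qs.
  have [[[Qi _ _] _] _] := sp' Q Qs; apply: hmul => //; exact: smu.
have cls := qmean_class M0 Pi PM gper gmu (prime_comaximal Pp Pmu).
transitivity (qmean L M (fun p => g p +
    (- c P * (g p * \1_P (p - 0)) + - c' P * (g p * \1_P (p - (- k)))))).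
  congr qmean; apply/funext => p; rewrite big_cons -/(g p) /h subr0 opprK; ring.
rewrite !qmeanD !qmeanZ !cls; ring.
Qed.

End Ideals.

(** * Norms of ideals and the totient *)

Section NormPhi.
Variables (R : realType) (A : comNzRingType) (L : quad_order R A).
Implicit Types (I J P Q : set A) (a b c p r : A) (x : R).
Hypothesis A_principal : is_principal_ring A.

Lemma o_sq_scale (F : R -> R) s : o_sq F -> 0 <= s -> o_sq (fun x => F (s * x)).
Proof.
move=> oF s0 eps e0.
have s1 : 0 < s ^+ 2 + 1 by rewrite ltr_wpDl // sqr_ge0.
have [D HD] := oF _ (divr_gt0 e0 s1); exists D => x x0.
apply: le_trans (HD _ (mulr_ge0 s0 x0)) _.
rewrite lerD2r exprMn mulrA ler_wpM2r ?sqr_ge0 // mulrAC ler_pdivrMr //.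
by rewrite ler_wpM2l ?(ltW e0) // lerDl.
Qed.

Lemma o_sq_const (c : R) : o_sq (fun x => c * x ^+ 2) -> c = 0.
Proof.
move=> H; apply/eqP/negPn/negP => c0.
have n0 : 0 < `|c| by rewrite normr_gt0.
have [D HD] := H _ (divr_gt0 n0 (ltr0n R 2)).
pose y := 2 * `|D| / `|c| + 1.
have y1 : 1 <= y by rewrite /y lerDr divr_ge0 ?mulr_ge0.
have y0 : 0 <= y by lra.
have := HD y y0; rewrite normrM (ger0_norm (sqr_ge0 _)) => h.
have : `|c| * y <= `|c| * y ^+ 2 by rewrite ler_pM2l // expr2 ler_peMl.
have : `|c| * y = 2 * `|D| + `|c| by rewrite /y; field; rewrite gt_eqF.
have := ler_norm D; lra.
Qed.

Lemma full_cone x : 0 <= x ->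
  cone L (- pi) pi x = [set p | p != 0 /\ (nrm L p)%:R <= x ^+ 2].
Proof.
move=> x0; apply/seteqP; split=> p; first exact: cone_disc.
move=> [p0 px]; have [|t [rho [tp r0 re_ im_]]] := @polar R (re L p) (im L p).
  apply: contra p0 => /eqP[r0 i0]; apply/eqP.
  by apply: (re_im_inj (L := L)); rewrite ?re0 ?im0.
exists t, rho; split=> //; rewrite r0 /=.
rewrite -(ler_pXn2r (ltn0Sn 1)) ?nnegrE ?(ltW r0) //; move: px.
by rewrite nrm_re_im re_ im_ !exprMn -mulrDr cos2Dsin2 mulr1.
Qed.

Lemma sum_indic (S T : set A) : finite_set S ->
  \sum_(p \in S) (\1_T p : R) = \sum_(p \in S `&` T) (1 : R).
Proof.
move=> fS; rewrite fsbig_mkcondr; apply: eq_fsbigr => p _.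
by rewrite indicE; case: (p \in T).
Qed.

(** The norm is multiplicative, so dividing by [a] shrinks the disc by [|a|]. *)
Lemma multiples_in_disc a x : a != 0 -> 0 <= x ->
  [set p | p != 0 /\ (nrm L p)%:R <= x ^+ 2] `&` pideal a =
  [set a * b | b in [set b | b != 0 /\
     (nrm L b)%:R <= ((Num.sqrt (nrm L a)%:R)^-1 * x) ^+ 2]].
Proof.
move=> a0 x0.
have n0 : 0 < (nrm L a)%:R :> R by rewrite ltr0n nrm_gt0.
have E b : ((nrm L (a * b))%:R <= x ^+ 2) =
    ((nrm L b)%:R <= ((Num.sqrt (nrm L a)%:R)^-1 * x) ^+ 2 :> R).
  rewrite exprMn exprVn sqr_sqrtr // nrmM natrM.
  by rewrite ler_pdivlMl.
apply/seteqP; split=> p.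
  move=> [[p0 px] /pidealP[b pb]]; exists b; last by rewrite pb mulrC.
  move: p0 px; rewrite pb mulrC E (mulA_eq0 L) ?negb_or => /andP[_ b0] h.
  by split.
move=> [b [b0 h] <-]; split; last by apply/pidealP; exists b; rewrite mulrC.
by split; [rewrite (mulA_eq0 L) negb_or a0|rewrite E].
Qed.

(** Both sides are the inverse of the density of the multiples of [a] in the
    plane, computed modulo [nrm a] and by rescaling. *)
Lemma idealN_pideal a : a != 0 -> idealN (pideal a) = nrm L a.
Proof.
move=> a0; have M0 := nrm_gt0 L a0.
have I0 := covol_gt0 L; have pi0 := pi_gt0 R.
have aM := nrm_in_ideal L (pideal_ideal a) (pideal_id a).
have n0 : 0 < (nrm L a)%:R :> R by rewrite ltr0n.
have pp : - pi <= pi :> R by lra.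
have p2 : pi - - pi <= 2 * pi :> R by lra.
have i1 p : `|\1_(pideal a) (p - 0) : R| <= 1.
  by rewrite indicE; case: (_ \in _); rewrite ?normr1 ?normr0.
have d1 := cone_density_periodic L M0 (indic_periodic R 0 (pideal_ideal a) aM) i1 pp p2.
rewrite (qmean_residue L M0 (pideal_ideal a) aM 0) in d1.
have d2 : cone_density L (fun=> 1) 1 (- pi) pi.
  have := @cone_density_periodic R A L _ M0 (fun=> 1) (- pi) pi.
  by rewrite qmean_const //; apply => // p; rewrite normr1.
pose s : R := (Num.sqrt (nrm L a)%:R)^-1.
have s0 : 0 <= s by rewrite invr_ge0 sqrtr_ge0.
have := o_sq_scale d2 s0.
have s2 : s ^+ 2 = (nrm L a)%:R^-1 by rewrite exprVn sqr_sqrtr // ltW.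
have eqs x : 0 <= x -> \sum_(p \in cone L (- pi) pi x) (\1_(pideal a) (p - 0) : R) =
    \sum_(p \in cone L (- pi) pi (s * x)) (1 : R).
  move=> x0; transitivity (\sum_(p \in cone L (- pi) pi x) (\1_(pideal a) p : R)).
    by apply: eq_fsbigr => p _; rewrite subr0.
  rewrite sum_indic ?full_cone ?mulr_ge0 //; last first.
    by rewrite -full_cone //; exact: cone_finite.
  rewrite multiples_in_disc // fsbig_image // => u v _ _.
  exact: (mulA_inj L a0).
move=> d3; have : o_sq (fun x => (((nrm L a)%:R^-1 - (idealN (pideal a))%:R^-1)
    * (pi / covol L)) * x ^+ 2).
  have d4 : o_sq (fun x => - 1 * (\sum_(p \in cone L (- pi) pi (s * x)) (1 : R)
     - 1 * (pi - - pi) / (2 * covol L) * (s * x) ^+ 2)).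
    apply: o_sq_le d3 => x x0; by rewrite mulN1r normrN.
  apply: o_sq_ext (o_sqD d1 d4) => x x0; rewrite eqs // exprMn s2.
  by field; rewrite !gt_eqF //= ?ltr0n ?(idealN_gt0 L M0 (pideal_ideal a)).
move/o_sq_const/eqP; rewrite mulf_eq0 (gt_eqF (divr_gt0 pi0 I0)) orbF subr_eq0.
by move=> /eqP/invr_inj/eqP; rewrite eqr_nat => /eqP.
Qed.

Definition primes_over a : set (set A) := [set P | nz_prime_ideals P /\ P a].

Lemma prime_norm P : nz_prime_ideals P -> exists c,
  [/\ c != 0, P = pideal c, idealN P = nrm L c & (2 <= idealN P)%N].
Proof.
move=> Pp; have [c c0 Pc] := nz_prime_ideal_gen A_principal Pp.
have NP : idealN P = nrm L c by rewrite Pc idealN_pideal.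
exists c; split=> //; rewrite NP ltn_neqAle nrm_gt0 // andbT eq_sym.
apply/eqP => /nrm_eq1 c1; have [[_ P1 _] _] := Pp; apply: P1.
by rewrite Pc; apply/pidealP; exists (conjA L c); rewrite mulrC.
Qed.

Lemma prod_indic (s : seq (set A)) (p : A) :
  \prod_(P <- s) (1 - \1_P p : R) = (all (fun P => p \notin P) s)%:R.
Proof.
elim: s => [|P s IH]; first by rewrite big_nil.
by rewrite big_cons IH indicE /=; case: (p \in P); rewrite /= ?subrr ?mul0r ?subr0 ?mul1r.
Qed.

(** The units modulo [a] are the residues avoiding every prime over [a], and
    these conditions are independent. *)
Lemma phiE a : a != 0 -> (phi a)%:R =
  (nrm L a)%:R * \prod_(P <- fset_set (primes_over a)) (1 - (idealN P)%:R^-1) :> R.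
Proof.
move=> a0; have M0 := nrm_gt0 L a0.
have Ii := pideal_ideal a; have aM := nrm_in_ideal L Ii (pideal_id a).
have fq := quotient_finite L Ii M0 aM.
have fP : finite_set (primes_over a) := primes_over_finite L A_principal a0.
set U := quotient_units (pideal a).
have UI : U `<=` quotient (pideal a).
  by move=> _ [r _ <-]; apply/quotientP; exists r.
have fU : finite_set U by apply: sub_finite_set fq.
have n0 : (nrm L a)%:R != 0 :> R by rewrite pnatr_eq0 -lt0n.
have := qmean_prime_product L A_principal 0 (s := fset_set (primes_over a))
  (fun=> 1) (fun=> 0) M0 (fset_uniq _).
have sP P : P \in fset_set (primes_over a) -> nz_prime_ideals P /\ P (nrm L a)%:R.
  rewrite in_fset_set // inE => -[Pp Pa]; split=> //.
  by apply: nrm_in_ideal => //; case: Pp => [[]].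
move=> /(_ sP) /= => e; rewrite /phi (negbTE a0).
have -> : \prod_(P <- fset_set (primes_over a)) (1 - (idealN P)%:R^-1) =
   \prod_(P <- fset_set (primes_over a)) (1 - (1 + 0) / (idealN P)%:R) :> R.
  by apply: eq_bigr => P _; rewrite addr0 mul1r.
rewrite -e {e}.
have -> : (fun p => \prod_(P <- fset_set (primes_over a)) (1 - 1 * \1_P p - 0 * \1_P (p + 0)))
    = (fun p => \sum_(Q <- fset_set U) \1_Q p) :> (A -> R).
  apply/funext => p; rewrite (sum_classes R p Ii UI fU).
  under eq_bigr do rewrite mul1r mul0r subr0.
  rewrite prod_indic indicE; congr (_%:R); apply: congr1.
  have resE y : residue (pideal a) (p * y) = residue (pideal a) 1 <->
     pideal a (p * y - 1) by exact: eq_residue.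
  apply/allP/idP => [H|].
    rewrite inE; have /(coprimeP L A_principal _ a0)[y py] :
        forall P, nz_prime_ideals P -> P a -> ~ P p.
      move=> P Pp Pa Ppp; have := H P; rewrite in_fset_set // !inE.
      by move=> /(_ (conj Pp Pa)); rewrite notin_setE.
    by exists p => //; exists y; apply/resE.
  rewrite inE => -[r [y ry] rp] P; rewrite in_fset_set // inE => -[Pp Pa].
  rewrite notin_setE; apply: ((coprimeP L A_principal p a0).1 _ P Pp Pa).
  have /(eq_residue _ _ Ii) rp' := rp.
  have /(eq_residue _ _ Ii) ry' := ry.
  exists y; rewrite (_ : p * y - 1 = (r * y - 1) - (r - p) * y); last by ring.
  by apply: ideal_sub => //; exact: ideal_mulr.
rewrite qmean_sum // big_seq (eq_bigr (fun=> (nrm L a)%:R^-1)); last first.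
  move=> Q; rewrite in_fset_set // inE => /UI /quotientP[r ->].
  by rewrite -[in RHS](idealN_pideal a0) -(qmean_residue L M0 Ii aM r).
rewrite -big_seq big_const_seq count_predT iter_addr_0 /ncard.
by rewrite -[_^-1 *+ _]mulr_natr mulVKf.
Qed.

End NormPhi.

(** * Truncated Euler products *)

Section Tails.
Variables (R : realType) (A : comNzRingType) (L : quad_order R A).
Implicit Types (I J P Q : set A) (a b c p r : A) (x : R) (s t : seq (set A)).
Hypothesis A_principal : is_principal_ring A.

Let N P : R := (idealN P)%:R.

Lemma prod_one_minus (T : eqType) (u : seq T) (y : T -> R) :
  (forall i, i \in u -> 0 <= y i <= 1) ->
  0 <= \prod_(i <- u) (1 - y i) <= 1 /\
  1 - \sum_(i <- u) y i <= \prod_(i <- u) (1 - y i).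
Proof.
elim: u => [|i u IH] yu; first by rewrite !big_nil subr0 ler01 lexx.
have [] := IH; first by move=> j ju; apply: yu; rewrite inE ju orbT.
rewrite !big_cons; move: (\prod_(_ <- _) _) (\sum_(_ <- _) _) => p S.
have /andP[y0 y1] := yu i (mem_head _ _).
move=> /andP[p0 p1] Sp; split; first by apply/andP; split; nra.
nra.
Qed.

Lemma prime_N_ge2 P : nz_prime_ideals P -> 2 <= N P.
Proof.
by move=> /(prime_norm L A_principal)[c [_ _ _ h]]; rewrite /N (ler_nat _ 2).
Qed.

Lemma prime_invN P : nz_prime_ideals P -> 0 <= (N P)^-1 <= 1.
Proof.
move=> /prime_N_ge2 h; rewrite invr_ge0 invf_le1; last by lra.
by apply/andP; split; lra.
Qed.

(** The quotient of [phi a] by the norm of [a], for [a] nonzero. *)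
Definition euler_factor a : R :=
  \prod_(P <- fset_set (primes_over a)) (1 - (idealN P)%:R^-1).

(** Unlike [euler_factor] it is periodic, with period any integer lying in all
    the ideals of [s]. *)
Definition euler_trunc s a : R :=
  \prod_(P <- s) (1 - (idealN P)%:R^-1 * \1_P a).

Lemma euler_factor_bounds a : a != 0 -> 0 <= euler_factor a <= 1.
Proof.
move=> a0; apply: (prod_one_minus _).1 => P.
rewrite in_fset_set ?inE; last exact: primes_over_finite L A_principal _ a0.
by move=> [/prime_invN].
Qed.

Lemma euler_trunc_bounds s a : (forall P, P \in s -> nz_prime_ideals P) ->
  0 <= euler_trunc s a <= 1.
Proof.
move=> sp; apply: (prod_one_minus _).1 => P /sp /prime_invN /andP[n0 n1].
by rewrite indicE; case: (_ \in _); rewrite ?mulr1 ?mulr0 ?n0 ?lexx ?ler01.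
Qed.

(** Primes of [s] that do not contain [a] have trivial factors, so the truncation
    is a partial product of [euler_factor a]; the missing factors are close to 1. *)
Lemma euler_trunc_error s a : a != 0 -> uniq s ->
  (forall P, P \in s -> nz_prime_ideals P) ->
  `|euler_trunc s a - euler_factor a| <=
    \sum_(P <- fset_set (primes_over a) | P \notin s) (N P)^-1.
Proof.
move=> a0 us sp; have fP : finite_set (primes_over a).
  exact: primes_over_finite L A_principal _ a0.
set T := fset_set (primes_over a).
have TP P : P \in T = (P \in primes_over a) by rewrite in_fset_set.
have -> : euler_trunc s a = \prod_(P <- T | P \in s) (1 - (N P)^-1).
  rewrite /euler_trunc (eq_bigr (fun P => if a \in P then 1 - (N P)^-1 else 1)).
    rewrite -big_mkcond -big_filter -[RHS]big_filter; apply: perm_big.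
    apply: uniq_perm; rewrite ?filter_uniq ?fset_uniq // => P.
    rewrite !mem_filter TP; apply/idP/idP => /andP[].
      by rewrite inE => Pa Ps; rewrite Ps inE; split=> //; exact: sp.
    by rewrite !inE => Ps [_ Pa]; rewrite Ps andbT inE.
  by move=> P _; rewrite indicE; case: (a \in P); rewrite ?mulr1 ?mulr0 ?subr0.
pose X : R := \prod_(P <- T | P \in s) (1 - (N P)^-1).
pose Y : R := \prod_(P <- T | P \notin s) (1 - (N P)^-1).
have -> : euler_factor a = X * Y by rewrite /euler_factor (bigID (fun P => P \in s)).
rewrite -/X.
have Tb P : P \in T -> 0 <= (N P)^-1 <= 1.
  by rewrite TP inE => -[/prime_invN].
have [] := @prod_one_minus _ [seq P <- T | P \in s] (fun P => (N P)^-1).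
  by move=> P; rewrite mem_filter => /andP[_ /Tb].
have [] := @prod_one_minus _ [seq P <- T | P \notin s] (fun P => (N P)^-1).
  by move=> P; rewrite mem_filter => /andP[_ /Tb].
rewrite !big_filter -/X -/Y => /andP[Y0 Y1] hY /andP[X0 X1] _.
rewrite -[X in `|X - _|]mulr1 -mulrBr ger0_norm; last by rewrite mulr_ge0 // subr_ge0.
apply: (@le_trans _ _ (1 * (1 - Y))); first by rewrite ler_wpM2r // subr_ge0.
by rewrite mul1r; lra.
Qed.

Definition punctured_disc x : set A := [set p | p != 0 /\ (nrm L p)%:R <= x ^+ 2].

Lemma finite_disc x : finite_set (punctured_disc x).
Proof. by apply: sub_finite_set (disc_finite L x) => p []. Qed.

(** With [P = (c)] the points of [P] are the [c b], and [b] runs through the disc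
    of radius [x / |c|]. *)
Lemma prime_multiples_count P x : nz_prime_ideals P -> 0 <= x ->
  \sum_(a \in punctured_disc x) (\1_P a : R) <= disc_const L * x ^+ 2 / N P.
Proof.
move=> Pp x0; have [c [c0 Pc NP _]] := prime_norm L A_principal Pp.
rewrite sum_indic; last exact: finite_disc.
rewrite {1}Pc /N NP /punctured_disc (multiples_in_disc L c0 x0).
rewrite fsbig_image; last by move=> u v _ _; exact: (mulA_inj L c0).
apply: le_trans (disc_count L _) _.
  by rewrite mulr_ge0 // invr_ge0 sqrtr_ge0.
by rewrite exprMn exprVn sqr_sqrtr // mulrCA mulrA [_^-1 * _]mulrC mulrAC.
Qed.

(** Convergence of the sum of [1 / N P ^ 2] is stated through the finite families
    of primes outside [s]. *)
Definition tail_le s (dl : R) := forall t, uniq t ->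
  (forall P, P \in t -> nz_prime_ideals P /\ P \notin s) ->
  \sum_(P <- t) (N P) ^- 2 <= dl.

(** Exchanging the sums over points and over primes: a prime [P] outside [s]
    contributes [1 / N P] at each of the [O(x ^ 2 / N P)] points it contains. *)
Lemma euler_trunc_average s dl x : 0 <= x -> uniq s ->
  (forall P, P \in s -> nz_prime_ideals P) -> tail_le s dl ->
  \sum_(a \in punctured_disc x) `|euler_trunc s a - euler_factor a|
    <= disc_const L * x ^+ 2 * dl.
Proof.
move=> x0 us sp tl.
have fP a : a != 0 -> finite_set (primes_over a).
  exact: primes_over_finite L A_principal _.
pose TT := fset_set (\bigcup_(a in punctured_disc x) primes_over a).
have fTT : finite_set (\bigcup_(a in punctured_disc x) primes_over a).
  by apply: bigcup_finite => [|a [a0 _]]; [exact: finite_disc|exact: fP].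
pose t := [seq P <- TT | P \notin s].
have tt P : P \in t -> nz_prime_ideals P /\ P \notin s.
  rewrite mem_filter in_fset_set // => /andP[Ps]; rewrite inE => -[a _ [Pp _]].
  by split.
have ut : uniq t by rewrite filter_uniq // fset_uniq.
apply: (@le_trans _ _ (\sum_(a \in punctured_disc x) \sum_(P <- t) (N P)^-1 * \1_P a)).
  apply: ler_fsum => [|a da]; first exact: finite_disc.
  have [a0 _] := da; apply: le_trans (euler_trunc_error a0 us sp) _.
  rewrite [leRHS](eq_bigr (fun P => if a \in P then (N P)^-1 else 0)); last first.
    by move=> P _; rewrite indicE; case: (a \in P); rewrite ?mulr1 ?mulr0.
  rewrite -[leRHS]big_mkcond -[leRHS]big_filter -[leLHS]big_filter.
  rewrite (perm_big [seq P <- t | a \in P]) ?lexx //.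
  apply: uniq_perm; rewrite ?filter_uniq ?fset_uniq // => P.
  rewrite !mem_filter !in_fset_set //; last exact: fP.
  apply/idP/idP.
    move=> /andP[-> ]; rewrite inE => -[Pp Pa]; apply/andP; split; rewrite inE //.
    by exists a.
  move=> /andP[+ /andP[-> ]]; rewrite !inE => Pa [b _ [Pp _]].
  by split.
rewrite fsbig_finite; last exact: finite_disc.
rewrite exchange_big /=.
apply: (@le_trans _ _ (\sum_(P <- t) disc_const L * x ^+ 2 * (N P) ^- 2)); last first.
  rewrite -mulr_sumr; apply: ler_wpM2l; last exact: tl.
  by rewrite mulr_ge0 ?sqr_ge0 ?disc_const_ge0.
rewrite big_seq [leRHS]big_seq; apply: ler_sum => P /tt[Pp _].
rewrite -mulr_sumr -fsbig_finite; last exact: finite_disc.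
have /andP[n0 _] := prime_invN Pp.
apply: le_trans (ler_wpM2l n0 (prime_multiples_count Pp x0)) _.
by rewrite -[(N P) ^- 2]exprVn mulrCA expr2 !mulrA.
Qed.

(** Writes [1 / n ^ 2] as a sum over the levels [j >= n], which turns the sum
    below into an average of the counts of points of norm at most [j]. *)
Lemma inv_sqr_telescope (n T : nat) : (0 < n <= T.+1)%N ->
  n%:R ^- 2 = T.+1%:R ^- 2 + \sum_(0 <= j < T)
    (n <= j.+1)%:R * (j.+1%:R ^- 2 - j.+2%:R ^- 2) :> R.
Proof.
elim: T => [|T IH] /andP[n0 nT].
  by rewrite big_geq // addr0; have -> : n = 1%N by lia.
rewrite big_nat_recr //=; have [nT'|nT'] := leqP n T.+1.
  rewrite mul1r IH ?n0 //; ring.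
rewrite mul0r addr0 big1_seq ?addr0; first by have -> : n = T.+2 by lia.
move=> j; rewrite mem_index_iota => /andP[_ /andP[_ jT]].
by rewrite (_ : (n <= j.+1)%N = false) ?mul0r //; lia.
Qed.

Lemma sum_inv_nrm_sqr (S : set A) : finite_set S -> (forall a, S a -> a != 0) ->
  \sum_(a \in S) ((nrm L a)%:R ^- 2 : R) <= 3 * disc_const L.
Proof.
move=> fS S0; set C := disc_const L.
have C0 : 0 <= C := disc_const_ge0 L.
have [T HT] : exists T, forall a, S a -> (nrm L a <= T.+1)%N.
  exists (\max_(a <- fset_set S) nrm L a) => a Sa; apply: leqW.
  by apply: leq_bigmax_seq => //; rewrite in_fset_set // inE.
have cnt (j : nat) : \sum_(a \in S) ((nrm L a <= j)%N%:R : R) <= C * j%:R.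
  apply: le_trans (_ : \sum_(a \in punctured_disc (Num.sqrt j%:R)) (1 : R) <= _).
    have -> : \sum_(a \in S) ((nrm L a <= j)%N%:R : R) =
        \sum_(a \in S) (\1_[set a | (nrm L a <= j)%N] a : R).
      apply: eq_fsbigr => a _; rewrite indicE; congr (_%:R); apply: congr1.
      by apply/idP/idP; rewrite inE.
    rewrite sum_indic //; apply: ler_fsum_sub => // [|a [Sa /= na]].
      exact: finite_disc.
    by split; [exact: S0|rewrite sqr_sqrtr // ler_nat].
  by apply: le_trans (disc_count L (sqrtr_ge0 _)) _; rewrite sqr_sqrtr.
have -> : \sum_(a \in S) ((nrm L a)%:R ^- 2 : R) =
  \sum_(a \in S) (T.+1%:R ^- 2 + \sum_(0 <= j < T)
    (nrm L a <= j.+1)%:R * (j.+1%:R ^- 2 - j.+2%:R ^- 2) : R).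
  apply: eq_fsbigr => a; rewrite inE => Sa; apply: inv_sqr_telescope.
  by rewrite nrm_gt0 ?S0 // HT.
rewrite fsumD // fsbig_finite // [X in _ + X]fsbig_finite // exchange_big /=.
have w0 (j : nat) : 0 <= j.+1%:R ^- 2 - j.+2%:R ^- 2 :> R.
  by rewrite subr_ge0 lef_pV2 ?posrE ?exprn_gt0 // ler_pXn2r ?nnegrE // ler_nat.
have b1 : \sum_(i <- fset_set S) (T.+1%:R ^- 2 : R) <= C.
  have -> : \sum_(i <- fset_set S) (T.+1%:R ^- 2 : R) =
     T.+1%:R ^- 2 * \sum_(a \in S) ((nrm L a <= T.+1)%N%:R : R).
    rewrite fsbig_finite // mulr_sumr big_seq [RHS]big_seq; apply: eq_bigr => a.
    by rewrite in_fset_set // inE => /HT ->; rewrite mulr1.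
  apply: le_trans (ler_wpM2l _ (cnt _)) _; first by rewrite invr_ge0 sqr_ge0.
  rewrite mulrCA ler_piMr // expr2 invfM -mulrA mulVf ?pnatr_eq0 // mulr1.
  by rewrite invf_le1 ?ltr0n // ler1n.
have b2 : \sum_(0 <= j < T) \sum_(i <- fset_set S)
     (nrm L i <= j.+1)%:R * (j.+1%:R ^- 2 - j.+2%:R ^- 2) <= 2 * C :> R.
  apply: (@le_trans _ _ (\sum_(0 <= j < T) 2 * C * (j.+1%:R^-1 - j.+2%:R^-1))).
    apply: ler_sum => j _; rewrite -mulr_suml -fsbig_finite //.
    apply: le_trans (ler_wpM2r (w0 j) (cnt j.+1)) _.
    rewrite -[j.+2%:R]natr1.
    have j0 : 0 < j.+1%:R :> R by rewrite ltr0n.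
    move: j.+1%:R j0 => y j0.
    rewrite (_ : C * y * (y ^- 2 - (y + 1) ^- 2) =
      C * ((y^-1 - (y + 1)^-1) * (2 - (y + 1)^-1))); last first.
      by field; rewrite !gt_eqF //; lra.
    rewrite -[leRHS]mulrA [leRHS]mulrCA ler_wpM2l // mulrC ler_wpM2r //.
      by rewrite subr_ge0 lef_pV2 ?posrE; lra.
    by rewrite gerBl invr_ge0; lra.
  rewrite -mulr_sumr; apply: ler_piMr; first by rewrite mulr_ge0.
  rewrite (eq_bigr (fun j => - j.+2%:R^-1 - - j.+1%:R^-1)); last first.
    by move=> j _; rewrite opprK addrC.
  rewrite telescope_sumr // invr1 opprK gerDr oppr_le0 invr_ge0 //.
by apply: le_trans (lerD b1 b2) _; lra.
Qed.

Lemma sum_inv_prime_norm t : uniq t ->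
  (forall P, P \in t -> nz_prime_ideals P) ->
  \sum_(P <- t) (N P) ^- 2 <= 3 * disc_const L.
Proof.
move=> ut tp; pose gen P := xget 0 [set c : A | c != 0 /\ P = pideal c].
have genP P : P \in t -> gen P != 0 /\ P = pideal (gen P).
  move=> /tp /(prime_norm L A_principal)[c [c0 Pc _ _]].
  have : [set c : A | c != 0 /\ P = pideal c] (gen P) by apply: (@xgetPex _ 0); exists c.
  by [].
have gen_inj : {in t &, injective gen}.
  by move=> P Q Pt Qt e; rewrite (genP _ Pt).2 (genP _ Qt).2 e.
have umap : uniq (map gen t) by rewrite map_inj_in_uniq.
have := @sum_inv_nrm_sqr [set` map gen t]; rewrite -fsbig_seq // big_map.
rewrite big_seq [X in X <= _](eq_bigr (fun P => (N P) ^- 2)) -?big_seq.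
  apply; first exact: finite_seq.
  by move=> _ /= /mapP[P /genP[P0 _] ->].
by move=> P /genP[g0 Pg]; rewrite /N {2}Pg (idealN_pideal L g0).
Qed.

(** The finite sums are bounded; a family coming within [dl] of their supremum
    leaves less than [dl] to the other primes. *)
Lemma tail_le_ex dl : 0 < dl -> exists s,
  [/\ uniq s, forall P, P \in s -> nz_prime_ideals P & tail_le s dl].
Proof.
move=> dl0.
pose X := [set \sum_(P <- s) (N P) ^- 2 | s in [set s : seq (set A) |
   uniq s /\ forall P, P \in s -> nz_prime_ideals P]].
have X0 : X !=set0 by exists 0, [::] => //=; rewrite big_nil.
have Xb : has_ubound X.
  by exists (3 * disc_const L) => _ [s [us sp] <-]; exact: sum_inv_prime_norm.
have [_ [s [us sp] <-] h] := sup_adherent dl0 (conj X0 Xb).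
exists s; split=> // t ut tp.
have : X (\sum_(P <- s ++ t) (N P) ^- 2).
  exists (s ++ t) => //; split.
    rewrite cat_uniq us ut andbT; apply/hasPn => P /tp[]//.
  by move=> P; rewrite mem_cat => /orP[/sp|/tp[]].
move=> /(ub_le_sup Xb); rewrite big_cat /=; lra.
Qed.

End Tails.

(** * Infinite products *)

Section InfiniteProducts.
Variables (R : realType) (I : choiceType).
Implicit Types (P : set I) (w : I -> R) (J s t : {fset I}).
Local Open Scope fset_scope.

Lemma prod_fset_split P (F : I -> R) s J : s `<=` J ->
  \prod_(i <- J | i \in P) F i =
  (\prod_(i <- s | i \in P) F i) * \prod_(i <- J `\` s | i \in P) F i.
Proof.
move=> sJ; rewrite -big_cat; apply: perm_big; apply: uniq_perm.
- exact: fset_uniq.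
- rewrite cat_uniq !fset_uniq andbT /=; apply/hasPn => i.
  by rewrite in_fsetD => /andP[].
move=> i; rewrite mem_cat in_fsetD; case: (boolP (i \in s)) => //= /(fsubsetP sJ) ->.
by [].
Qed.

Lemma totallyP (Q : {fset I} -> Prop) s : (forall J, s `<=` J -> Q J) ->
  \forall J \near totally, Q J.
Proof. by move=> H; exists s. Qed.

Lemma near_totally (Q : {fset I} -> Prop) : (\forall J \near totally, Q J) ->
  exists s, forall J, s `<=` J -> Q J.
Proof. by move=> [s _ H]; exists s => J sJ; exact: H. Qed.

(** With factors in [[1/2, 1]] the partial products decrease, hence converge to
    their infimum. Beyond a family whose tail of [w] is at most 1/2 they lose at
    most half of their value, so the limit is positive. *)
Lemma unordered_prod_cvg P w : (forall i, P i -> 0 <= w i <= 1 / 2) ->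
  (forall dl, 0 < dl -> exists s, forall t, (forall i, i \in t -> i \notin s) ->
     \sum_(i <- t | i \in P) w i <= dl) ->
  exists2 l : R, 0 < l &
    (fun J => \prod_(i <- J | i \in P) (1 - w i)) @ totally --> l.
Proof.
move=> w01 tl; pose f J := \prod_(i <- J | i \in P) (1 - w i).
have w01' i : i \in P -> 0 <= w i <= 1 / 2 by rewrite inE => /w01.
have f0 J : 0 < f J.
  by apply: prodr_gt0 => i /w01' /andP[]; lra.
have f1 J : f J <= 1 /\ 1 - \sum_(i <- J | i \in P) w i <= f J.
  have H i : i \in [seq i <- J | i \in P] -> 0 <= w i <= 1.
    by rewrite mem_filter => /andP[/w01' /andP[h1 h2] _]; apply/andP; split; lra.
  have [/andP[_ h1] h2] := prod_one_minus H.
  by move: h1 h2; rewrite !big_filter; split.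
have fle s J : s `<=` J -> f J <= f s.
  move=> sJ; rewrite /f (prod_fset_split P _ sJ) ler_piMr //; first exact/ltW/f0.
  by have [] := f1 (J `\` s).
pose X := [set f J | J in [set: {fset I}]].
have X0 : X !=set0 by exists (f fset0), fset0.
have Xlb : has_lbound X by exists 0 => _ [J _ <-]; exact/ltW/f0.
have [s hs] := tl (1 / 2) ltac:(lra).
have low J : f s / 2 <= f J.
  apply: le_trans (fle J (J `|` s) (fsubsetUl _ _)).
  rewrite /f (prod_fset_split P _ (fsubsetUr J s)) ler_wpM2l //; first exact/ltW/f0.
  have [_] := f1 ((J `|` s) `\` s); rewrite -/(f _).
  suff : \sum_(i <- (J `|` s) `\` s | i \in P) w i <= 1 / 2 by lra.
  by apply: hs => i; rewrite in_fsetD => /andP[].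
exists (inf X).
  apply: (@lt_le_trans _ _ (f s / 2)); first by rewrite divr_gt0.
  by apply: lb_le_inf => // _ [J _ <-].
apply/cvgrPdist_le => eps e0.
have [_ [J0 _ <-] hJ0] := inf_adherent e0 (conj X0 Xlb).
apply: (totallyP (s := J0)) => J JJ0.
have := ge_inf Xlb (imageT f J); have := fle _ _ JJ0.
by rewrite ler_norml -/(f J) => h1 h2; apply/andP; split; lra.
Qed.

End InfiniteProducts.

(** * From counts to weighted sums *)

Section Abel.
Variables (R : realType) (A : comNzRingType) (L : quad_order R A).
Implicit Types (a b : R) (p : A) (G : A -> R) (x c : R).

Lemma cone_inter_nrm a b x (n : nat) : 0 <= x -> n%:R <= x ^+ 2 ->
  cone L a b x `&` [set p | (nrm L p <= n)%N] = cone L a b (Num.sqrt n%:R).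
Proof.
move=> x0 nx; apply/seteqP; split=> p.
  move=> [[t [rho [tab /andP[r0 rx] e1 e2]]] /= pn]; exists t, rho; split=> //.
  rewrite r0 /= -(ler_pXn2r (ltn0Sn 1)) ?nnegrE ?sqrtr_ge0 ?(ltW r0) //.
  rewrite sqr_sqrtr //; apply: le_trans (_ : (nrm L p)%:R <= _); last by rewrite ler_nat.
  by rewrite nrm_re_im e1 e2 !exprMn -mulrDr cos2Dsin2 mulr1.
move=> cp; have [_] := cone_disc cp; rewrite sqr_sqrtr // ler_nat => pn.
split=> //; move: cp => [t [rho [tab /andP[r0 rx] e1 e2]]]; exists t, rho; split=> //.
rewrite r0 /=; apply: le_trans rx _.
by rewrite -(ler_pXn2r (ltn0Sn 1)) ?nnegrE ?sqrtr_ge0 // sqr_sqrtr.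
Qed.

Lemma sqr_telescope (m X : nat) : (m <= X)%N ->
  m%:R ^+ 2 = X%:R ^+ 2 - \sum_(0 <= n < X) (m <= n)%:R * (2 * n%:R + 1) :> R.
Proof.
elim: X => [|X IH] mX; first by rewrite big_geq // subr0; have -> : m = 0%N by lia.
rewrite big_nat_recr //=; have [mX'|mX'] := leqP m X.
  by rewrite mul1r IH // -[X.+1%:R]natr1; ring.
rewrite big1_seq ?add0r ?mul0r ?subr0; first by have -> : m = X.+1 by lia.
move=> j; rewrite mem_index_iota => /andP[_ /andP[_ jX]].
by rewrite (_ : (m <= j)%N = false) ?mul0r //; lia.
Qed.

Lemma sum_odd (X : nat) : \sum_(0 <= n < X) (2 * n%:R + 1) = X%:R ^+ 2 :> R.
Proof.
elim: X => [|X IH]; first by rewrite big_geq // expr0n.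
by rewrite big_nat_recr //= IH -[X.+1%:R]natr1; ring.
Qed.

Lemma sum_odd_weighted (X : nat) : \sum_(0 <= n < X) (2 * n%:R + 1) * n%:R =
  2 * X%:R ^+ 3 / 3 - X%:R ^+ 2 / 2 - X%:R / 6 :> R.
Proof.
elim: X => [|X IH]; first by rewrite big_geq //; field.
by rewrite big_nat_recr //= IH -[X.+1%:R]natr1; field.
Qed.

(** Summation by parts over the values of the norm: with [y = x ^ 2], the count
    [c n] of points of norm at most [n] gives [c y ^ 3 / 3], the integral of
    [c n ^ 2]. *)
Lemma abel_nrm_sqr G a b c :
  o_sq (fun x => \sum_(p \in cone L a b x) G p - c * x ^+ 2) ->
  forall eps, 0 < eps -> exists D, 0 <= D /\ forall x, 1 <= x ->
   `|\sum_(p \in cone L a b x) (G p * (nrm L p)%:R ^+ 2) - c / 3 * x ^+ 6|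
     <= eps * x ^+ 6 + D * x ^+ 5.
Proof.
move=> HG eps e0; have [D HD] := HG _ (divr_gt0 e0 (ltr0n R 2)).
have D0 : 0 <= D.
  have := le_trans (normr_ge0 _) (HD 0 (lexx _)).
  by rewrite expr0n /= mulr0 add0r.
exists (2 * D + 3 * `|c|); split; first by rewrite addr_ge0 // mulr_ge0.
move=> x x1; have x0 : 0 <= x by lra.
set y := x ^+ 2; have y1 : 1 <= y by rewrite /y; nra.
have y0 : 0 <= y by lra.
pose X := Num.truncn y; have /andP[Xy yX] := truncn_itv y0; rewrite -/X in Xy yX.
rewrite -natr1 in yX; have X0 : 0 <= X%:R :> R by [].
set F := fun x => \sum_(p \in cone L a b x) G p in HD.
have fc := cone_finite L a b x.
have -> : \sum_(p \in cone L a b x) (G p * (nrm L p)%:R ^+ 2) =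
    X%:R ^+ 2 * F x - \sum_(0 <= n < X) (2 * n%:R + 1) * F (Num.sqrt n%:R).
  transitivity (\sum_(p \in cone L a b x) (X%:R ^+ 2 * G p -
     \sum_(0 <= n < X) (2 * n%:R + 1) * ((nrm L p <= n)%N%:R * G p))).
    apply: eq_fsbigr => p; rewrite inE => /cone_disc[_ px].
    have pX : (nrm L p <= X)%N.
      by rewrite -ltnS -(ltr_nat R); apply: le_lt_trans px _; rewrite -natr1.
    rewrite (sqr_telescope pX) mulrBr [X in X - _]mulrC; congr (_ - _).
    by rewrite mulr_sumr; apply: eq_bigr => n _; ring.
  rewrite fsumB //; congr (_ - _); first by rewrite -mulr_fsumr.
  rewrite fsbig_finite // exchange_big /= !big_nat; apply: eq_bigr => n /= nX.
  rewrite -mulr_sumr -fsbig_finite //; congr (_ * _).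
  rewrite /F -(@cone_inter_nrm _ _ x) //; last first.
    by rewrite -/y; apply: le_trans Xy; rewrite ler_nat ltnW.
  rewrite fsbig_mkcondr; apply: eq_fsbigr => p _.
  rewrite (_ : (p \in _) = (nrm L p <= n)%N); last by apply/idP/idP; rewrite inE.
  by case: (_ <= _)%N; rewrite ?mul1r ?mul0r.
pose e n := F (Num.sqrt n%:R) - c * n%:R.
have eb n : `|e n| <= eps / 2 * n%:R + D.
  by have := HD _ (sqrtr_ge0 n%:R); rewrite sqr_sqrtr.
have sE : \sum_(0 <= n < X) (2 * n%:R + 1) * F (Num.sqrt n%:R) =
   c * (2 * X%:R ^+ 3 / 3 - X%:R ^+ 2 / 2 - X%:R / 6)
   + \sum_(0 <= n < X) (2 * n%:R + 1) * e n.
  rewrite -sum_odd_weighted mulr_sumr -big_split /=; apply: eq_bigr => n _.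
  by rewrite /e; ring.
rewrite sE; set E := \sum_(0 <= n < X) (2 * n%:R + 1) * e n.
have Eb : `|E| <= y ^+ 2 * (eps / 2 * y + D).
  apply: le_trans (ler_norm_sum _ _ _) _.
  apply: (@le_trans _ _ (X%:R ^+ 2 * (eps / 2 * y + D))); last first.
    rewrite ler_wpM2r //; last by rewrite ler_pXn2r ?nnegrE.
    by rewrite addr_ge0 // mulr_ge0 //; lra.
  rewrite -sum_odd mulr_suml !big_nat; apply: ler_sum => n /= nX.
  have n0 : 0 <= 2 * n%:R + 1 :> R by rewrite addr_ge0 // mulr_ge0.
  rewrite normrM (ger0_norm n0) ler_wpM2l //; apply: le_trans (eb n) _.
  rewrite lerD2r ler_wpM2l; [by []|lra|].
  by apply: le_trans Xy; rewrite ler_nat ltnW.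
have Fb := HD x x0; rewrite -/y in Fb.
have X2 : X%:R ^+ 2 <= y ^+ 2 by rewrite ler_pXn2r ?nnegrE.
have Fb2 : `|X%:R ^+ 2 * (F x - c * y)| <= y ^+ 2 * (eps / 2 * y + D).
  by rewrite normrM (ger0_norm (sqr_ge0 _)); apply: ler_pM.
have -> : X%:R ^+ 2 * F x - (c * (2 * X%:R ^+ 3 / 3 - X%:R ^+ 2 / 2 - X%:R / 6) + E)
   - c / 3 * x ^+ 6 =
   X%:R ^+ 2 * (F x - c * y) - E +
   c * (X%:R ^+ 2 * y - 2 * X%:R ^+ 3 / 3 - y ^+ 3 / 3 + X%:R ^+ 2 / 2 + X%:R / 6).
  by rewrite /y; field.
have cb : `|c * (X%:R ^+ 2 * y - 2 * X%:R ^+ 3 / 3 - y ^+ 3 / 3 + X%:R ^+ 2 / 2 + X%:R / 6)|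
    <= `|c| * (3 * y ^+ 2).
  rewrite normrM ler_wpM2l //.
  pose f := y - X%:R; have f0 : 0 <= f by rewrite /f; lra.
  have f1 : f <= 1 by rewrite /f; lra.
  rewrite (_ : _ - y ^+ 3 / 3 + _ + _ = X%:R ^+ 2 / 2 + X%:R / 6 - X%:R * f ^+ 2 - f ^+ 3 / 3); last first.
    by rewrite /f; field.
  have ff : 0 <= f ^+ 2 <= 1 by rewrite sqr_ge0 expr_le1.
  have fff : 0 <= f ^+ 3 <= 1 by rewrite exprn_ge0 // expr_le1.
  have Xf : 0 <= X%:R * f ^+ 2 <= X%:R.
    by case/andP: ff => ? ?; rewrite mulr_ge0 //= ler_piMr.
  have yy : y <= y ^+ 2 by rewrite expr2 ler_peMl.
  move: ff fff Xf => /andP[? ?] /andP[? ?] /andP[? ?].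
  have XX := sqr_ge0 (X%:R : R).
  by rewrite ler_norml; apply/andP; split; lra.
have y2 : y ^+ 2 = x ^+ 4 by rewrite /y; ring.
have y3 : y ^+ 2 * (eps / 2 * y + D) = eps / 2 * x ^+ 6 + D * x ^+ 4.
  by rewrite /y; ring.
rewrite y3 in Fb2 Eb; rewrite y2 in cb.
have x45 : x ^+ 4 <= x ^+ 5 by rewrite [leRHS]exprS ler_peMl // exprn_ge0.
apply: le_trans (ler_normD _ _) _; apply: le_trans (lerD (ler_normB _ _) cb) _.
apply: le_trans (lerD (lerD Fb2 Eb) (lexx _)) _.
have := ler_wpM2l D0 x45; have := ler_wpM2l (normr_ge0 c) x45; lra.
Qed.

Definition radius p : R := Num.sqrt (nrm L p)%:R.

Lemma radius_ge0 p : 0 <= radius p. Proof. exact: sqrtr_ge0. Qed.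

Lemma radius_sqr p : radius p ^+ 2 = (nrm L p)%:R.
Proof. by rewrite sqr_sqrtr. Qed.

Lemma nrmD_diff p q x : 0 <= x -> (nrm L p)%:R <= x ^+ 2 ->
  `|(nrm L (p + q))%:R - (nrm L p)%:R : R| <= 2 * x * radius q + radius q ^+ 2.
Proof.
move=> x0 px.
have -> : (nrm L (p + q))%:R - (nrm L p)%:R =
    (nrm L q)%:R + 2 * (re L p * re L q + im L p * im L q) :> R.
  by rewrite !nrm_re_im reD imD; ring.
have cs : `|re L p * re L q + im L p * im L q| <= x * radius q.
  rewrite -(ler_pXn2r (ltn0Sn 1)) ?nnegrE ?mulr_ge0 ?radius_ge0 //.
  rewrite real_normK ?num_real // exprMn radius_sqr.
  apply: le_trans (ler_wpM2r _ px) => //; rewrite !nrm_re_im -subr_ge0.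
  rewrite (_ : _ - _ = (re L p * im L q - im L p * re L q) ^+ 2); last by ring.
  exact: sqr_ge0.
rewrite -radius_sqr; apply: le_trans (ler_normD _ _) _.
rewrite (ger0_norm (sqr_ge0 _)) addrC lerD2r normrM ger0_norm // -mulrA.
by rewrite ler_wpM2l.
Qed.

Lemma disc_translate p q x : 0 <= x -> (nrm L p)%:R <= x ^+ 2 ->
  (nrm L (p + q))%:R <= (x + radius q) ^+ 2 :> R.
Proof.
move=> x0 px; have := nrmD_diff q x0 px; rewrite ler_norml => /andP[_ h].
by rewrite sqrrD; lra.
Qed.

(** The norms of [p] and [p + k] differ by [O(x)], which is negligible against
    [x ^ 2]. *)
Lemma abel_nrm_shift G a b c k : (forall p, p != 0 -> `|G p| <= 1) ->
  o_sq (fun x => \sum_(p \in cone L a b x) G p - c * x ^+ 2) ->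
  forall eps, 0 < eps -> exists D, forall x, 1 <= x ->
   `|\sum_(p \in cone L a b x) (G p * ((nrm L p)%:R * (nrm L (p + k))%:R))
      - c / 3 * x ^+ 6| <= eps * x ^+ 6 + D * x ^+ 5.
Proof.
move=> G1 HG eps e0; have [D [D0 HD]] := abel_nrm_sqr HG e0.
set q := radius k; have q0 : 0 <= q := radius_ge0 k.
pose C := disc_const L; have C0 : 0 <= C := disc_const_ge0 L.
exists (D + C * (2 * q + q ^+ 2)) => x x1; have x0 : 0 <= x by lra.
have fc := cone_finite L a b x.
pose S := \sum_(p \in cone L a b x)
  (G p * ((nrm L p)%:R * ((nrm L (p + k))%:R - (nrm L p)%:R))).
have -> : \sum_(p \in cone L a b x) (G p * ((nrm L p)%:R * (nrm L (p + k))%:R)) =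
   \sum_(p \in cone L a b x) (G p * (nrm L p)%:R ^+ 2) + S.
  by rewrite -fsumD //; apply: eq_fsbigr => p _; ring.
have Sb : `|S| <= C * (2 * q + q ^+ 2) * x ^+ 5.
  apply: le_trans (ler_norm_fsum _ fc) _.
  apply: (@le_trans _ _ (\sum_(p \in cone L a b x) ((2 * q + q ^+ 2) * x ^+ 3 * 1))).
    apply: ler_fsum => // p /cone_disc[p0 px]; rewrite mulr1.
    have n0 : 0 <= (nrm L p)%:R :> R by [].
    rewrite normrM; apply: (@le_trans _ _ (1 * `|(nrm L p)%:R * ((nrm L (p + k))%:R - (nrm L p)%:R)|)).
      by rewrite ler_wpM2r // G1.
    rewrite mul1r normrM ger0_norm //.
    apply: (@le_trans _ _ (x ^+ 2 * (2 * x * q + q ^+ 2))).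
      by apply: ler_pM => //; exact: nrmD_diff.
    rewrite (_ : _ * x ^+ 3 = x ^+ 2 * ((2 * q + q ^+ 2) * x)); last by ring.
    apply: ler_wpM2l; first exact: sqr_ge0.
    rewrite [leRHS]mulrDl; apply: lerD; first by rewrite mulrAC.
    by rewrite ler_peMr // sqr_ge0.
  rewrite -mulr_fsumr.
  have w0 : 0 <= (2 * q + q ^+ 2) * x ^+ 3.
    by rewrite mulr_ge0 ?exprn_ge0 // addr_ge0 ?sqr_ge0 // mulr_ge0.
  apply: le_trans (ler_wpM2l w0 (_ : _ <= C * x ^+ 2)) _; last first.
    by rewrite le_eqVlt; apply/orP; left; apply/eqP; ring.
  apply: le_trans (disc_count L x0); apply: ler_fsum_sub => //.
    exact: finite_disc.
  by move=> p; exact: cone_disc.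
rewrite addrAC; apply: le_trans (ler_normD _ _) _.
apply: le_trans (lerD (HD x x1) Sb) _; lra.
Qed.

End Abel.

(** * The correlation of the totient with its translate *)

Section Correlation.
Variables (R : realType) (A : comNzRingType) (L : quad_order R A).
Implicit Types (P Q : set A) (a b x : R) (p : A) (s t : seq (set A)).
Hypothesis A_principal : is_principal_ring A.
Variable k : A.
Let N P : R := (idealN P)%:R.

Definition primes_dvd : set (set A) :=
  [set P | @nz_prime_ideals A P /\ ideal_dvd P (pideal k)].

Lemma primes_dvdE P : (P \in primes_dvd) = (P \in @nz_prime_ideals A) && (k \in P).
Proof.
apply/idP/andP; rewrite !inE; first by move=> [Pp h]; split=> //; apply: h; exact: pideal_id.
move=> [Pp Pk]; split=> // x /pidealP[y ->].
by case: Pp => [[[_ _ PM] _ _] _]; exact: PM.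
Qed.

Lemma common_period s : (forall P, P \in s -> nz_prime_ideals P) ->
  exists2 M, (0 < M)%N & forall P, P \in s -> P M%:R.
Proof.
elim: s => [|P s IH] sp; first by exists 1%N.
have [|M M0 HM] := IH; first by move=> Q Qs; apply: sp; rewrite inE Qs orbT.
have Pp := sp P (mem_head _ _); have [c c0 Pc] := nz_prime_ideal_gen A_principal Pp.
exists (nrm L c * M)%N; first by rewrite muln_gt0 M0 nrm_gt0.
move=> Q; rewrite inE natrM => /predU1P[->|Qs].
  rewrite Pc; apply: ideal_mulr (pideal_ideal c) _.
  exact: nrm_in_ideal (pideal_ideal c) (pideal_id c).
have [[[_ _ QM] _ _] _] := sp Q (mem_behead (s := P :: s) Qs).
by apply: QM; exact: HM.
Qed.

(** At each prime [P] there is one condition on [p] and one on [p + k]. They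
    coincide when [P] contains [k] and exclude each other otherwise. *)
Lemma euler_trunc_mean s M : (0 < M)%N -> uniq s ->
  (forall P, P \in s -> nz_prime_ideals P /\ P M%:R) ->
  qmean L M (fun p => euler_trunc R s p * euler_trunc R s (p + k)) =
  (\prod_(P <- s) (1 - 2 / N P ^+ 2)) *
  \prod_(P <- s | k \in P) (1 + (N P * (N P ^+ 2 - 2))^-1).
Proof.
move=> M0 us sp.
pose c P := if k \in P then 2 / N P - (N P) ^- 2 else (N P)^-1.
pose c' P := if k \in P then 0 else (N P)^-1.
transitivity (qmean L M (fun p => \prod_(P <- s)
   (1 - c P * \1_P p - c' P * \1_P (p + k)))).
  congr qmean; apply/funext => p; rewrite /euler_trunc -big_split /=.
  rewrite big_seq [RHS]big_seq; apply: eq_bigr => P /sp[[[Pi _ _] _] _].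
  rewrite /c /c' !indicE -/(N P); have [kP|kP] := boolP (k \in P).
    rewrite (_ : (p + k \in P) = (p \in P)); last first.
      move: kP; rewrite inE => Pk; apply/idP/idP; rewrite !inE => h.
        by rewrite -(addrK k p); exact: ideal_sub.
      by case: Pi => _ PD _; exact: PD.
    by case: (p \in P) => /=; rewrite ?mulr1 ?mulr0 ?mul0r -?exprVn; ring.
  have [pP|pP] := boolP (p \in P); have [pkP|pkP] := boolP (p + k \in P);
    rewrite /= ?mulr1 ?mulr0; try ring.
  move: pP pkP kP; rewrite !inE notin_setE => Pp Ppk; case.
  by rewrite -(addKr p k) addrC; exact: ideal_sub.
rewrite (qmean_prime_product L A_principal) // big_mkcond /= [X in _ = _ * X]big_mkcond.
rewrite -big_split /= big_seq [RHS]big_seq; apply: eq_bigr => P /sp[Pp _].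
have N2 := prime_N_ge2 L A_principal Pp; rewrite -/(N P) in N2 *.
have N22 : N P ^+ 2 - 2 != 0 by rewrite gt_eqF //; nra.
have N0 : N P != 0 by rewrite gt_eqF //; lra.
rewrite /c /c'; case: (k \in P); field; rewrite ?N0 ?N22 //.
Qed.

(** Set to 0 at the point [- k], where [phi (p + k)] is 0 by convention and
    [euler_factor (p + k)] has no meaning. *)
Definition correlation p : R :=
  if p + k == 0 then 0 else euler_factor R p * euler_factor R (p + k).

Lemma correlation_le1 p : p != 0 -> `|correlation p| <= 1.
Proof.
rewrite /correlation => p0; case: eqP => [_|/eqP pk0]; first by rewrite normr0.
have /andP[h1 h2] := euler_factor_bounds L A_principal p0.
have /andP[h3 h4] := euler_factor_bounds L A_principal pk0.
by rewrite ger0_norm ?mulr_ge0 // mulr_ile1.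
Qed.

Lemma phi_mul p : p != 0 -> (phi p * phi (p + k)%R)%N%:R =
  correlation p * ((nrm L p)%:R * (nrm L (p + k))%:R).
Proof.
move=> p0; rewrite /correlation natrM; case: eqP => [e|/eqP pk0].
  by rewrite {2}/phi e eqxx mulr0 mul0r.
by rewrite !(phiE L A_principal) // /euler_factor; ring.
Qed.

(** The error of a product of two factors in [[0, 1]] is at most the sum of their
    errors; the one at [p + k] is averaged over a translated disc, and the point
    [- k] accounts for the final 1. *)
Lemma correlation_trunc s (dl : R) a b x : 0 <= x -> uniq s ->
  (forall P, P \in s -> nz_prime_ideals P) -> tail_le s dl ->
  `|\sum_(p \in cone L a b x) correlation p -
    \sum_(p \in cone L a b x) euler_trunc R s p * euler_trunc R s (p + k)|
  <= disc_const L * dl * (x ^+ 2 + (x + radius L k) ^+ 2) + 1.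
Proof.
move=> x0 us sp tl; have fc := cone_finite L a b x.
have k0 := radius_ge0 L k.
pose h q : R := if q == 0 then 1 else `|euler_trunc R s q - euler_factor R q|.
have tb p := euler_trunc_bounds L A_principal p sp.
rewrite -fsumB //; apply: le_trans (ler_norm_fsum _ fc) _.
apply: (@le_trans _ _ (\sum_(p \in cone L a b x)
   (`|euler_trunc R s p - euler_factor R p| + h (p + k)))).
  apply: ler_fsum => // p /cone_disc[p0 _].
  have /andP[t0 t1] := tb p; have /andP[u0 u1] := tb (p + k).
  have /andP[f0 f1] := euler_factor_bounds L A_principal p0.
  rewrite /correlation /h; case: eqP => [_|/eqP pk0].
    rewrite sub0r normrN ger0_norm ?mulr_ge0 //.
    by apply: le_trans (mulr_ile1 _ _ _ _) _ => //; rewrite lerDr.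
  have /andP[g0 g1] := euler_factor_bounds L A_principal pk0.
  set T := euler_trunc R s p in t0 t1 *; set U := euler_trunc R s (p + k) in u0 u1 *.
  set F := euler_factor R p in f0 f1 *; set G := euler_factor R (p + k) in g0 g1 *.
  rewrite (_ : F * G - T * U = - ((T - F) * U + F * (U - G))); last by ring.
  rewrite normrN; apply: le_trans (ler_normD _ _) _; rewrite !normrM.
  by apply: lerD; [rewrite ler_piMr // ger0_norm|rewrite ler_piMl // ger0_norm].
rewrite fsumD // mulrDr -addrA; apply: lerD.
  rewrite mulrAC; apply: le_trans (euler_trunc_average L A_principal x0 us sp tl).
  apply: ler_fsum_sub => //; first exact: finite_disc.
  by move=> p /cone_disc.
pose S := [set p + k | p in cone L a b x].
have -> : \sum_(p \in cone L a b x) h (p + k) = \sum_(q \in S) h q.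
  by rewrite fsbig_image // => u v _ _; exact: addIr.
have fd : finite_set (punctured_disc L (x + radius L k)) := finite_disc L _.
have f0 : finite_set [set 0 : A] by exact: finite_set1.
apply: (@le_trans _ _ (\sum_(q \in punctured_disc L (x + radius L k) `|` [set 0]) h q)).
  apply: ler_fsum_sub; [by rewrite finite_setU|..].
  - move=> _ [p /cone_disc[_ px] <-]; have [->|q0] := eqVneq (p + k) 0; first by right.
    by left; split=> //; exact: disc_translate.
  - by move=> q _; rewrite /h; case: ifP.
rewrite fsbigU0 // => [|q [[q0 _] /= e]]; last by rewrite e eqxx in q0.
rewrite fsbig_set1 (_ : h 0 = 1) ?lerD2r; last by rewrite /h eqxx.
rewrite mulrAC; apply: le_trans (euler_trunc_average L A_principal _ us sp tl).
  by apply: ler_fsum => // q [q0 _]; rewrite /h (negbTE q0).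
exact: addr_ge0.
Qed.

Lemma trunc_density s a b : uniq s -> (forall P, P \in s -> nz_prime_ideals P) ->
  a <= b -> b - a <= 2 * pi ->
  cone_density L (fun p => euler_trunc R s p * euler_trunc R s (p + k))
   ((\prod_(P <- s) (1 - 2 / N P ^+ 2)) *
    \prod_(P <- s | k \in P) (1 + (N P * (N P ^+ 2 - 2))^-1)) a b.
Proof.
move=> us sp ab ba; have [M M0 HM] := common_period sp.
rewrite -(euler_trunc_mean M0 us); last by move=> P Ps; split; [exact: sp|exact: HM].
have tper : periodic_mod M (euler_trunc R s).
  move=> p q; rewrite /euler_trunc big_seq [RHS]big_seq; apply: eq_bigr => P Ps.
  have [[Pi _ _] _] := sp P Ps.
  by have := @indic_periodic R _ M P 0 Pi (HM P Ps) p q; rewrite !subr0 => ->.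
apply: cone_density_periodic => // [p q|p].
  by rewrite tper addrAC tper.
have /andP[h1 h2] := euler_trunc_bounds L A_principal p sp.
have /andP[h3 h4] := euler_trunc_bounds L A_principal (p + k) sp.
by rewrite ger0_norm ?mulr_ge0 // mulr_ile1.
Qed.

Section Limits.
Variables l1 l2 : R.
Hypothesis cvg1 : (fun J : {fset set A} =>
  \prod_(P <- J | P \in @nz_prime_ideals A) (1 - 2 / N P ^+ 2)) @ totally --> l1.
Hypothesis cvg2 : (fun J : {fset set A} =>
  \prod_(P <- J | P \in primes_dvd) (1 + (N P * (N P ^+ 2 - 2))^-1)) @ totally --> l2.

Lemma correlation_density a b : a <= b -> b - a <= 2 * pi ->
  cone_density L correlation (l1 * l2) a b.
Proof.
move=> ab ba eps e0.
pose C := disc_const L; have C0 : 0 <= C := disc_const_ge0 L.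
pose B := (b - a) / (2 * covol L).
have B0 : 0 <= B.
  by rewrite divr_ge0 ?subr_ge0 // mulr_ge0 // ltW // covol_gt0.
(* Three errors of [eps / 3]: truncation, density, Euler products. The first
   is at most [C dl (x ^ 2 + (x + q) ^ 2)], whence the factor [3 C]. *)
pose dl := eps / (3 * (3 * C + 1)).
have dl0 : 0 < dl by rewrite divr_gt0 // !mulr_gt0 // ltr_wpDl // mulr_ge0.
have Cdl : 3 * (C * dl) <= eps / 3.
  rewrite /dl (_ : 3 * _ = (3 * C) / (3 * C + 1) * (eps / 3)); last first.
    by field; rewrite gt_eqF // ltr_wpDl // mulr_ge0.
  rewrite ler_piMl ?divr_ge0 ?(ltW e0) // ler_pdivrMr ?mul1r; last first.
    by rewrite ltr_wpDl // mulr_ge0.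
  by rewrite lerDl.
have [s1 [us1 sp1 tl1]] := tail_le_ex L A_principal dl0.
have eB : 0 < eps / (3 * (B + 1)) by rewrite divr_gt0 // mulr_gt0 // ltr_wpDl.
have [J0 HJ0] := near_totally ((@cvgrPdist_le _ _ _ _ _ _ _).1 (cvgM cvg1 cvg2) _ eB).
pose J := (J0 `|` [fset P in s1])%fset.
have /HJ0 /= hJ : (J0 `<=` J)%fset by exact: fsubsetUl.
pose s := [seq P <- J | P \in @nz_prime_ideals A].
have us : uniq s by rewrite filter_uniq // fset_uniq.
have sp P : P \in s -> nz_prime_ideals P by rewrite mem_filter => /andP[/set_mem].
have tl : tail_le s dl.
  move=> t ut tp; apply: tl1 => // P /tp[Pp Ps]; split=> //.
  apply: contra Ps => Ps1; rewrite mem_filter mem_set //= in_fsetU.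
  by apply/orP; right; rewrite inE.
have := trunc_density us sp ab ba.
set E := _ * _ => dens.
have EJ : `|l1 * l2 - E| <= eps / (3 * (B + 1)).
  apply: le_trans hJ; rewrite le_eqVlt; apply/orP; left; apply/eqP.
  congr (`| _ - _ |); rewrite /E !big_filter; congr (_ * _).
  by rewrite big_filter_cond; apply: eq_bigl => P; rewrite primes_dvdE.
have [D HD] := dens _ (divr_gt0 e0 (ltr0n R 3)).
set q := radius L k; have q0 : 0 <= q := radius_ge0 L k.
exists (D + (2 * (C * dl) * q ^+ 2 + 1)) => x x0.
have tr := correlation_trunc a b x0 us sp tl.
have hD := HD x x0; rewrite -/C -/q in tr.
have x2 : 0 <= x ^+ 2 := sqr_ge0 x.
have EB : `|E * (b - a) / (2 * covol L) * x ^+ 2 - l1 * l2 * (b - a) / (2 * covol L) * x ^+ 2|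
    <= eps / 3 * x ^+ 2.
  rewrite -mulrBl normrM (ger0_norm x2) ler_wpM2r //.
  rewrite (_ : _ - _ = (E - l1 * l2) * B); last by rewrite /B; ring.
  rewrite normrM (ger0_norm B0) distrC.
  apply: (@le_trans _ _ (eps / (3 * (B + 1)) * B)); first by rewrite ler_wpM2r.
  rewrite (_ : _ * B = eps / 3 * (B / (B + 1))); last first.
    by field; rewrite gt_eqF // ltr_wpDl.
  by rewrite ler_piMr ?divr_ge0 ?(ltW e0) // ler_pdivrMr ?mul1r ?lerDl // ltr_wpDl.
move: tr hD EB; set S := \sum_(p \in cone L a b x) correlation p.
set T := \sum_(p \in _) _; set u := E * _ / _ * _; set v := _ * _ / _ * _.
move=> tr hD EB; rewrite (_ : S - v = (S - T) + (T - u) + (u - v)); last by ring.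
apply: le_trans (ler_normD _ _) _; apply: le_trans (lerD (ler_normD _ _) (lexx _)) _.
apply: le_trans (lerD (lerD tr hD) EB) _.
have Cd0 : 0 <= C * dl by rewrite mulr_ge0 // ltW.
have sq : (x + q) ^+ 2 <= 2 * x ^+ 2 + 2 * q ^+ 2.
  by rewrite -subr_ge0 (_ : _ - _ = (x - q) ^+ 2); [exact: sqr_ge0|ring].
have := ler_wpM2l Cd0 sq; have := ler_wpM2r x2 Cdl; lra.
Qed.

Theorem phi_correlation_sum a b : a <= b -> b - a <= 2 * pi ->
  forall eps, 0 < eps -> exists D, forall x, 1 <= x ->
  `|\sum_(p \in cone L a b x) ((phi p * phi (p + k)%R)%N%:R : R)
     - (b - a) / (6 * covol L) * l1 * l2 * x ^+ 6| <= eps * x ^+ 6 + D * x ^+ 5.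
Proof.
move=> ab ba eps e0.
have [D HD] := abel_nrm_shift k correlation_le1 (correlation_density ab ba) e0.
exists D => x x1; have := HD x x1.
rewrite (_ : l1 * l2 * (b - a) / (2 * covol L) / 3 = (b - a) / (6 * covol L) * l1 * l2); last first.
  by field; rewrite gt_eqF // covol_gt0.
congr (`| _ - _ | <= _); apply: eq_fsbigr => p; rewrite inE => /cone_disc[p0 _].
by rewrite phi_mul.
Qed.

End Limits.

Lemma tail_fset dl : 0 < dl -> exists s : {fset set A},
  forall t : {fset set A}, (forall P, P \in t -> P \notin s) ->
  \sum_(P <- t | P \in @nz_prime_ideals A) (N P) ^- 2 <= dl.
Proof.
move=> /(tail_le_ex L A_principal)[s [us sp tl]]; exists [fset P in s]%fset => t ts.
rewrite -big_filter; apply: tl; first by rewrite filter_uniq // fset_uniq.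
move=> P; rewrite mem_filter => /andP[/set_mem Pp /ts].
by rewrite inE.
Qed.

Lemma euler_product_primes_cvg : exists2 l : R, 0 < l &
  (fun J : {fset set A} =>
  \prod_(P <- J | P \in @nz_prime_ideals A) (1 - 2 / N P ^+ 2)) @ totally --> l.
Proof.
apply: unordered_prod_cvg => [P /(prime_N_ge2 L A_principal)|dl dl0].
  rewrite -/(N P) => N2; rewrite divr_ge0 ?sqr_ge0 //= ler_pdivrMr ?exprn_gt0; nra.
have [s hs] := tail_fset (divr_gt0 dl0 (ltr0n R 2)); exists s => t ts.
by rewrite -mulr_sumr; have := hs t ts; lra.
Qed.

(** The factors are at least 1; their inverses are of the form [1 - w P] with
    [w P <= 1 / N P ^ 2]. *)
Lemma euler_product_dvd_cvg : exists2 l : R, 0 < l &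
  (fun J : {fset set A} =>
  \prod_(P <- J | P \in primes_dvd) (1 + (N P * (N P ^+ 2 - 2))^-1)) @ totally --> l.
Proof.
pose w P := (N P * (N P ^+ 2 - 2) + 1)^-1.
have Nf P : @nz_prime_ideals A P -> 0 < N P * (N P ^+ 2 - 2) /\
    N P ^+ 2 <= N P * (N P ^+ 2 - 2) + 1.
  by move=> /(prime_N_ge2 L A_principal); rewrite -/(N P) => N2; split; nra.
have [|dl dl0|l l0 cl] := @unordered_prod_cvg R _ primes_dvd w.
- move=> P [Pp _]; have [h1 h2] := Nf P Pp.
  have N2 := prime_N_ge2 L A_principal Pp; rewrite -/(N P) in N2.
  have h3 : 2 <= N P * (N P ^+ 2 - 2) + 1 by nra.
  rewrite /w invr_ge0 div1r lef_pV2 ?posrE ?h3 ?andbT //; lra.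
- have [s hs] := tail_fset dl0; exists s => t ts; apply: le_trans (hs t ts).
  rewrite [leRHS](bigID (fun P => k \in P)) /=.
  rewrite (eq_bigl (fun P => (P \in @nz_prime_ideals A) && (k \in P))); last first.
    by move=> P; rewrite primes_dvdE.
  apply: ler_wpDr; first by apply: sumr_ge0 => P _; rewrite invr_ge0 sqr_ge0.
  apply: ler_sum => P /andP[]; rewrite inE => Pp _; have [h1 h2] := Nf P Pp.
  have N2 := prime_N_ge2 L A_principal Pp; rewrite -/(N P) in N2.
  by rewrite /w lef_pV2 // posrE ?exprn_gt0 //; lra.
exists l^-1; first by rewrite invr_gt0.
suff -> : (fun J : {fset set A} =>
    \prod_(P <- J | P \in primes_dvd) (1 + (N P * (N P ^+ 2 - 2))^-1)) =
  (fun J : {fset set A} => (\prod_(P <- J | P \in primes_dvd) (1 - w P))^-1).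
  by apply: cvgV => //; rewrite gt_eqF.
apply/funext => J; rewrite -prodfV; apply: eq_bigr => P; rewrite inE => -[Pp _].
have [h1 _] := Nf P Pp; rewrite /w; move: (N P * _) h1 => y y0.
have y1 : y + 1 != 0 by rewrite gt_eqF //; lra.
have -> : 1 - (y + 1)^-1 = y / (y + 1) by field.
by rewrite invf_div; field; rewrite gt_eqF.
Qed.

End Correlation.

(** * Imaginary quadratic fields *)

Section ImaginaryQuadratic.
Variables (R : realType) (K : fieldExtType rat) (iota : {rmorphism K -> R[i]}).
Hypothesis K_quadratic : \dim {:K} = 2%N.
Hypothesis K_imaginary : exists u : K, complex.Im (iota u) != 0.
Implicit Types (x y u : K) (p q : rat) (a : OK K).

Let kre x : R := complex.Re (iota x).
Let kim x : R := complex.Im (iota x).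

Lemma ratr_complex p : ratr p = (ratr p : R)%:C.
Proof.
by rewrite -(fmorph_eq_rat (real_complex R \o (@ratr R) : {rmorphism rat -> R[i]})).
Qed.

Let kreZ p x : kre (p *: x) = ratr p * kre x.
Proof.
by rewrite /kre rmorphZ_num ratr_complex; case: (iota x) => ? ? /=; rewrite mul0r subr0.
Qed.

Let kimZ p x : kim (p *: x) = ratr p * kim x.
Proof.
by rewrite /kim rmorphZ_num ratr_complex; case: (iota x) => ? ? /=; rewrite mul0r addr0.
Qed.

Let kreD x y : kre (x + y) = kre x + kre y.
Proof. by rewrite /kre rmorphD; case: (iota x) (iota y) => [? ?] []. Qed.

Let kimD x y : kim (x + y) = kim x + kim y.
Proof. by rewrite /kim rmorphD; case: (iota x) (iota y) => [? ?] []. Qed.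

Let kreM x y : kre (x * y) = kre x * kre y - kim x * kim y.
Proof. by rewrite /kre /kim rmorphM; case: (iota x) (iota y) => [? ?] []. Qed.

Let kimM x y : kim (x * y) = kre x * kim y + kim x * kre y.
Proof. by rewrite /kre /kim rmorphM; case: (iota x) (iota y) => [? ?] []. Qed.

Let kre1 : kre 1 = 1. Proof. by rewrite /kre rmorph1. Qed.
Let kim1 : kim 1 = 0. Proof. by rewrite /kim rmorph1. Qed.

Lemma quadratic_span u : kim u != 0 -> forall x, exists p q, x = p%:A + q *: u.
Proof.
move=> u0 x; have u_neq0 : u != 0.
  by apply: contra u0 => /eqP ->; rewrite /kim rmorph0.
have fr : free [:: 1; u].
  rewrite free_cons seq1_free u_neq0 andbT span_seq1; apply/negP => /vlineP[c e].
  have := congr1 kim e; rewrite kim1 kimZ => /esym/eqP.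
  rewrite mulf_eq0 (negbTE u0) orbF fmorph_eq0 => /eqP c0.
  by move: e; rewrite c0 scale0r => /eqP; rewrite oner_eq0.
have bs : basis_of fullv [:: 1; u].
  by rewrite basisEfree fr subvf /= K_quadratic.
have : x \in span [:: 1; u] by rewrite (span_basis bs) memvf.
rewrite span_cons span_seq1 => /memv_addP[_ /vlineP[p ->] [_ /vlineP[q ->] ->]].
by exists p, q.
Qed.

(** A nonreal [u] satisfies [u ^ 2 = p + q u] with [p] and [q] rational; the
    imaginary part of this equation gives twice the real part of [u], its real
    part gives the norm, and every [x] is a combination of 1 and [u]. *)
Lemma quadratic_trace_norm x : exists p q,
  2 * kre x = ratr p /\ kre x ^+ 2 + kim x ^+ 2 = ratr q.
Proof.
have [u u0] := K_imaginary; rewrite -/(kim u) in u0.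
have [p [q e]] := quadratic_span u0 (u * u).
have e1 := congr1 kre e; have e2 := congr1 kim e.
rewrite kreM kreD !kreZ kre1 mulr1 in e1; rewrite kimM kimD !kimZ kim1 mulr0 add0r in e2.
have ru : kre u = ratr q / 2.
  by apply: (mulIf u0); lra.
have [a [b ->]] := quadratic_span u0 x.
exists (2 * a + b * q), (a ^+ 2 + a * b * q - b ^+ 2 * p).
rewrite !kreD !kimD !kreZ !kimZ kre1 kim1 !rmorphB !rmorphD !rmorphM /=.
have -> : ratr 2 = 2 :> R by rewrite ratr_nat.
split; first by rewrite ru; field.
have iu : kim u ^+ 2 = kre u ^+ 2 - ratr p - ratr q * kre u by lra.
by rewrite mulr0 add0r exprMn iu ru; field.
Qed.

Lemma quadratic_conj x : exists y, iota y = (iota x)^*.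
Proof.
have [p [q [e1 _]]] := quadratic_trace_norm x.
exists (p%:A - x); rewrite rmorphB rmorphZ_num rmorph1 mulr1 ratr_complex -e1 /kre.
by case: (iota x) => s t /=; apply/eqP; rewrite eq_complex /=; apply/andP; split;
  apply/eqP; ring.
Qed.

(** Transported to the algebraic numbers, where rational algebraic integers are
    known to be integers. *)
Lemma rat_integral p : integralOver (intr : int -> K) p%:A ->
  exists m : int, p = m%:~R.
Proof.
move=> [f fm froot].
have rt : root (map_poly (intr : int -> algC) f) (ratr p).
  have E : map_poly (intr : int -> K) f = map_poly (in_alg K) (map_poly (intr : int -> rat) f).
    by rewrite -map_poly_comp; apply: eq_map_poly => m ; rewrite /= -(rmorph_int (in_alg K)).
  have : root (map_poly (intr : int -> rat) f) p by rewrite E fmorph_root in froot.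
  rewrite -(fmorph_root (ratr : {rmorphism rat -> algC})) -map_poly_comp.
  by rewrite (eq_map_poly (g := intr)) // => m /=; rewrite ratr_int.
have pA : (ratr p : algC) \in Aint.
  apply: root_monic_Aint rt _ _; first exact: monic_map.
  by apply/polyOverP => i; rewrite coef_map /= intr_int.
have := Cint_rat_Aint (Crat_rat p) pA => /intrP[m e].
exists m; apply: (fmorph_inj (ratr : {rmorphism rat -> algC})).
by rewrite /= e ratr_int.
Qed.

Lemma OK_rational a p : OKval a = p%:A -> exists m : int, a = m%:~R.
Proof.
move=> e; have /asboolP : OKval a \in @algint K by case: (a).
rewrite e => /rat_integral[m pm]; exists m; apply: val_inj; rewrite rmorph_int /= e pm.
by rewrite -(rmorph_int (in_alg K)).
Qed.

Lemma integral_conj x y : iota y = (iota x)^* ->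
  integralOver (intr : int -> K) x -> integralOver (intr : int -> K) y.
Proof.
move=> yx [f fm froot]; exists f => //.
have E g : map_poly iota (map_poly (intr : int -> K) g) = map_poly intr g.
  by rewrite -map_poly_comp; apply: eq_map_poly => m /=; rewrite rmorph_int.
rewrite -(fmorph_root iota) E yx; rewrite -(fmorph_root iota) E in froot.
rewrite -[X in root X _](_ : map_poly conjc (map_poly intr f) = _).
  by rewrite fmorph_root.
by rewrite -map_poly_comp; apply: eq_map_poly => m /=; rewrite rmorph_int.
Qed.

Lemma OK_conj a : exists b : OK K, iota (OKval b) = (iota (OKval a))^*.
Proof.
have [y yx] := quadratic_conj (OKval a).
have ya : y \in @algint K.
  apply/asboolP; apply: integral_conj yx _; apply/asboolP; by case: (a).
by exists (MkOK ya).
Qed.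

Lemma OK_norm a : exists n : nat, n%:R = kre (OKval a) ^+ 2 + kim (OKval a) ^+ 2.
Proof.
have [b ba] := OK_conj a; have [p [q [_ e]]] := quadratic_trace_norm (OKval a).
have [m abm] : exists m : int, a * b = m%:~R.
  apply: (@OK_rational _ q); apply: (fmorph_inj iota).
  rewrite rmorphM ba rmorphZ_num rmorph1 mulr1 ratr_complex -e /kre /kim.
  by case: (iota _) => s t /=; apply/eqP; rewrite eq_complex /=; apply/andP; split;
    apply/eqP; ring.
have mE : m%:~R = kre (OKval a) ^+ 2 + kim (OKval a) ^+ 2.
  have vab : \val a * \val b = m%:~R :> K by rewrite -rmorphM abm rmorph_int.
  have := congr1 kre vab; rewrite /= kreM /kre /kim ba rmorph_int.
  rewrite (_ : complex.Re (m%:~R : R[i]) = m%:~R); last first.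
    by rewrite -(rmorph_int (real_complex R)).
  by move=> <-; case: (iota _) => s t /=; ring.
have m0 : 0 <= m by rewrite -(ler0z R) mE addr_ge0 ?sqr_ge0.
by exists `|m|%N; rewrite -mE natr_absz ger0_norm.
Qed.



Lemma OK_trace a : exists m : int, m%:~R = 2 * kre (OKval a).
Proof.
have [b ba] := OK_conj a; have [p [q [e _]]] := quadratic_trace_norm (OKval a).
have [m abm] : exists m : int, a + b = m%:~R.
  apply: (@OK_rational _ p); apply: (fmorph_inj iota).
  rewrite rmorphD ba rmorphZ_num rmorph1 mulr1 ratr_complex -e /kre.
  by case: (iota _) => s t /=; apply/eqP; rewrite eq_complex /=; apply/andP; split;
    apply/eqP; ring.
exists m; have vab : \val a + \val b = m%:~R :> K by rewrite -rmorphD abm rmorph_int.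
have := congr1 kre vab; rewrite /= kreD /kre ba rmorph_int.
rewrite (_ : complex.Re (m%:~R : R[i]) = m%:~R); last first.
  by rewrite -(rmorph_int (real_complex R)).
by move=> <-; case: (iota _) => s t /=; ring.
Qed.

(** It is minus the discriminant [t ^ 2 - 4 n] of the characteristic polynomial of
    [a]. This discreteness of imaginary parts gives a least one below. *)
Lemma OK_four_im_sqr a : exists n : nat, n%:R = 4 * kim (OKval a) ^+ 2.
Proof.
have [n nE] := OK_norm a; have [m mE] := OK_trace a.
have E : (4 * n%:Z - m ^+ 2)%:~R = 4 * kim (OKval a) ^+ 2 :> R.
  by rewrite rmorphB rmorphM rmorphXn /= mE -pmulrn nE; ring.
have k0 : 0 <= 4 * n%:Z - m ^+ 2 by rewrite -(ler0z R) E mulr_ge0 ?sqr_ge0.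
case: (4 * n%:Z - m ^+ 2) E k0 => // r E _; by exists r; rewrite -E.
Qed.

Lemma integral_quadratic x (P Q : int) : x * x = P%:~R + Q%:~R * x ->
  integralOver (intr : int -> K) x.
Proof.
move=> e; have f1 : last (0 : int) [:: - P; - Q; 1] != 0 by [].
exists (Poly [:: - P; - Q; 1]).
  by rewrite monicE lead_coefE (PolyK (c := 0)).
rewrite map_Poly_id0 ?rmorph0 // /root horner_Poly /= !rmorphN rmorph1.
apply/eqP; rewrite mul0r add0r mulrDl mul1r e; ring.
Qed.

(** If [u ^ 2 = p + q u] and [d] is a common denominator of [p] and [q], then [d u]
    is a root of a monic polynomial with integral coefficients. *)
Lemma OK_nonreal : exists a : OK K, kim (OKval a) != 0.
Proof.
have [u u0] := K_imaginary; rewrite -/(kim u) in u0.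
have [p [q e]] := quadratic_span u0 (u * u).
pose d := denq p * denq q; pose v := d%:~R * u.
have d0 : d != 0 by rewrite mulf_neq0 // denq_neq0.
have vi : v \in @algint K.
  apply/asboolP; apply: (@integral_quadratic _ (numq p * denq p * denq q ^+ 2) (denq p * numq q)).
  have ratE (r : rat) : (denq r)%:~R * r%:A = (numq r)%:~R :> K.
    rewrite -(rmorph_int (in_alg K)) -rmorphM /= -[X in _ * X](divq_num_den r).
    by rewrite mulrCA mulfV ?mulr1 ?intr_eq0 ?denq_neq0 // -(rmorph_int (in_alg K)).
  rewrite /v mulrACA e !rmorphM /= -(ratE p) -(ratE q) -[q *: u]mulr_algl.
  ring.
exists (MkOK vi); rewrite /= /v kimM.
have -> : kre d%:~R = d%:~R.
  by rewrite /kre rmorph_int -(rmorph_int (real_complex R)).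
have -> : kim d%:~R = 0.
  by rewrite /kim rmorph_int -(rmorph_int (real_complex R)).
by rewrite mul0r addr0 mulf_neq0 // intr_eq0.
Qed.

Lemma OK_minimal : exists t : OK K, 0 < kim (OKval t) /\
  forall a, 0 < kim (OKval a) -> kim (OKval t) <= kim (OKval a).
Proof.
pose Q := fun n : nat => `[< (0 < n)%N /\
  exists a : OK K, 0 < kim (OKval a) /\ n%:R = 4 * kim (OKval a) ^+ 2 >].
have Qa a : 0 < kim (OKval a) -> exists2 n, Q n & n%:R = 4 * kim (OKval a) ^+ 2.
  move=> a0; have [n nE] := OK_four_im_sqr a; exists n => //; apply/asboolP; split.
    by rewrite -(ltr0n R) nE mulr_gt0 // exprn_gt0.
  by exists a.
have Qex : exists n, Q n.
  have [a] := OK_nonreal; rewrite neq_lt => /orP[a0|a0].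
    have : 0 < kim (OKval (- a)).
      have -> : OKval (- a) = - OKval a by rewrite -[LHS]/(\val (- a)) rmorphN.
      by rewrite -scaleN1r kimZ rmorphN rmorph1; lra.
    by move=> /Qa[n Qn _]; exists n.
  by have [n Qn _] := Qa a a0; exists n.
have [n /asboolP[n0 [t [t0 tE]]] nmin] := ex_minnP Qex.
exists t; split=> // a a0; have [m Qm mE] := Qa a a0.
rewrite -(ler_pXn2r (ltn0Sn 1)) ?nnegrE ?(ltW t0) ?(ltW a0) //.
have : n%:R <= m%:R :> R by rewrite ler_nat nmin.
by rewrite tE mE; lra.
Qed.

(** Euclidean division of imaginary parts by the least positive one leaves a real
    algebraic integer, which is rational, hence an integer. *)
Lemma OK_coordinates (t : OK K) : 0 < kim (OKval t) ->
  (forall a, 0 < kim (OKval a) -> kim (OKval t) <= kim (OKval a)) ->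
  forall a, exists ij : int * int, a = ij.1%:~R + ij.2%:~R * t.
Proof.
move=> t0 tmin a; pose j := Num.floor (kim (OKval a) / kim (OKval t)).
pose b := a - j%:~R * t.
have bE : OKval b = OKval a - j%:~R *: OKval t.
  rewrite -[LHS]/(\val (a - j%:~R * t)) rmorphB rmorphM rmorph_int /=.
  by rewrite -[in RHS]mulr_algl -(rmorph_int (in_alg K)).
have imb : kim (OKval b) = kim (OKval a) - j%:~R * kim (OKval t).
  by rewrite bE -scaleN1r kimD !kimZ rmorphN rmorph1 ratr_int; ring.
have /andP[h1 h2] := floor_itv (kim (OKval a) / kim (OKval t)).
rewrite -/j ler_pdivlMr // in h1; rewrite -/j ltr_pdivrMr // rmorphD /= mulrDl mul1r in h2.
have b0 : kim (OKval b) = 0.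
  apply/eqP; rewrite eq_le; apply/andP; split; last by rewrite imb subr_ge0.
  by rewrite leNgt; apply/negP => /tmin; rewrite imb; lra.
have [u u0] := K_imaginary; rewrite -/(kim u) in u0.
have [p [q e]] := quadratic_span u0 (OKval b).
have q0 : q = 0.
  have := congr1 kim e; rewrite b0 kimD !kimZ kim1 mulr0 add0r => /esym/eqP.
  by rewrite mulf_eq0 (negbTE u0) orbF fmorph_eq0 => /eqP.
have [i bi] : exists i : int, b = i%:~R.
  by apply: (@OK_rational _ p); rewrite e q0 scale0r addr0.
by exists (i, j); rewrite /= -bi /b subrK.
Qed.

Lemma OK_quad_order : exists L : quad_order R (OK K),
  forall a, emb L a = iota (OKval a).
Proof.
have [t [t0 tmin]] := OK_minimal.
have co := OK_coordinates t0 tmin.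
have conj_ex a : exists b : OK K, a * b = (sval (cid (OK_norm a)))%:R.
  have [b ba] := OK_conj a; exists b; apply: val_inj.
  rewrite rmorphM rmorph_nat /=; apply: (fmorph_inj iota).
  rewrite rmorphM ba rmorph_nat; case: (cid _) => n /= nE.
  rewrite -(rmorph_nat (real_complex R)) nE /kre /kim.
  by case: (iota _) => x y /=; apply/eqP; rewrite eq_complex /=; apply/andP; split;
    apply/eqP; ring.
unshelve eexists.
  apply: (@QuadOrder R (OK K) (iota \o (\val : OK K -> K)) t
    (fun a => (sval (cid (co a))).1) (fun a => (sval (cid (co a))).2) _ _
    (fun a => sval (cid (OK_norm a))) _ (fun a => sval (cid (conj_ex a))) _).
  - by move=> a; case: (cid _).
  - exact: t0.
  - by move=> a; case: (cid (OK_norm a)).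
  - by move=> a; case: (cid (conj_ex a)).
by [].
Qed.



(** The rows of [B] express the products [e i * x] in the basis; [x] and its
    conjugate are the eigenvalues of [B], with eigenvectors the images of the
    basis under the two embeddings. The eigenvector equations are solved for the
    trace by Cramer's rule, and [Dl], the area spanned by the basis, is not 0
    because 1 and [u] are combinations of the basis. *)
Lemma trace_basis (d : nat) (B : 'M[rat]_d) (e : 'I_d -> K) x : d = 2%N ->
  (forall i, e i * x = \sum_j B i j *: e j) ->
  (forall y, exists c : 'I_d -> rat, y = \sum_i c i *: e i) ->
  ratr (\tr B) = 2 * kre x.
Proof.
move=> d2; subst d => eB span.
pose i0 : 'I_2 := ord0; pose i1 : 'I_2 := lift ord0 ord0.
have sum2 (V : nmodType) (f : 'I_2 -> V) : \sum_i f i = f i0 + f i1.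
  by rewrite big_ord_recl big_ord_recl big_ord0 addr0.
pose Dl := kre (e i0) * kim (e i1) - kre (e i1) * kim (e i0).
have Dl0 : Dl != 0.
  have [u u0] := K_imaginary; rewrite -/(kim u) in u0.
  have [c c1] := span 1; have [c' cu] := span u.
  apply: contra u0 => /eqP D0.
  have r1 := congr1 kre c1; have m1 := congr1 kim c1; have ru := congr1 kre cu; have mu := congr1 kim cu.
  rewrite sum2 kreD !kreZ in ru; rewrite sum2 kimD !kimZ in mu.
  rewrite sum2 kreD !kreZ kre1 in r1; rewrite sum2 kimD !kimZ kim1 in m1.
  have : kim u * 1 - kre u * 0 = 0.
    rewrite {1}r1 {1}m1 ru mu.
    transitivity ((ratr (c i0) * ratr (c' i1) - ratr (c i1) * ratr (c' i0)) * Dl).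
      by rewrite /Dl; ring.
    by rewrite D0 mulr0.
  by rewrite mulr1 mulr0 subr0 => ->.
have r0 := congr1 kre (eB i0); have m0 := congr1 kim (eB i0).
have r1 := congr1 kre (eB i1); have m1 := congr1 kim (eB i1).
rewrite sum2 kreD !kreZ kreM in r0; rewrite sum2 kimD !kimZ kimM in m0.
rewrite sum2 kreD !kreZ kreM in r1; rewrite sum2 kimD !kimZ kimM in m1.
apply: (mulIf Dl0); rewrite /mxtrace sum2 rmorphD /=.
transitivity (kim (e i1) * (ratr (B i0 i0) * kre (e i0) + ratr (B i0 i1) * kre (e i1))
  - kre (e i1) * (ratr (B i0 i0) * kim (e i0) + ratr (B i0 i1) * kim (e i1))
  + kre (e i0) * (ratr (B i1 i0) * kim (e i0) + ratr (B i1 i1) * kim (e i1))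
  - kim (e i0) * (ratr (B i1 i0) * kre (e i0) + ratr (B i1 i1) * kre (e i1))).
  by rewrite /Dl; ring.
by rewrite -r0 -m0 -r1 -m1 /Dl; ring.
Qed.

Lemma trK_re x : ratr (trK x) = 2 * kre x.
Proof.
pose e : 'I_(\dim {:K}) -> K := fun i => (vbasis {:K})`_i.
apply: (trace_basis (e := e)) => // [i|y].
  rewrite [LHS](coord_basis (vbasisP {:K})) ?memvf //; apply: eq_bigr => j _.
  by rewrite !mxE /= passmx.vecof_delta lfunE.
exists (fun i => coord (vbasis {:K}) i y).
by rewrite [LHS](coord_basis (vbasisP {:K})) ?memvf.
Qed.

Lemma det_mx22 (F : comNzRingType) (T : 'M[F]_2) :
  \det T = T ord0 ord0 * T (lift ord0 ord0) (lift ord0 ord0)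
         - T ord0 (lift ord0 ord0) * T (lift ord0 ord0) ord0.
Proof.
rewrite (expand_det_row _ ord0) big_ord_recl big_ord_recl big_ord0 addr0.
rewrite /cofactor !det_mx11 !mxE /= expr0 mul1r expr1 mulN1r mulrN.
by congr (_ * T _ _ - _ * T _ _); apply: val_inj.
Qed.

(** The trace form has determinant [- 4 Dl ^ 2] in the basis [w], where [Dl] is the
    oriented area of the parallelogram spanned by [w]. This area is the one of
    [(1, tau)] times the determinant [m] of an integral matrix, whose inverse
    expresses [(1, tau)] in the basis [w] and is integral too. *)
Lemma integral_basis_disc (L : quad_order R (OK K)) (d : nat) (w : 'I_d -> OK K) :
  (forall a, emb L a = iota (OKval a)) -> d = 2%N -> integral_basis w ->
  `|ratr (\det (\matrix_(i, j) trK (OKval (w i) * OKval (w j)))) : R| =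
  (2 * covol L) ^+ 2.
Proof.
move=> L_emb d2; subst d => wb.
pose i0 : 'I_2 := ord0; pose i1 : 'I_2 := lift ord0 ord0.
have sum2 (V : nmodType) (f : 'I_2 -> V) : \sum_i f i = f i0 + f i1.
  by rewrite big_ord_recl big_ord_recl big_ord0 addr0.
rewrite det_mx22 -/i0 -/i1 rmorphB !rmorphM /= !mxE !trK_re !kreM.
pose x i := kre (OKval (w i)); pose y i := kim (OKval (w i)).
pose Dl := x i0 * y i1 - x i1 * y i0.
rewrite -!/(x _) -!/(y _).
rewrite (_ : _ - _ = - (2 * Dl) ^+ 2); last by rewrite /Dl; ring.
rewrite normrN ger0_norm ?sqr_ge0 // !exprMn; congr (_ * _).
pose m := scoord L (w i0) * tcoord L (w i1) - scoord L (w i1) * tcoord L (w i0).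
have xE i : x i = (scoord L (w i))%:~R + (tcoord L (w i))%:~R * re L (tau L).
  by rewrite -re_pt -ptE /re L_emb.
have yE i : y i = (tcoord L (w i))%:~R * covol L.
  by rewrite -(im_pt L (scoord L (w i))) -ptE /im L_emb.
have DlE : Dl = m%:~R * covol L.
  by rewrite /Dl !xE !yE /m rmorphB !rmorphM /=; ring.
have [c [c1 _]] := wb 1; have [c' [ct _]] := wb (tau L).
have zE (a : OK K) (n : int) : re L (a *~ n) = n%:~R * re L a /\
    im L (a *~ n) = n%:~R * im L a.
  rewrite -mulrzl; have n0 := re_pt L n 0; have n1 := im_pt L n 0.
  rewrite /pt mul0r addr0 mul0r in n0 n1; rewrite addr0 in n0.
  by rewrite reM imM n0 n1; split; ring.
have wre i : re L (w i) = x i by rewrite /re L_emb.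
have wim i : im L (w i) = y i by rewrite /im L_emb.
have cr := congr1 (re L) c1; have ci := congr1 (im L) c1.
have ti := congr1 (im L) ct; have tr := congr1 (re L) ct.
rewrite sum2 reD !(zE _ _).1 !wre re1 in cr.
rewrite sum2 imD !(zE _ _).2 !wim im1 in ci.
rewrite sum2 imD !(zE _ _).2 !wim -/(covol L) in ti.
rewrite sum2 reD !(zE _ _).1 !wre in tr.
pose n := c 0 i0 * c' 0 i1 - c 0 i1 * c' 0 i0.
have mn : n * m = 1.
  apply: (@intr_inj R); apply: (mulIf (lt0r_neq0 (covol_gt0 L))).
  rewrite rmorphM -mulrA -DlE mul1r.
  have : covol L * 1 - re L (tau L) * 0 = covol L by ring.
  rewrite {1}cr {1}ci {1}ti tr /n rmorphB !rmorphM /= /Dl => <-; ring.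
have m2 : m ^+ 2 = 1.
  have : m \is a GRing.unit by apply/unitrP; exists n; split; rewrite // mulrC.
  by rewrite /GRing.unit /= qualifE /= => /orP[] /eqP ->.
by rewrite DlE exprMn -rmorphXn m2 mul1r.
Qed.

Lemma integral_basis_exists (L : quad_order R (OK K)) (d : nat) : d = 2%N ->
  exists w : 'I_d -> OK K, integral_basis w.
Proof.
move=> d2; subst d; exists (fun i => if i == ord0 then 1 else tau L) => a.
have sum2 (c : 'rV[int]_2) : \sum_i (if i == ord0 then 1 else tau L) *~ c 0 i =
   pt L (c 0 ord0) (c 0 (lift ord0 ord0)).
  by rewrite big_ord_recl big_ord_recl big_ord0 addr0 /= /pt mulrzl.
exists (\row_j if j == ord0 then scoord L a else tcoord L a); split.
  by rewrite sum2 !mxE -ptE.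
move=> c; rewrite sum2 {1}(ptE L a) => /pt_inj[-> ->].
apply/rowP => j; rewrite mxE; case: eqP => [->//|/eqP j0].
by congr (c 0 _); apply: val_inj; case: j j0 => [[|[|]]].
Qed.

Lemma disc_covol (L : quad_order R (OK K)) :
  (forall a, emb L a = iota (OKval a)) ->
  Num.sqrt (ratr `|disc K|) = 2 * covol L.
Proof.
move=> L_emb; have [w wb] := integral_basis_exists L K_quadratic.
have [w' [w'b dE]] : [set d : rat | exists w : 'I_(\dim {:K}) -> OK K,
    integral_basis w /\ d = \det (\matrix_(i, j) trK (OKval (w i) * OKval (w j)))]
    (disc K).
  by apply: xgetPex; eexists; exists w.
rewrite ratr_norm dE (integral_basis_disc L_emb K_quadratic w'b) sqrtr_sqr ger0_norm //.
by rewrite mulr_ge0 // ltW // covol_gt0.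
Qed.

End ImaginaryQuadratic.

(** * The sum over a sector *)

(** The sector is the cone of directions centred at the argument of [z]. *)
Lemma sector_cone (R : realType) (A : comNzRingType) (L : quad_order R A)
    (z : R[i]) (theta : R) : z != 0 ->
  exists al : R, forall x,
    [set a : A | sector z theta x (emb L a)] =
    cone L (al - theta / 2) (al + theta / 2) x.
Proof.
move=> z0; have [|al [r [_ r0 e1 e2]]] := @polar R (complex.Re z) (complex.Im z).
  by apply: contra z0 => /eqP[r0 i0]; rewrite eq_complex r0 i0 !eqxx.
have zE : z = (r * cos al) +i* (r * sin al) by rewrite -e1 -e2; case: (z).
have nz : complex.Re `|z| = r.
  rewrite normc_def /= e1 e2 !exprMn -mulrDr cos2Dsin2 mulr1 sqrtr_sqr.
  by rewrite ger0_norm // ltW.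
exists al => x; apply/seteqP; split=> a; rewrite /sector /cone nz /=.
  move=> [t [rho [/andP[t1 t2] /andP[h1 h2] ae]]]; exists (t + al), (rho * r).
  split.
  - by apply/andP; split; lra.
  - by rewrite mulr_gt0 //= -ler_pdivlMr.
  - by rewrite /re ae zE /= cosD; ring.
  - by rewrite /im ae zE /= sinD; ring.
move=> [t [rho [/andP[t1 t2] /andP[h1 h2] e3 e4]]]; exists (t - al), (rho / r).
split.
- by apply/andP; split; lra.
- by rewrite divr_gt0 //= ler_pM2r ?invr_gt0.
- have ct : cos t = cos (t - al) * cos al - sin (t - al) * sin al.
    by rewrite -cosD subrK.
  have st : sin t = sin (t - al) * cos al + cos (t - al) * sin al.
    by rewrite -sinD subrK.
  apply/eqP; rewrite eq_complex -/(re L a) -/(im L a) e3 e4 zE /= ct st.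
  by apply/andP; split; apply/eqP; field; rewrite gt_eqF.
Qed.

Theorem theorem1p3 (R : realType) (K : fieldExtType rat)
    (iota : {rmorphism K -> R[i]})
    (K_quadratic : \dim {:K} = 2%N)
    (K_imaginary : exists u : K, complex.Im (iota u) != 0)
    (OK_principal : is_principal_ring (OK K))
    (z : R[i]) (z_neq0 : z != 0)
    (theta : R) (theta_bounds : 0 < theta <= 2 * pi)
    (k : OK K) :
  (fun x : R =>
     \sum_(a \in [set a : OK K | sector z theta x (iota (OKval a))])
       ((phi a * phi (a + k)%R)%N%:R : R))
  ~_ (pinfty_nbhs R)
  (fun x : R =>
     theta / (3 * Num.sqrt (ratr `|disc K|))
     * unordered_prod (@nz_prime_ideals (OK K))
         (fun p => 1 - 2 / (idealN p)%:R ^+ 2)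
     * unordered_prod
         [set p | @nz_prime_ideals (OK K) p /\ ideal_dvd p (pideal k)]
         (fun p => 1 + ((idealN p)%:R * ((idealN p)%:R ^+ 2 - 2))^-1)
     * x ^+ 6).
Proof.
have [L L_emb] := OK_quad_order K_quadratic K_imaginary.
have [l1 l1_gt0 cvg1] := euler_product_primes_cvg L OK_principal.
have [l2 l2_gt0 cvg2] := euler_product_dvd_cvg L OK_principal k.
have -> : unordered_prod (@nz_prime_ideals (OK K))
    (fun p => 1 - 2 / (idealN p)%:R ^+ 2) = l1 by exact: (cvg_lim (@Rhausdorff R) cvg1).
have -> : unordered_prod [set p | @nz_prime_ideals (OK K) p /\ ideal_dvd p (pideal k)]
    (fun p => 1 + ((idealN p)%:R * ((idealN p)%:R ^+ 2 - 2))^-1) = l2.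
  by exact: (cvg_lim (@Rhausdorff R) cvg2).
rewrite (disc_covol K_quadratic K_imaginary L_emb).
have [al sectorE] := sector_cone L theta z_neq0.
have I_gt0 := covol_gt0 L.
case/andP: theta_bounds => theta_gt0 theta_le.
set c := theta / (3 * (2 * covol L)) * l1 * l2.
have c_gt0 : 0 < c by rewrite !mulr_gt0 // invr_gt0 !mulr_gt0.
apply/eqaddoP => eps eps_gt0.
have ab : al - theta / 2 <= al + theta / 2 by lra.
have ba : al + theta / 2 - (al - theta / 2) <= 2 * pi by lra.
have [D HD] := phi_correlation_sum L OK_principal cvg1 cvg2 ab ba
  (mulr_gt0 (mulr_gt0 eps_gt0 c_gt0) (ltac:(lra) : 0 < 1 / 2)).
(* Beyond this threshold [D x ^ 5] is at most half of the allowed error. *)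
exists (Num.max 1 (2 * `|D| / (eps * c))); split; first exact: num_real.
move=> x; rewrite gt_max => /andP[/ltW x_ge1 /ltW x_ge].
have x_gt0 : 0 < x by lra.
have := HD x x_ge1.
have -> : (al + theta / 2 - (al - theta / 2)) / (6 * covol L) * l1 * l2 = c.
  by rewrite /c; field; rewrite gt_eqF.
rewrite -sectorE /= => h.
rewrite [X in `|X|](_ : _ = \sum_(a \in [set a | sector z theta x (emb L a)])
    ((phi a * phi (a + k)%R)%N%:R : R) - c * x ^+ 6); last first.
  suff -> : [set a | sector z theta x (emb L a)] =
    [set a : OK K | sector z theta x (iota (OKval a))] by [].
  by apply: eq_set => a; rewrite L_emb.
apply: le_trans h _; rewrite [leRHS](_ : _ = eps * c * x ^+ 6); last first.
  rewrite -mulrA -/c ger0_norm //; apply: mulr_ge0; first exact: ltW.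
  by rewrite exprn_ge0 // ltW.
have x5 : 0 <= x ^+ 5 by rewrite exprn_ge0 // ltW.
have ec : 0 < eps * c by rewrite mulr_gt0.
have : D * x ^+ 5 <= eps * c / 2 * x ^+ 6.
  rewrite [x ^+ 6]exprS mulrA ler_wpM2r //; apply: le_trans (ler_norm _) _.
  by move: x_ge; rewrite ler_pdivrMr //; lra.
lra.
Qed.
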